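(* Let $f$, $X$, $\rho_0$, $\mathcal L_0$ be as in the context, and assume that $c$ is preperiodic: $c_{n_0}$ is periodic of minimal period $n_1\ge1$, where $n_0\ge2$ is minimal with $c_{n_0}$ periodic. Let $\varphi\in C^1([a_0,b])$ and let $$\Psi(z)=\sum_{n=0}^\infty\int_{a_0}^b z^n\mathcal L_0^n(\rho_0X)(x)\varphi'(x)\,dx ,$$ which extends meromorphically to a disc of radius $>1$. (1) If $\mathcal J^{n_1,n_0}_m=0$ for $m=n_0,\dots,n_0+n_1-1$, then $\Psi(z)$ is holomorphic in a disc of radius strictly larger than one, with $$\Psi(1)=\lim_{z\to1}\Psi(z)\quad\text{and}\quad \Psi(1)=\lim_{k\to\infty}\sum_{n=0}^k\int_{a_0}^b\mathcal L_0^n(X\rho_0)(x)\varphi'(x)\,dx .$$ (2) The residue of $\Psi(z)$ at $z=1$, understood as the coefficient of $\frac1{1-z}$ in the principal part of the (at most simple) pole at $z=1$, is $$\mathcal J(f,X)\Bigl(\int\varphi\rho_0\,dx-\frac1{n_1}\sum_{j=n_0}^{n_0+n_1-1}\varphi(c_j)\Bigr).$$ In particular, if $\mathcal J(f,X)=0$ then $\Psi(z)$ is holomorphic at $z=1$ with $\Psi(1)=\lim_{z\in[0,1),\,z\to1}\Psi(z)$.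
   Context: Setting. Let $a<c<b$, $I=[a,b]$, and let $f:I\to I$ be continuous such that: (i) $f$ is strictly increasing on $I_+=[a,c]$ and strictly decreasing on $I_-=[c,b]$; (ii) for $\sigma=\pm$, $f|_{I_\sigma}$ extends to a $C^3$ map on a neighbourhood of $I_\sigma$ and $\inf|f'|_{I_\sigma}|>1$; (iii) $c$ is not periodic under $f$; (iv) $f$ is topologically mixing on $[f^2(c),f(c)]$. Write $c_k=f^k(c)$. $f$ has a unique absolutely continuous invariant probability measure; its density $\rho_0$ is of bounded variation, is extended by $0$ to $\mathbb R$ (it is supported in $[c_2,c_1]$), and is taken with only regular discontinuities (at each $x$, $2\rho_0(x)$ is the sum of the left and right limits). Inverse branches. $J=(-\infty,f(c)]$; $\chi=1$ on the interior of $J$, $\chi(f(c))=1/2$, $\chi=0$ outside $J$. The two inverse branches of $f$ are extended to $C^3$ maps $\psi_+:J\to(-\infty,c]$ (strictly increasing, onto) and $\psi_-:J\to[c,\infty)$ (strictly decreasing, onto) with $\sup|\psi_\pm'|<1$. $a_0\le a$ denotes the unique fixed point of $\psi_+$. Operator. $\mathcal L_0\varphi(x)=\chi(x)\varphi(\psi_+(x))-\chi(x)\varphi(\psi_-(x))$. Perturbation field. $X:\mathbb R\to\mathbb R$ satisfies $\sup|X|\le1$, $X|_{f(I)}$ extends to a $C^2$ function in a neighbourhood of $f(I)$, and $X'$ (derivative in the sense of distributions) is a function of bounded variation supported in $[a,b]$. It is assumed that for small $|t|$ (possibly one-sided: only $t\ge0$ or only $t\le0$) the map $f_t=f+tX\circ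 f$ sends $I$ into itself. Jumps. For $1\le n\le n_0+n_1-1$ let $s_n=\lim_{y\downarrow c_n}\rho_0(y)-\lim_{x\uparrow c_n}\rho_0(x)$. The weighted total jump is $\mathcal J(f,X)=\sum_{n=1}^{n_0+n_1-1}s_nX(c_n)$. If $n_1=1$, put $\mathcal J^{1,n_0}_{n_0}=\mathcal J(f,X)=\sum_{k=1}^{n_0}X(c_k)s_k$. If $n_1\ge2$, for $m=n_0,\dots,n_0+n_1-1$ put $$\mathcal J^{n_1,n_0}_m=\sum_{\substack{1\le k\le n_0+n_1-1:\\ \exists\,\ell\ge0:\ k+n_0-1-\ell n_1=m}}X(c_k)s_k .$$ $C^1([a_0,b])$ is the set of functions on $[a_0,b]$ which extend to $C^1$ functions in an open neighbourhood of $[a_0,b]$. The power series $\Psi$ converges in the open unit disc. *)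

(* Defs.v *)
From HB Require Import structures.
From mathcomp Require Import all_boot all_order all_algebra.
From mathcomp Require Import all_classical all_reals all_analysis.
From mathcomp Require Export complex.

Set Implicit Arguments.
Unset Strict Implicit.
Unset Printing Implicit Defensive.

Import Order.TTheory GRing.Theory Num.Theory.
Import numFieldNormedType.Exports.

Local Open Scope classical_set_scope.
Local Open Scope ring_scope.
Local Open Scope complex_scope.

(* The usual normed topology of the complex numbers: R[i] as a normed space
   over itself, so that [derivable F z 1] below is complex differentiability. *)
#[warnings="-redundant-canonical-projection"]
HB.instance Definition _ (R : realType) := NormedModule.copy R[i] R[i]^o.

Section RealFunctions.
Context {R : realType}.
Implicit Types (f g h X rho : R -> R) (A U V : set R).

Definition Ck_on (k : nat) U g : Prop :=
  (forall i x, (i < k)%N -> U x -> derivable (derive1n i g) x 1) /\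
  (forall x, U x -> {for x, continuous (derive1n k g)}).

(* [h] is a C^k extension of [g|_A] to a neighbourhood of [A]; the values of
   [h] away from that neighbourhood are irrelevant. *)
Definition Ck_extension (k : nat) A g h : Prop :=
  (forall x, A x -> h x = g x) /\
  exists U, [/\ open U, A `<=` U & Ck_on k U h].

Definition extends_Ck (k : nat) A g : Prop := exists h, Ck_extension k A g h.

(* On a nondegenerate interval [A] the derivative of the extension [h] at points
   of [A] is the (possibly one-sided) derivative of [g|_A]. *)
Definition expanding_C3 A g : Prop :=
  exists h, Ck_extension 3 A g h /\
    (1 < ereal_inf [set `|derive1 h x|%:E | x in A])%E.

Definition contracting_C3 A g : Prop :=
  exists h, Ck_extension 3 A g h /\
    (ereal_sup [set `|derive1 h x|%:E | x in A] < 1)%E.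

Definition topologically_mixing f A : Prop :=
  forall U V, open U -> open V -> U `&` A !=set0 -> V `&` A !=set0 ->
    \forall n \near \oo, exists x, (U `&` A) x /\ (V `&` A) (iter n f x).

Definition periodic_point f (x : R) : Prop :=
  exists n, (0 < n)%N /\ iter n f x = x.

Definition minimal_period f (x : R) (n : nat) : Prop :=
  [/\ (0 < n)%N, iter n f x = x
    & forall k, (0 < k < n)%N -> iter k f x <> x].

(* Bounded variation on the whole line ([bounded_variation] of the library is
   relative to a compact interval). *)
Definition bounded_variation_line g : Prop :=
  exists M : R, forall x y, x <= y -> (total_variation x y g <= M%:E)%E.

Definition left_limit g (x : R) : R := lim (g y @[y --> x^'-]).
Definition right_limit g (x : R) : R := lim (g y @[y --> x^'+]).

Definition regular_discontinuities g : Prop :=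
  forall x, 2 * g x = left_limit g x + right_limit g x.

Definition test_function g : Prop :=
  (forall n x, derivable (derive1n n g) x 1) /\
  (exists M : R, forall x, M < `|x| -> g x = 0).

Definition distributional_derivative X (dX : R -> R) : Prop :=
  [/\ locally_integrable setT X, locally_integrable setT dX
    & forall g, test_function g ->
        \int[lebesgue_measure]_x (X x * derive1 g x) =
        - \int[lebesgue_measure]_x (dX x * g x)].

(* The map [f] is only considered on [a, b]. *)
Record expanding_unimodal (a b c : R) f : Prop := ExpandingUnimodal {
  eu_ac : a < c;
  eu_cb : c < b;
  eu_maps : forall x, a <= x <= b -> a <= f x <= b;
  eu_continuous : {within `[a, b], continuous f};
  eu_increasing : forall x y, a <= x -> x < y -> y <= c -> f x < f y;
  eu_decreasing : forall x y, c <= x -> x < y -> y <= b -> f y < f x;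
  eu_expanding_p : expanding_C3 `[a, c] f;
  eu_expanding_m : expanding_C3 `[c, b] f;
  eu_critical : ~ periodic_point f c;
  eu_mixing : topologically_mixing f `[iter 2 f c, f c]
}.

(* [rho] is the density, extended by 0 to the line, of an absolutely continuous
   [f]-invariant probability measure on [a, b]. *)
Definition invariant_density (a b : R) f rho : Prop :=
  [/\ measurable_fun setT rho,
      forall x, 0 <= rho x,
      (\int[lebesgue_measure]_x (rho x)%:E = 1)%E,
      forall x, ~~ (a <= x <= b) -> rho x = 0
    & forall A, measurable A ->
        (\int[lebesgue_measure]_(x in `[a, b] `&` f @^-1` A) (rho x)%:E =
         \int[lebesgue_measure]_(x in A) (rho x)%:E)%E].

Definition regular_invariant_density (a b c : R) f rho : Prop :=
  [/\ invariant_density a b f rho,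
      forall x, ~~ (iter 2 f c <= x <= f c) -> rho x = 0,
      bounded_variation_line rho
    & regular_discontinuities rho].

(* Only the values of [psip] and [psim] on J = ]-oo, f c] are meaningful. *)
Record inverse_branches (a b c : R) f (psip psim : R -> R) : Prop :=
  InverseBranches {
  ib_inv_p : forall x, a <= x <= c -> psip (f x) = x;
  ib_inv_m : forall x, c <= x <= b -> psim (f x) = x;
  ib_increasing : forall x y, x < y -> y <= f c -> psip x < psip y;
  ib_decreasing : forall x y, x < y -> y <= f c -> psim y < psim x;
  ib_onto_p : psip @` `]-oo, f c] = `]-oo, c]%classic;
  ib_onto_m : psim @` `]-oo, f c] = `[c, +oo[%classic;
  ib_contracting_p : contracting_C3 `]-oo, f c] psip;
  ib_contracting_m : contracting_C3 `]-oo, f c] psim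
}.

Definition unique_fixed_point A g (x : R) : Prop :=
  [/\ A x, g x = x & forall y, A y -> g y = y -> y = x].

Record perturbation_field (a b : R) f X : Prop := PerturbationField {
  pf_bounded : forall x, `|X x| <= 1;
  pf_C2 : extends_Ck 2 (f @` `[a, b]) X;
  pf_derivative : exists dX, [/\ distributional_derivative X dX,
    bounded_variation_line dX
    & forall x, ~~ (a <= x <= b) -> dX x = 0];
  pf_maps : exists2 eps, 0 < eps &
    (forall t x, 0 <= t <= eps -> a <= x <= b -> a <= f x + t * X (f x) <= b) \/
    (forall t x, - eps <= t <= 0 -> a <= x <= b -> a <= f x + t * X (f x) <= b)
}.

Definition chi (c : R) f (x : R) : R :=
  if x < f c then 1 else if x == f c then 2^-1 else 0.

Definition L0 (c : R) f (psip psim : R -> R) (u : R -> R) (x : R) : R :=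
  chi c f x * u (psip x) - chi c f x * u (psim x).

Definition jump (c : R) f rho (n : nat) : R :=
  right_limit rho (iter n f c) - left_limit rho (iter n f c).

Definition total_jump (c : R) f X rho (n0 n1 : nat) : R :=
  \sum_(1 <= n < n0 + n1) jump c f rho n * X (iter n f c).

(* The index condition is k + n0 - 1 - l * n1 = m; since 1 <= k the truncated
   predecessor is harmless. *)
Definition partial_jump (c : R) f X rho (n0 n1 m : nat) : R :=
  if n1 == 1%N then total_jump c f X rho n0 n1
  else \sum_(1 <= k < n0 + n1 |
               `[< exists l : nat, (k + n0).-1 = (m + l * n1)%N >])
         X (iter k f c) * jump c f rho k.

Definition Psi_coef (a0 b c : R) f (psip psim : R -> R) X rho (phi : R -> R)
    (n : nat) : R :=
  \int[lebesgue_measure]_(x in `[a0, b])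
    (iter n (L0 c f psip psim) (fun y => rho y * X y) x * derive1 phi x).

End RealFunctions.

Section ComplexFunctions.
Context {R : realType}.
Implicit Types (F G : R[i] -> R[i]) (z w : R[i]) (u : nat -> R).

Definition disc (r : R) : set R[i] := [set z | `|z| < r%:C].

Definition holomorphic_at F z : Prop := \forall w \near z, derivable F w 1.

Definition holomorphic_on (U : set R[i]) F : Prop :=
  forall z, U z -> derivable F z 1.

(* Values of [F] at poles are irrelevant. *)
Definition meromorphic_on (U : set R[i]) F : Prop :=
  forall z, U z -> exists (k : nat) G,
    holomorphic_at G z /\ \forall w \near z^', (w - z) ^+ k * F w = G w.

(* [F] has at most a simple pole at [z], and [res] is the coefficient of
   1 / (z - w) in its principal part there. *)
Definition at_most_simple_pole F z (res : R[i]) : Prop :=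
  exists G, holomorphic_at G z /\ \forall w \near z^', F w = res / (z - w) + G w.

Definition power_series_partial u z : nat -> R[i] :=
  series (fun n => (u n)%:C * z ^+ n).

Definition power_series u z : R[i] := limn (power_series_partial u z).

End ComplexFunctions.

(* Main.v *)
(** [L0] acts on primitives as the transfer operator acts on densities: if [H' = h]
    then [(L0 H)' = L h]. The post-critical set is finite and forward invariant, so
    [L] preserves densities that are Lipschitz on each of its complementary intervals;
    an invariant cone of log-Lipschitz densities together with a Doeblin bound, which
    comes from mixing, makes [L0^n K] decay exponentially for primitives [K] of total
    mass zero. The invariant density is therefore C^1 with Lipschitz derivative off the
    post-critical set, and [rho0 X = K - J T + sum_k s_k X(c_k) H_(c_k)] where [K] has
    mass zero, [T] is the primitive of [rho0] vanishing on the right ([L0 T = T]) and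
    [H_p] is a unit step at [p] ([L0 H_(c_k) = H_(c_(k+1))]). Integrating against the
    derivative of [phi], the [n]-th coefficient of [Psi] equals
    [J int phi rho0 - sum_k s_k X(c_k) phi(c_(k+n))] up to an exponentially small error.
    The main term is eventually periodic in [n], with period [n1]; hence [Psi] is a
    rational function with poles at [n1]-th roots of unity plus a function holomorphic
    in a larger disc. Its residue at [1] is the mean of the main term over a period,
    and the vanishing of all partial jumps annihilates the periodic part altogether. *)

Require Import Defs.
From mathcomp Require Import all_boot all_order all_algebra.
From mathcomp Require Import all_classical all_reals all_analysis.
From mathcomp Require Import complex.
From mathcomp Require Import measurable_realfun.
From mathcomp Require Import ring lra zify.

Set Implicit Arguments.
Unset Strict Implicit.
Unset Printing Implicit Defensive.

Import Order.TTheory GRing.Theory Num.Theory.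
Import numFieldNormedType.Exports.

Local Open Scope classical_set_scope.
Local Open Scope ring_scope.

(** * Differentiation with exceptional points *)

(** The iterates of [L0] act on [rho0 X], so [rho0 X] plays the role of a primitive and the cone
    estimate must be applied to its derivative. This asks for one more derivative of the density
    than is given. A priori [rho0] is only of bounded variation, hence in no cone of Lipschitz
    densities. Its regularity is obtained from outside: the iterates of the uniform density satisfy
    bounds on the derivative and on its Lipschitz constant that do not degrade with [n], and their
    limit is identified with the tail of [rho0] at the level of primitives. There an L1 error of
    size [e] is a difference of two monotone functions of size [e], a bound which the operator
    preserves without any regularity. Pointwise statements are restricted to points off the critical
    orbit; the orbit is finite, so integrals do not see it, and continuity of primitives bridges it.
    The orbit contains [c] itself while the total jump starts at [c_1], so the absence of a jump at
    [c] has to be proved; it follows from the invariance equation, as [c] is not periodic. *)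

Section RealTools.
Context {R : realType}.
Implicit Types (F h g : R -> R) (x y u v l B : R).

Lemma is_derive_quadratic F x l d B : 0 < d ->
  (forall y, `|y - x| < d -> `|F y - F x - l * (y - x)| <= B * (y - x) ^+ 2) ->
  is_derive x 1 F l.
Proof.
move=> d0 H.
have B0 : 0 <= B.
  have := H (x + d / 2); rewrite addrAC subrr add0r gtr0_norm; last by lra.
  move=> /(_ ltac:(lra)) /(le_trans (normr_ge0 _)); rewrite pmulr_lge0 //.
  by rewrite exprn_gt0 //; lra.
have c : (fun e => e^-1 *: (F (e *: (1 : R) + x) - F x)) @ 0^' --> l.
  apply/cvgrPdist_le => e e0.
  near=> t.
  have t0 : t != 0 by near: t; exact: nbhs_dnbhs_neq.
  have td : `|t| < d by near: t; exact: dnbhs0_lt.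
  have te : `|t| < e / (B + 1).
    by near: t; apply: dnbhs0_lt; rewrite divr_gt0 //; lra.
  rewrite /GRing.scale /= mulr1.
  have := H (t + x); rewrite addrK => /(_ td) Ht.
  have -> : l - t^-1 * (F (t + x) - F x) = - t^-1 * (F (t + x) - F x - l * t).
    by field.
  rewrite normrM normrN normfV ler_pdivrMl ?normr_gt0 //.
  rewrite (le_trans Ht) // -(real_normK (num_real t)).
  move: te; rewrite ltr_pdivlMr; last by lra.
  have := normr_ge0 t; nra.
split; first by apply/cvg_ex; exists l.
by rewrite /derive; apply/cvg_lim.
Unshelve. all: by end_near. Qed.

Lemma is_derive_continuous F x l : is_derive x 1 F l -> {for x, continuous F}.
Proof.
move=> [H _]; apply: differentiable_continuous; exact/derivable1_diffP.
Qed.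

Lemma continuous_near F h x : (\forall y \near x, F y = h y) ->
  {for x, continuous h} -> {for x, continuous F}.
Proof.
move=> e; rewrite /prop_for /continuous_at (nbhs_singleton e : F x = h x).
by apply: cvg_trans; apply: near_eq_cvg; apply: filterS e => y ->.
Qed.

Lemma cvg_sum_ord (T : Type) (S : set_system T) {FS : Filter S} N
    (v : nat -> T -> R) (l : nat -> R) :
  (forall k, (k < N)%N -> v k x @[x --> S] --> l k) ->
  \sum_(k < N) v k x @[x --> S] --> \sum_(k < N) l k.
Proof.
elim: N => [_|N IH H].
  by rewrite big_ord0; apply: cvg_near_cst; near=> x; rewrite big_ord0.
rewrite big_ord_recr /=; under eq_fun do rewrite big_ord_recr /=.
by apply: cvgD; [apply: IH => k kN; exact/H/ltnW|exact: H].
Unshelve. all: by end_near. Qed.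

Lemma near_right_dnbhs x (P : R -> Prop) :
  (\forall z \near x^', P z) -> \forall z \near x^'+, P z.
Proof.
by rewrite /dnbhs /at_right !near_withinE; apply: filterS => z h xz; apply: h; rewrite gt_eqF.
Qed.

Lemma near_left_dnbhs x (P : R -> Prop) :
  (\forall z \near x^', P z) -> \forall z \near x^'-, P z.
Proof.
by rewrite /dnbhs /at_left !near_withinE; apply: filterS => z h xz; apply: h; rewrite lt_eqF.
Qed.

Lemma mean_value_exceptions (s : seq R) F h u v B : continuous F -> u <= v ->
  (forall x, u < x < v -> x \notin s -> is_derive x 1 F (h x) /\ h x <= B) ->
  F v - F u <= B * (v - u).
Proof.
move=> cF; elim: s u v => [|p s IH] u v uv H.
  move: uv; rewrite le_eqVlt => /predU1P[->|uv]; first by rewrite !subrr mulr0.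
  have [|x /[!in_itv]/= xuv ->] := @MVT R F h u v uv _ (continuous_subspaceT cF).
    by move=> x; rewrite in_itv /= => /H -/(_ isT)[].
  by have [] := H x xuv isT => _ ?; rewrite ler_wpM2r // subr_ge0 ltW.
have [/andP[up pv]|np] := boolP (u < p < v).
  have -> : F v - F u = (F v - F p) + (F p - F u) by ring.
  have -> : B * (v - u) = B * (v - p) + B * (p - u) by ring.
  apply: lerD; apply: IH; rewrite ?ltW // => x /andP[x1 x2] xs.
    apply: H; first by rewrite x2 (lt_trans up).
    by rewrite inE negb_or gt_eqF.
  apply: H; first by rewrite x1 (lt_trans x2).
  by rewrite inE negb_or lt_eqF.
apply: IH => // x xuv xs; apply: H => //; rewrite inE negb_or xs andbT.
by apply: contra np => /eqP <-.
Qed.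

Lemma mean_value_exceptions_ge (s : seq R) F h u v B : continuous F -> u <= v ->
  (forall x, u < x < v -> x \notin s -> is_derive x 1 F (h x) /\ B <= h x) ->
  B * (v - u) <= F v - F u.
Proof.
move=> cF uv H.
have := @mean_value_exceptions s (fun x => - F x) (fun x => - h x) u v (- B).
move=> H'; suff : - F v - - F u <= - B * (v - u) by lra.
apply: H' => // [x|x xuv xs]; first by apply: cvgN; exact: cF.
have [D1 D2] := H _ xuv xs; split; last by lra.
exact: is_deriveN.
Qed.

Lemma mean_value_exceptions_norm (s : seq R) F h u v B : continuous F ->
  (forall x, (u < x < v) || (v < x < u) -> x \notin s ->
     is_derive x 1 F (h x) /\ `|h x| <= B) ->
  `|F v - F u| <= B * `|v - u|.
Proof.
move=> cF; wlog uv : u v / u <= v => [W H|H].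
  have [uv|/ltW uv] := leP u v; first exact: W.
  rewrite distrC [X in _ * X]distrC; apply: W => // x.
  by rewrite orbC; exact: H.
rewrite [X in _ * X]ger0_norm ?subr_ge0 // ler_norml -mulNr; apply/andP; split.
  apply: (@mean_value_exceptions_ge s _ h) => // x xuv xs.
  by have [|//|? ] := H x; rewrite ?xuv // ler_norml => /andP[].
apply: (@mean_value_exceptions s _ h) => // x xuv xs.
by have [|//|? ] := H x; rewrite ?xuv // ler_norml => /andP[].
Qed.

Lemma mean_value_norm F h u v B :
  (forall x, u <= x <= v -> is_derive x 1 F (h x) /\ `|h x| <= B) ->
  forall x y, u <= x <= v -> u <= y <= v -> `|F x - F y| <= B * `|x - y|.
Proof.
move=> H x y; wlog yx : x y / y <= x => [W|] Hx Hy.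
  have [|/ltW] := leP y x => ?; first exact: W.
  by rewrite distrC [X in _ * X]distrC; apply: W.
have sub z : y <= z <= x -> u <= z <= v.
  move: Hx Hy => /andP[? ?] /andP[? ?] /andP[? ?].
  by apply/andP; split; [apply: le_trans; last eassumption|apply: le_trans; first eassumption].
have [||z] := @MVT_segment R F h y x yx.
- move=> z; rewrite in_itv /= => /andP[? ?].
  by have [|] := H z; rewrite // sub // !ltW.
- apply: continuous_in_subspaceT => z; rewrite inE /= in_itv /= => zz.
  by have [|D _] := H z; rewrite ?sub //; exact: is_derive_continuous D.
rewrite in_itv /= => zz ->; rewrite normrM ler_wpM2r //.
by have [|] := H z; rewrite ?sub.
Qed.

Lemma derive_ge_right F x l d B : 0 < d -> is_derive x 1 F l ->
  (forall y, x < y < x + d -> B * (y - x) <= F y - F x) -> B <= l.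
Proof.
move=> d0 [D <-] H.
have cr := cvg_dnbhs_at_right D.
apply: (cvgr_to_ge cr); near=> t.
have t0 : 0 < t by near: t; exact: nbhs_right_gt.
have td : t < d by near: t; exact: nbhs_right_lt.
rewrite /GRing.scale /= mulr1 ler_pdivlMl // mulrC.
have := H (t + x); rewrite addrK; apply.
by apply/andP; split; lra.
Unshelve. all: by end_near. Qed.

(** The mean value bound for [F z - h y * z], whose derivative [h z - h y] is at most [B * |x - y|]
    between the two points. *)
Lemma first_order_remainder F h x y B :
  (forall z, Num.min x y <= z <= Num.max x y ->
     is_derive z 1 F (h z) /\ `|h z - h y| <= B * `|z - y|) ->
  `|F x - F y - h y * (x - y)| <= B * (x - y) ^+ 2.
Proof.
move=> H; pose G z := F z - h y * z.
have xin : Num.min x y <= x <= Num.max x y by rewrite ge_min le_max lexx.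
have yin : Num.min x y <= y <= Num.max x y by rewrite ge_min le_max lexx !orbT.
have B0 : x != y -> 0 <= B.
  move=> xy; have [_ /(le_trans (normr_ge0 _))] := H x xin.
  by rewrite pmulr_lge0 // normr_gt0 subr_eq0.
have [->|/B0 {}B0] := eqVneq x y; first by rewrite !subrr mulr0 subr0 normr0 expr0n mulr0.
have -> : F x - F y - h y * (x - y) = G x - G y by rewrite /G; ring.
rewrite -(real_normK (num_real (x - y))) expr2 mulrA.
apply: (@mean_value_norm G (fun z => h z - h y) (Num.min x y) (Num.max x y)) => // z zr.
have [D1 D2] := H z zr; split.
  have Dz : is_derive z 1 (fun z : R => h y *: z) (h y *: 1) by exact: is_deriveZ.
  by rewrite /GRing.scale /= mulr1 in Dz; exact: is_deriveB.
apply: le_trans D2 _; rewrite ler_wpM2l //.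
move: zr; case: (leP x y) => xy /andP[z1 z2].
  by rewrite ler0_norm ?subr_le0 // ler0_norm ?subr_le0 // !opprB lerD2l lerN2.
rewrite (ger0_norm (_ : 0 <= z - y)) ?subr_ge0 //.
by rewrite (ger0_norm (_ : 0 <= x - y)) ?subr_ge0 ?lerD2r // ltW.
Qed.

Lemma cauchy_cvgn (v : nat -> R) :
  (forall e, 0 < e -> exists N, forall n m, (N <= n)%N -> (N <= m)%N ->
     `|v n - v m| < e) -> cvgn v.
Proof.
move=> H; apply/cauchy_cvgP/cauchy_ballP => e e0; near_simpl.
have [N HN] := H e e0; exists ([set n | (N <= n)%N], [set n | (N <= n)%N]).
  by split; exact: nbhs_infty_ge.
by move=> [n m] [/= ? ?]; rewrite /ball /= HN.
Qed.

(* Difference quotients at step [x - y] pin [f n y] down up to [B |x - y|], so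
   convergence of the functions forces convergence of the derivatives. *)
Lemma derivative_interpolation (F f : nat -> R -> R) (G : R -> R) y d B : 0 < d ->
  (forall n x, `|x - y| < d ->
     `|F n x - F n y - f n y * (x - y)| <= B * (x - y) ^+ 2) ->
  (forall x, `|x - y| < d -> F n x @[n --> \oo] --> G x) ->
  exists2 l, f n y @[n --> \oo] --> l & is_derive y 1 G l.
Proof.
move=> d0 HF HG.
have B0 : 0 <= B.
  have := HF 0%N (y + d / 2); rewrite addrAC subrr add0r gtr0_norm; last by lra.
  move=> /(_ ltac:(lra)) /(le_trans (normr_ge0 _)); rewrite pmulr_lge0 //.
  by rewrite exprn_gt0 //; lra.
have [l fl] : exists l, f n y @[n --> \oo] --> l.
  apply/cvg_ex; apply: cauchy_cvgn => e e0.
  (* At this step the two quadratic remainders add up to at most [e * t / 2], and the four errors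
     [e * t / 8] in the values of [F] to another [e * t / 2]; division by [t] gives [e]. *)
  pose t := Num.min (d / 2) (e / (4 * (B + 1))).
  have t0 : 0 < t by rewrite lt_min !divr_gt0 //; lra.
  have td : t < d by rewrite gt_min; apply/orP; left; lra.
  have te : t * (4 * (B + 1)) <= e.
    by rewrite -ler_pdivlMr; [rewrite ge_min lexx orbT|lra].
  have xd : `|y + t - y| < d by rewrite addrAC subrr add0r gtr0_norm.
  have yd : `|y - y| < d by rewrite subrr normr0.
  have e' : 0 < e * t / 8 by rewrite divr_gt0 ?mulr_gt0.
  have /cvgrPdist_lt/(_ _ e')[N1 _ HN1] := HG _ xd.
  have /cvgrPdist_lt/(_ _ e')[N2 _ HN2] := HG _ yd.
  exists (maxn N1 N2) => n m; rewrite !geq_max => /andP[n1 n2] /andP[m1 m2].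
  have := HN1 n n1; have := HN1 m m1; have := HN2 n n2; have := HN2 m m2.
  have := HF n _ xd; have := HF m _ xd.
  rewrite -[y + t - y]addrA [t - y]addrC addrA subrr add0r.
  rewrite !ltr_norml !ler_norml.
  move=> /andP[? ?] /andP[? ?] /andP[? ?] /andP[? ?] /andP[? ?] /andP[? ?].
  have t2 : B * t ^+ 2 <= e * t / 4.
    by rewrite expr2; have := ler_wpM2l (ltW t0) te; nra.
  by rewrite -(ltr_pM2r t0) -[X in _ && X](ltr_pM2r t0); apply/andP; split; nra.
exists l => //; apply: (@is_derive_quadratic _ _ _ d B) => // x xd.
have yd : `|y - y| < d by rewrite subrr normr0.
have C : `|F n x - F n y - f n y * (x - y)| @[n --> \oo] -->
    `|G x - G y - l * (x - y)|.
  by apply: cvg_norm; apply: cvgB; [apply: cvgB; exact: HG|apply: cvgM => //; exact: cvg_cst].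
by apply: (cvgr_to_le C); near=> n; exact: HF.
Unshelve. all: by end_near. Qed.
End RealTools.

(** * Transfer operators with a finite post-critical set *)

Definition side {R : realType} (s : bool) : R := if s then 1 else -1.

(* [br true] and [br false] are the extended inverse branches psi_+ and psi_-, with
   derivatives [dbr] and [ddbr]. Most bounds are only available where the branch
   lands in the support [c_2, c_1] of the densities. *)
Record markov_unimodal {R : realType} (c : R) (f : R -> R)
    (br dbr ddbr : bool -> R -> R) (lam kap D : R) : Prop := MarkovUnimodal {
  mk_lo : iter 2 f c < c;
  mk_hi : c < iter 1 f c;
  mk_finite : exists K, forall k, exists2 j, (j < K)%N & iter k f c = iter j f c;
  mk_range : forall k, iter 2 f c <= iter k f c <= iter 1 f c;
  mk_maps : forall y, iter 2 f c <= y <= iter 1 f c ->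
    iter 2 f c <= f y <= iter 1 f c;
  mk_mono : forall s x y, x < y -> y <= iter 1 f c ->
    0 < side s * (br s y - br s x);
  mk_side : forall s x, x <= iter 1 f c -> 0 <= side s * (c - br s x);
  mk_inv : forall s y, iter 2 f c <= y <= iter 1 f c ->
    0 <= side s * (c - y) -> br s (f y) = y;
  mk_derive : forall s x, x <= iter 1 f c -> is_derive x 1 (br s) (dbr s x);
  mk_lam : 0 < lam < 1;
  mk_contract : forall s x, x <= iter 1 f c -> `|dbr s x| <= lam;
  mk_kap : 0 < kap <= 1;
  mk_expand : forall s x, x < iter 1 f c ->
    iter 2 f c <= br s x <= iter 1 f c -> kap <= side s * dbr s x;
  mk_D : 0 <= D;
  mk_derive2 : forall s x, x <= iter 1 f c ->
    iter 2 f c <= br s x <= iter 1 f c ->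
    is_derive x 1 (dbr s) (ddbr s x) /\ `|ddbr s x| <= D;
  mk_lip : forall s x y, x <= iter 1 f c -> y <= iter 1 f c ->
    iter 2 f c <= br s x <= iter 1 f c -> iter 2 f c <= br s y <= iter 1 f c ->
    `|dbr s x - dbr s y| <= D * `|x - y|;
  mk_lip2 : forall s x y, x <= iter 1 f c -> y <= iter 1 f c ->
    iter 2 f c <= br s x <= iter 1 f c -> iter 2 f c <= br s y <= iter 1 f c ->
    `|ddbr s x - ddbr s y| <= D * `|x - y|;
  mk_mix : topologically_mixing f `[iter 2 f c, iter 1 f c]
}.

Section Markov.
Context {R : realType} (c : R) (f : R -> R) (br dbr ddbr : bool -> R -> R).
Context (lam kap D : R) (M : markov_unimodal c f br dbr ddbr lam kap D).

Notation orb k := (iter k f c).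
Notation lo := (iter 2 f c).
Notation hi := (iter 1 f c).

(** * The critical orbit and the cells of its complement *)

Definition regular_point (x : R) : Prop := forall k, x != orb k.

(** The components of the complement of the critical orbit, as a relation: equal answers to all
    comparisons mean that no orbit point lies between [x] and [y]. The orbit never has to be
    sorted. *)
Definition cell (x y : R) : Prop :=
  forall k, [/\ x != orb k, y != orb k & (x < orb k) = (y < orb k)].

Let lohi : lo < hi. Proof. exact: lt_trans (mk_lo M) (mk_hi M). Qed.

Lemma cell_sym x y : cell x y -> cell y x.
Proof. by move=> H k; have [? ? ?] := H k. Qed.

Lemma cell_trans y x z : cell x y -> cell y z -> cell x z.
Proof. by move=> H1 H2 k; have [? ? ->] := H1 k; have [? ? ->] := H2 k. Qed.

Lemma cell_refl x : regular_point x -> cell x x.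
Proof. by move=> H k; split. Qed.

Lemma cellL x y : cell x y -> regular_point x.
Proof. by move=> H k; have [] := H k. Qed.

Lemma cellR x y : cell x y -> regular_point y.
Proof. by move=> H k; have [] := H k. Qed.

Lemma regular_lo x : regular_point x -> lo <= x <= hi -> lo < x < hi.
Proof.
move=> H; have := H 2%N; have := H 1%N.
by rewrite !lt_neqAle => -> n2 /andP[-> ->]; rewrite eq_sym n2.
Qed.

Lemma cell_range x y : cell x y -> (lo <= x <= hi) = (lo <= y <= hi).
Proof.
move=> H; have [x1 y1 e1] := H 1%N; have [x2 y2 e2] := H 2%N.
rewrite !(le_eqVlt _ hi) (negbTE x1) (negbTE y1) /= e1.
by congr (_ && _); rewrite !leNgt e2.
Qed.

Lemma cell_hi x y : cell x y -> (x < hi) = (y < hi).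
Proof. by move=> H; have [] := H 1%N. Qed.

Lemma cell_dist x y : cell x y -> lo <= x <= hi -> `|x - y| <= hi - lo.
Proof.
move=> H xl; have := xl; rewrite (cell_range H) => /andP[? ?].
by move: xl => /andP[? ?]; rewrite ler_norml; apply/andP; split; lra.
Qed.

Lemma regular_ball x : regular_point x ->
  exists2 d, 0 < d & forall y, `|y - x| < d -> cell x y.
Proof.
move=> H; have [K HK] := mk_finite M.
have {HK} HK : forall y, (forall j : 'I_K,
    [/\ x != orb j, y != orb j & (x < orb j) = (y < orb j)]) -> cell x y.
  by move=> y Hy k; have [j jK ->] := HK k; exact: (Hy (Ordinal jK)).
suff : \forall y \near x, forall j : 'I_K,
    [/\ x != orb j, y != orb j & (x < orb j) = (y < orb j)].
  move=> /nbhs_ballP[d d0 Hd]; exists d => // y yd; apply: HK; apply: Hd.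
  by rewrite /ball /= distrC.
suff near1 (j : 'I_K) : \forall y \near x,
    [/\ x != orb j, y != orb j & (x < orb j) = (y < orb j)].
  exact: filter_forall near1.
have := H j; move=> nj; have := nj; rewrite {1}neq_lt => /orP[xj|xj].
  near=> y; have yj : y < orb j by near: y; exact: lt_nbhsl.
  by rewrite xj yj !lt_eqF.
near=> y; have yj : orb j < y by near: y; exact: lt_nbhsr.
by rewrite !gt_eqF //; split=> //; rewrite ltNge ltW // ltNge ltW.
Unshelve. all: by end_near. Qed.

Lemma cell_open x : open (cell x).
Proof.
rewrite openE => y xy; have [d d0 Hd] := regular_ball (cellR xy).
apply/nbhs_ballP; exists d => // z; rewrite /ball /= distrC => /Hd.
exact: cell_trans.
Qed.

(** There are finitely many cells, coded by the comparisons with the orbit points. So a time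
    depending on two points becomes uniform as soon as [Q] depends only on their cells. *)
Lemma cells_eventually (Q : nat -> R -> R -> Prop) :
  (forall n x y x' y', cell x x' -> cell y y' -> Q n x y -> Q n x' y') ->
  (forall x y, lo < x < hi -> regular_point x -> lo < y < hi -> regular_point y ->
     exists n0, forall n, (n0 <= n)%N -> Q n x y) ->
  exists n0, forall n, (n0 <= n)%N ->
    forall x y, lo < x < hi -> regular_point x -> lo < y < hi ->
      regular_point y -> Q n x y.
Proof.
move=> Qc Qe; have [K HK] := mk_finite M.
pose code (x : R) := [ffun j : 'I_K => x < orb j].
have codeP x y : regular_point x -> regular_point y -> code x = code y -> cell x y.
  move=> rx ry /ffunP e k; have [j jK ->] := HK k.
  by split=> //; have := e (Ordinal jK); rewrite !ffunE.
have /choice[N HN] : forall t : {ffun 'I_K -> bool} * {ffun 'I_K -> bool},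
  exists n0, forall n, (n0 <= n)%N -> forall x y, lo < x < hi -> regular_point x ->
    lo < y < hi -> regular_point y -> code x = t.1 -> code y = t.2 -> Q n x y.
  move=> t; have [[[x y] [x1 x2 y1 [y2 tx ty]]]|no] := pselect (exists z : R * R,
    [/\ lo < z.1 < hi, regular_point z.1, lo < z.2 < hi &
     [/\ regular_point z.2, code z.1 = t.1 & code z.2 = t.2]]).
    have [n0 Hn0] := Qe x y x1 x2 y1 y2; exists n0 => n /Hn0 q x' y' ? ? ? ? tx' ty'.
    by apply: Qc q; apply: codeP; rewrite // ?tx ?ty.
  by exists 0%N => n _ x y *; exfalso; apply: no; exists (x, y).
exists (\max_t N t)%N => n nN x y *.
apply: (HN (code x, code y)) => //; apply: leq_trans nN.
exact: (leq_bigmax (code x, code y)).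
Qed.

(** * Inverse branches and cells *)

Lemma br_lt s x y : x < y -> y <= hi -> if s then br s x < br s y else br s y < br s x.
Proof. by move=> xy yh; have := mk_mono M s xy yh; case: s => /=; rewrite /side; lra. Qed.

Lemma br_inj s x y : x <= hi -> y <= hi -> br s x = br s y -> x = y.
Proof.
move=> xh yh e; apply/eqP; apply/negPn/negP; rewrite neq_lt => /orP[] h.
  by have := mk_mono M s h yh; rewrite e subrr mulr0 ltxx.
by have := mk_mono M s h xh; rewrite e subrr mulr0 ltxx.
Qed.

Lemma f_br s x : x <= hi -> lo <= br s x <= hi -> f (br s x) = x.
Proof.
move=> xh r; apply: (@br_inj s) => //; last exact: (mk_inv M r (mk_side M s xh)).
by have /andP[] := mk_maps M r.
Qed.

Lemma br_f y : lo <= y <= hi -> exists s, br s (f y) = y.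
Proof.
move=> r; have [yc|cy] := leP y c.
  by exists true; apply: (mk_inv M) r _; rewrite /side; lra.
by exists false; apply: (mk_inv M) r _; rewrite /side; lra.
Qed.

Lemma br_orb s x k : x < hi -> br s x = orb k -> x = orb k.+1.
Proof.
move=> xh e; have r : lo <= br s x <= hi by rewrite e; exact: (mk_range M).
by have := f_br (ltW xh) r; rewrite e => <-.
Qed.

(** If [orb k] lies on the side of branch [s], it is the branch value at [orb k.+1] and monotonicity
    decides. Otherwise the whole branch lies on one side of it, and the answer is the constant
    [s]. *)
Lemma br_ltP s x k : x < hi -> regular_point x ->
  (br s x < orb k) = if 0 <= side s * (c - orb k) then
                       (if s then x < orb k.+1 else orb k.+1 < x) else s.
Proof.
move=> xh rx; have xk := rx k.+1.
have rk1 : orb k.+1 <= hi by have /andP[] := mk_range M k.+1.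
have sx := mk_side M s (ltW xh).
case: ifPn => [sk|]; last first.
  by rewrite -ltNge; case: s sx; rewrite /side => ? ?; apply/idP/idP => //; lra.
have e : br s (orb k.+1) = orb k by apply: (mk_inv M) sk; exact: (mk_range M).
rewrite -{1}e; have [lt|gt|eq] := ltgtP x (orb k.+1).
- by have := br_lt s lt rk1; case: s {sx sk e} => [->//|]; apply: lt_gtF.
- by have := br_lt s gt (ltW xh); case: s {sx sk e} => [|->//]; apply: lt_gtF.
- by rewrite eq eqxx in xk.
Qed.

Lemma regular_br s x : x < hi -> regular_point x -> regular_point (br s x).
Proof. by move=> xh rx k; apply/eqP => /br_orb -/(_ xh) e; have /eqP := rx k.+1. Qed.

(** The Markov property: a branch can cross [orb k] only where its argument crosses [orb k.+1],
    because the orbit is forward invariant. *)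
Lemma cell_br s x y : cell x y -> x < hi -> cell (br s x) (br s y).
Proof.
move=> H xh; have yh : y < hi by rewrite -(cell_hi H).
have rx := cellL H; have ry := cellR H.
move=> k; split; [exact: regular_br|exact: regular_br|].
rewrite !br_ltP //; have [n1 n2 e] := H k.+1.
case: ifP => // _; case: s => //.
by rewrite !ltNge !le_eqVlt e (negbTE n1) (negbTE n2).
Qed.

Lemma br_lip s x y : x <= hi -> y <= hi -> `|br s x - br s y| <= lam * `|x - y|.
Proof.
move=> xh yh.
apply: (@mean_value_norm _ (br s) (dbr s) (Num.min x y) hi lam) => [z /andP[_ zh]||].
- by split; [exact: (mk_derive M)|exact: (mk_contract M)].
- by rewrite ge_min lexx /=.
- by rewrite ge_min lexx orbT.
Qed.

Lemma br_below s x : x < lo -> ~~ (lo <= br s x <= hi).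
Proof.
move=> xlo; apply/negP => r.
have xh : x <= hi by rewrite ltW // (lt_trans xlo).
by have := mk_maps M r; rewrite f_br // leNgt xlo.
Qed.

(* The branch weight |psi_s'|, where it matters: on points whose branch lies in [lo, hi]. *)
Definition weight s x := side s * dbr s x.

(** * The operator on densities and on primitives *)

Definition transfer (h : R -> R) x :=
  if x < hi then h (br true x) * weight true x + h (br false x) * weight false x
  else 0.

Definition primitive_transfer (H : R -> R) x :=
  if x < hi then H (br true x) - H (br false x) else 0.

Definition supported (h : R -> R) := forall x, ~~ (lo <= x <= hi) -> h x = 0.

(** The multiplicative form allows [h] to vanish on a whole cell, and by symmetry of [cell] it
    bounds the ratio in both directions. Inside the support, values on the critical orbit stay
    free. *)
Definition cone A (h : R -> R) :=
  [/\ supported h, forall x, regular_point x -> 0 <= h x &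
      forall x y, cell x y -> h x <= h y * expR (A * `|x - y|)].

(* Primitives vanish to the right of the support, a normalisation preserved by
   [primitive_transfer]; [m] is the total mass. *)
Definition primitive (H h : R -> R) (m : R) :=
  [/\ continuous H, forall x, regular_point x -> is_derive x 1 H (h x),
      forall x, hi <= x -> H x = 0 & forall x, x <= lo -> H x = - m].

Lemma transfer_supported h : supported h -> supported (transfer h).
Proof.
move=> sh x; rewrite negb_and -!ltNge /transfer => /orP[xl|xh]; last first.
  by rewrite ltNge ltW.
by case: ifP => // _; rewrite !sh ?mul0r ?addr0 // br_below.
Qed.

(** A Lipschitz bound [D] on a quantity that is at least [kap] is a relative bound [D / kap]; then
    [1 + t <= expR t]. *)
Lemma weight_lip s x y : x <= hi -> y < hi ->
  lo <= br s x <= hi -> lo <= br s y <= hi ->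
  weight s x <= weight s y * expR (D / kap * `|x - y|).
Proof.
move=> xh yh rx ry; have L := mk_lip M xh (ltW yh) rx ry.
have K := mk_expand M yh ry; have /andP[k0 _] := mk_kap M; have D0 := mk_D M.
have : weight s x <= weight s y + D * `|x - y|.
  by move: L; rewrite ler_norml /weight; case: (s); rewrite /side; lra.
move/le_trans; apply.
have : weight s y * (1 + D / kap * `|x - y|) <= weight s y * expR (D / kap * `|x - y|).
  by apply: ler_wpM2l (expR_ge1Dx _); rewrite /weight (le_trans _ K) // ltW.
apply: le_trans; rewrite mulrDr mulr1 lerD2l mulrA ler_wpM2r //.
by rewrite mulrCA ler_peMr // ler_pdivlMr // mul1r.
Qed.

(** A branch shrinks distances by [lam], which multiplies the exponent, and the weights add
    [D / kap]. Since branches preserve cells, the two arguments enter or leave the support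
    together. *)
Lemma transfer_cone A h : 0 <= A -> cone A h -> cone (lam * A + D / kap) (transfer h).
Proof.
move=> A0 [sh h0 hA]; have /andP[l0 l1] := mk_lam M; have /andP[k0 _] := mk_kap M.
have t0 s x : x < hi -> regular_point x -> 0 <= h (br s x) * weight s x.
  move=> xh rx; have [r|nr] := boolP (lo <= br s x <= hi); last by rewrite sh ?mul0r.
  apply: mulr_ge0; first exact/h0/regular_br.
  by apply: le_trans (mk_expand M xh r); exact: ltW.
split; first exact: transfer_supported.
  by move=> x rx; rewrite /transfer; case: ifP => // xh; rewrite addr_ge0 ?t0.
move=> x y H; rewrite /transfer -(cell_hi H); case: ifP => [xh|_]; last by rewrite mul0r.
have yh : y < hi by rewrite -(cell_hi H).
suff P sg : h (br sg x) * weight sg x <=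
    h (br sg y) * weight sg y * expR ((lam * A + D / kap) * `|x - y|).
  by rewrite mulrDl; apply: lerD.
have Hb := cell_br sg H xh.
have [r|nr] := boolP (lo <= br sg x <= hi); last by rewrite !sh ?mul0r // -(cell_range Hb).
have r' : lo <= br sg y <= hi by rewrite -(cell_range Hb).
have w0 : 0 <= weight sg x by apply: le_trans (mk_expand M xh r); exact: ltW.
rewrite mulrDl expRD.
rewrite [leRHS](_ : _ = (h (br sg y) * expR (lam * A * `|x - y|)) *
  (weight sg y * expR (D / kap * `|x - y|))); last by ring.
apply: ler_pM => //; [exact/h0/regular_br/(cellL H)| |exact: weight_lip (ltW _) _ _ _].
apply: le_trans (hA _ _ Hb) _; apply: ler_wpM2l; first exact/h0/regular_br/(cellR H).
rewrite ler_expR [lam * A]mulrC -mulrA ler_wpM2l //.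
by rewrite br_lip // ltW.
Qed.

Lemma cone_weaken A A' h : A <= A' -> cone A h -> cone A' h.
Proof.
move=> AA [sh h0 hA]; split=> // x y H; apply: le_trans (hA _ _ H) _.
by apply: ler_wpM2l; [exact/h0/(cellR H)|rewrite ler_expR ler_wpM2r].
Qed.

Lemma br_hi s : br s hi = c.
Proof.
apply: (mk_inv M); last by rewrite subrr mulr0.
by rewrite !ltW ?(mk_lo M) ?(mk_hi M).
Qed.

Lemma br_lo : br true lo <= lo /\ br false lo = hi.
Proof.
have l2 : lo <= hi by exact: ltW.
split; last first.
  apply: (@mk_inv _ _ _ _ _ _ _ _ _ M false hi); first by rewrite lexx ltW.
  by rewrite /side; have := mk_hi M; lra.
have e : br true (orb 3) = lo.
  apply: (@mk_inv _ _ _ _ _ _ _ _ _ M true lo); first by rewrite lexx ltW.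
  by rewrite /side; have := mk_lo M; lra.
have /andP[l3 h3] := mk_range M 3.
move: l3; rewrite le_eqVlt => /predU1P[e3|l3]; first by rewrite {1}e3 e.
by have := br_lt true l3 h3; rewrite e => /ltW.
Qed.

(** Continuity at [hi] holds because both branches reach [c] there. The mass survives because, left
    of [lo], one branch stays left of [lo], where the primitive is [- m], and the other lands right
    of [hi], where it is 0. *)
Lemma primitive_transfer_primitive H h m : supported h -> primitive H h m ->
  primitive (primitive_transfer H) (transfer h) m.
Proof.
move=> sh [cH dH H0 Hm]; have l2 : lo <= hi by exact: ltW.
have brc s x : x <= hi -> {for x, continuous (br s)}.
  by move=> xh; exact: is_derive_continuous (mk_derive M s xh).
have Tc x : x <= hi ->
    {for x, continuous (fun x => H (br true x) - H (br false x))}.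
  by move=> xh; apply: cvgB; apply: continuous_comp; try exact: brc; exact: cH.
split.
- move=> x; have [xh|hx|xh] := ltgtP x hi.
  + apply: continuous_near (Tc _ (ltW xh)); near=> y; rewrite /primitive_transfer.
    by have -> : y < hi by near: y; exact: lt_nbhsl.
  + apply: (@continuous_near _ _ (cst 0)); last exact: cst_continuous.
    near=> y; rewrite /primitive_transfer ltNge.
    by have /ltW -> : hi < y by near: y; exact: lt_nbhsr.
  + rewrite xh; have C := Tc hi (lexx _).
    rewrite /prop_for /continuous_at /= !br_hi subrr in C.
    have z0 : primitive_transfer H hi = 0 by rewrite /primitive_transfer ltxx.
    rewrite /continuous_at z0.
    apply/cvgrPdist_lt => e e0; move/cvgrPdist_lt : C => /(_ e e0) C.
    near=> y; rewrite /primitive_transfer; case: ifP => [yh|_]; last by rewrite subrr normr0.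
    by near: y; exact: C.
- move=> x rx; have [xh|hx|xh] := ltgtP x hi; last by have := rx 1%N; rewrite xh eqxx.
  + have D1 s : is_derive x 1 (H \o br s) (h (br s x) * dbr s x).
      apply: is_derive1_comp; first exact/dH/regular_br.
      exact: (mk_derive M s (ltW xh)).
    rewrite /transfer xh.
    apply: (@near_eq_is_derive _ _ _ (fun x => (H \o br true) x - (H \o br false) x)).
    * near=> y; rewrite /primitive_transfer.
      by have -> : y < hi by near: y; exact: lt_nbhsl.
    * rewrite /weight /side mul1r mulN1r mulrN; exact: is_deriveB.
  + rewrite /transfer ltNge (ltW hx) /=.
    apply: (@near_eq_is_derive _ _ _ (cst 0)).
      near=> y; rewrite /primitive_transfer ltNge.
      by have /ltW -> : hi < y by near: y; exact: lt_nbhsr.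
- by move=> x xh; rewrite /primitive_transfer ltNge xh.
- move=> x xl; have xh : x < hi by exact: le_lt_trans xl lohi.
  have [b1 b2] := br_lo; rewrite /primitive_transfer xh Hm ?H0 ?subr0 //.
    move: xl; rewrite le_eqVlt => /predU1P[->|xl]; first by rewrite b2.
    by rewrite -b2 ltW // (br_lt false xl).
  move: xl; rewrite le_eqVlt => /predU1P[->//|xl].
  by apply: le_trans b1; rewrite ltW // (br_lt true xl).
Unshelve. all: by end_near. Qed.

Lemma regular_seq : exists s : seq R, forall x, x \notin s -> regular_point x.
Proof.
have [K HK] := mk_finite M; exists [seq orb j | j <- iota 0 K] => x H k.
have [j jK ->] := HK k; apply: contra H => /eqP ->.
by apply: map_f; rewrite mem_iota.
Qed.

Lemma primitive_le H h m x y B : primitive H h m -> x <= y ->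
  (forall z, x < z < y -> regular_point z -> h z <= B) -> H y - H x <= B * (y - x).
Proof.
move=> [cH dH _ _] xy hB; have [s Hs] := regular_seq.
apply: (@mean_value_exceptions _ s _ h) => // z zxy /Hs rz.
by split; [exact: dH|exact: hB].
Qed.

Lemma primitive_ge H h m x y B : primitive H h m -> x <= y ->
  (forall z, x < z < y -> regular_point z -> B <= h z) -> B * (y - x) <= H y - H x.
Proof.
move=> [cH dH _ _] xy hB; have [s Hs] := regular_seq.
apply: (@mean_value_exceptions_ge _ s _ h) => // z zxy /Hs rz.
by split; [exact: dH|exact: hB].
Qed.

Lemma primitive_nondecreasing A H h m x y : cone A h -> primitive H h m ->
  x <= y -> H x <= H y.
Proof.
move=> [_ h0 _] P xy; have := @primitive_ge H h m x y 0 P xy.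
by rewrite mul0r subr_ge0; apply => z _; exact: h0.
Qed.

Lemma primitive_bounds A H h m x : cone A h -> primitive H h m -> - m <= H x <= 0.
Proof.
move=> Ch P; have [_ _ H0 Hm] := P; have nd := primitive_nondecreasing Ch P.
apply/andP; split.
  have [xl|/ltW xl] := leP x lo; first by rewrite Hm.
  by rewrite -(Hm lo) // nd.
have [xh|/ltW xh] := leP hi x; first by rewrite H0.
by rewrite -(H0 hi) // nd.
Qed.

Lemma mass_ge0 A H h m : cone A h -> primitive H h m -> 0 <= m.
Proof. by move=> Ch P; have /andP[] := primitive_bounds 0 Ch P; lra. Qed.

Lemma weighted_ge0 h s x : supported h -> (forall x, regular_point x -> 0 <= h x) ->
  x < hi -> regular_point x -> 0 <= h (br s x) * weight s x.
Proof.
move=> sh h0 xh rx; have /andP[k0 _] := mk_kap M.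
have [r|nr] := boolP (lo <= br s x <= hi); last by rewrite sh ?mul0r.
apply: mulr_ge0; first exact/h0/regular_br.
by apply: le_trans (mk_expand M xh r); exact: ltW.
Qed.

Lemma regular_preimage y : regular_point (f y) -> regular_point y.
Proof. by move=> H k; apply/eqP => e; have := H k.+1; rewrite e /= eqxx. Qed.

(** One of the two branches at [f y] returns to [y] with weight at least [kap]; the other
    contributes a nonnegative term. *)
Lemma transfer_ge h y : supported h -> (forall x, regular_point x -> 0 <= h x) ->
  lo <= y <= hi -> regular_point (f y) -> h y * kap <= transfer h (f y).
Proof.
move=> sh h0 yr rf; have /andP[_ fh] := mk_maps M yr.
have fh' : f y < hi by rewrite lt_neqAle fh andbT; exact: (rf 1%N).
have [s es] := br_f yr.
have ws : h y * kap <= h (br s (f y)) * weight s (f y).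
  rewrite es ler_wpM2l //; first exact/h0/regular_preimage.
  by apply: (mk_expand M) => //; rewrite es.
rewrite /transfer fh'; have w0 t := weighted_ge0 t sh h0 fh' rf.
by case: s {es} ws (w0 true) (w0 false); lra.
Qed.

(** The solution of [lam * A0 + D / kap = A0 - 1]. One application of the operator thus gains a full
    unit of exponent, which is later spent on subtracting a uniform density. *)
Definition cone_exponent : R := (D / kap + 1) / (1 - lam).
Notation A0 := cone_exponent.

Lemma cone_exponent_ge1 : 1 <= A0.
Proof.
have /andP[l0 l1] := mk_lam M; have /andP[k0 _] := mk_kap M; have D0 := mk_D M.
rewrite /cone_exponent ler_pdivlMr ?subr_gt0 // mul1r.
have : 0 <= D / kap by rewrite divr_ge0 // ltW.
lra.
Qed.

Lemma transfer_cone0 h : cone A0 h -> cone (A0 - 1) (transfer h).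
Proof.
move=> Ch; have A1 := cone_exponent_ge1; have /andP[l0 l1] := mk_lam M.
have -> : A0 - 1 = lam * A0 + D / kap.
  have /andP[k0 _] := mk_kap M.
  by rewrite /cone_exponent; field; rewrite gt_eqF // subr_eq0 gt_eqF.
by apply: transfer_cone => //; lra.
Qed.

Lemma iter_transfer_cone n h : cone A0 h -> cone A0 (iter n transfer h).
Proof.
move=> Ch; elim: n => // n /transfer_cone0; apply: cone_weaken; lra.
Qed.

Lemma iter_transfer_primitive n H h m : supported h -> primitive H h m ->
  supported (iter n transfer h) /\
  primitive (iter n primitive_transfer H) (iter n transfer h) m.
Proof.
move=> sh P; elim: n => // n [IH1 IH2]; split; first exact: transfer_supported.
exact: primitive_transfer_primitive.
Qed.

(** * Mixing and the Doeblin bound *)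

Lemma iter_maps n y : lo <= y <= hi -> lo <= iter n f y <= hi.
Proof. by move=> yr; elim: n => // n /(mk_maps M). Qed.

Lemma iter_transfer_ge n h y : cone A0 h -> lo <= y <= hi ->
  regular_point (iter n f y) -> h y * kap ^+ n <= iter n transfer h (iter n f y).
Proof.
move=> Ch yr; have /andP[k0 _] := mk_kap M.
elim: n => [_|n IH rn]; first by rewrite expr0 mulr1.
have [sh h0 _] := iter_transfer_cone n Ch.
apply: le_trans (transfer_ge sh h0 (iter_maps n yr) rn).
by rewrite exprSr mulrA; apply: ler_wpM2r; [exact: ltW|apply: IH; exact: regular_preimage].
Qed.

(** The point [x] is pulled back along the branches that the orbit of [y] follows; by [cell_br] the
    pullbacks stay in the cells of that orbit. *)
Lemma covering_step n x y : lo <= y <= hi -> cell (iter n f y) x ->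
  exists y', [/\ lo <= y' <= hi, cell y y' & iter n f y' = x].
Proof.
move=> yr; elim: n x => [x H|n IH x H].
  by exists x; split => //; rewrite -(cell_range H).
set w := iter n f y; have wr : lo <= w <= hi by exact: iter_maps.
have rw := cellL H; have [s es] := br_f wr.
have /andP[_ fh] := mk_maps M wr.
have fh' : f w < hi by rewrite lt_neqAle fh andbT; exact: (rw 1%N).
have Hb := cell_br s H fh'; rewrite /= -/w es in Hb.
have [y' [y'r yy' e]] := IH _ Hb; exists y'; split => //=.
rewrite e f_br // -?(cell_range Hb) //.
by rewrite ltW // -(cell_hi H).
Qed.

(** Cells are open, so by mixing the images of one cell meet any other cell at all late times, and
    [covering_step] upgrades meeting to covering. Finiteness of the cells makes the time uniform. *)
Lemma covering : exists2 N, (0 < N)%N &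
  forall x y, lo < x < hi -> regular_point x -> lo < y < hi -> regular_point y ->
  exists y', [/\ lo <= y' <= hi, cell y y' & iter N f y' = x].
Proof.
pose Q n x y := exists y', [/\ lo <= y' <= hi, cell y y' & iter n f y' = x].
have [||n0 Hn0] := @cells_eventually Q; last by exists n0.+1 => // x y *; exact: Hn0.
move=> n x y x' y' xx' yy' [z [zr yz e]].
  have [|z' [zr' zz' e']] := @covering_step n x' z zr; first by rewrite e.
  by exists z'; split => //; apply: cell_trans zz'; apply: cell_trans yz; exact: cell_sym.
move=> x y xr rx yr ry.
have inI z : lo < z < hi -> (`[lo, hi]%classic : set R) z.
  by move=> /andP[? ?]; rewrite /= in_itv /= !ltW.
have := mk_mix M (@cell_open y) (@cell_open x).
case; first by exists y; split; [exact: cell_refl|exact: inI].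
  by exists x; split; [exact: cell_refl|exact: inI].
move=> n0 _ Hn0; exists n0 => n nn.
have [z [[yz zr] [xz _]]] := Hn0 n nn.
have {}zr : lo <= z <= hi by move: zr; rewrite /= in_itv.
have [z' [? zz' ?]] := covering_step zr (cell_sym xz).
by exists z'; split => //; exact: cell_trans zz'.
Qed.

(** Half of the mean is asked for, so that the non-strict mean value inequality already gives the
    contradiction [m <= m / 2]. *)
Lemma mean_density A H h m : cone A h -> primitive H h m -> 0 < m ->
  exists y, [/\ lo < y < hi, regular_point y & m / (2 * (hi - lo)) <= h y].
Proof.
move=> Ch P m0; apply: contrapT => no.
have ll : 0 < hi - lo by rewrite subr_gt0.
have := @primitive_le H h m lo hi (m / (2 * (hi - lo))) P (ltW lohi).
have [_ _ H0 Hm] := P; rewrite H0 // Hm // opprK add0r.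
have -> : m / (2 * (hi - lo)) * (hi - lo) = m / 2 by field; rewrite gt_eqF.
have half : ~~ (m <= m / 2) by rewrite -ltNge; lra.
rewrite (negbTE half) => F; suff : false by [].
apply: F => z zr rz; rewrite leNgt; apply/negP => lt.
by apply: no; exists z; split => //; exact: ltW.
Qed.

(** Half the mean density is reached somewhere, the cone spreads it over a cell at the cost
    [expR (- (A0 * (hi - lo)))], and [covering] carries it to every regular point at the cost
    [kap ^+ N]. The bound [d * (hi - lo) < 1] later keeps the remaining mass positive. *)
Lemma doeblin : exists N d, [/\ (0 < N)%N, 0 < d, d * (hi - lo) < 1 &
  forall H h m, cone A0 h -> primitive H h m ->
  forall x, lo < x < hi -> regular_point x -> d * m <= iter N transfer h x].
Proof.
have [N N0 cov] := covering; have /andP[k0 k1] := mk_kap M.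
have ll : 0 < hi - lo by rewrite subr_gt0.
have A1 := cone_exponent_ge1.
exists N, (kap ^+ N * expR (- (A0 * (hi - lo))) / (2 * (hi - lo))).
have kN : 0 < kap ^+ N by rewrite exprn_gt0.
have kN1 : kap ^+ N <= 1 by rewrite exprn_ile1 // ltW.
have E0 := expR_gt0 (- (A0 * (hi - lo))).
have E1 : expR (- (A0 * (hi - lo))) <= 1.
  by rewrite -expR0 ler_expR oppr_le0 mulr_ge0 ?ltW //; lra.
split=> //.
- by rewrite divr_gt0 ?mulr_gt0.
- have -> : kap ^+ N * expR (- (A0 * (hi - lo))) / (2 * (hi - lo)) * (hi - lo) =
    kap ^+ N * expR (- (A0 * (hi - lo))) / 2 by field; rewrite gt_eqF.
  by have := ler_pM (ltW kN) (ltW E0) kN1 E1; lra.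
move=> H h m Ch P x xr rx.
have := mass_ge0 Ch P; rewrite le_eqVlt => /predU1P[<-|m0].
  by rewrite mulr0; have [_ + _] := iter_transfer_cone N Ch; exact.
have [y [yr ry hy]] := mean_density Ch P m0.
have [y' [yr' yy' e]] := cov x y xr rx yr ry.
have := iter_transfer_ge Ch yr' (_ : regular_point (iter N f y')).
rewrite e => /(_ rx); apply: le_trans.
have [_ _ /(_ _ _ yy') hc] := Ch.
have h1 : h y <= h y' * expR (A0 * (hi - lo)).
  apply: le_trans hc _; apply: ler_wpM2l.
    by have [_ + _] := Ch; apply; exact: cellR yy'.
  rewrite ler_expR ler_wpM2l //; first by lra.
  by apply: cell_dist => //; have /andP[? ?] := yr; rewrite !ltW.
have {}h1 : m / (2 * (hi - lo)) * expR (- (A0 * (hi - lo))) <= h y'.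
  rewrite expRN ler_pdivrMr ?expR_gt0 //; exact: le_trans h1.
have := ler_wpM2r (ltW kN) h1; apply: le_trans.
by rewrite le_eqVlt; apply/orP; left; apply/eqP; ring.
Qed.

(** * Contraction of mass and exponential decay *)

Definition uniform_density (x : R) : R := if lo <= x <= hi then 1 else 0.
Definition uniform_primitive (x : R) : R := Num.max (lo - hi) (Num.min (x - hi) 0).

Lemma uniform_primitiveP : primitive uniform_primitive uniform_density (hi - lo).
Proof.
have ll := lohi.
split.
- move=> x.
  apply: (@continuous_max _ _ (cst (lo - hi)) (fun x => Num.min (x - hi) 0)).
    exact: cst_continuous.
  apply: (@continuous_min _ _ (fun x => x - hi) (cst 0)); last exact: cst_continuous.
  by apply: cvgB; [exact: cvg_id|exact: cvg_cst].
- move=> x rx; rewrite /uniform_density; case: ifPn => [/(regular_lo rx)/andP[xl xh]|].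
    apply: (@near_eq_is_derive _ _ _ (fun x => x - hi)).
      near=> y; rewrite /uniform_primitive.
      have yl : lo < y by near: y; exact: lt_nbhsr.
      have yh : y < hi by near: y; exact: lt_nbhsl.
      by rewrite min_l ?max_r //; lra.
    by rewrite -[X in is_derive _ _ _ X]subr0; apply: is_deriveB.
  rewrite negb_and -!ltNge => /orP[xl|xh].
    apply: (@near_eq_is_derive _ _ _ (cst (lo - hi))).
      near=> y; rewrite /uniform_primitive.
      have yl : y < lo by near: y; exact: lt_nbhsl.
      by rewrite min_l ?max_l //; lra.
  apply: (@near_eq_is_derive _ _ _ (cst 0)).
    near=> y; rewrite /uniform_primitive.
    have yl : hi < y by near: y; exact: lt_nbhsr.
    by rewrite min_r ?max_r //; lra.
- by move=> x xh; rewrite /uniform_primitive min_r ?max_r //; lra.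
- by move=> x xl; rewrite /uniform_primitive min_l ?max_l //; lra.
Unshelve. all: by end_near. Qed.

Lemma primitive_lin H h m H' h' m' r : primitive H h m -> primitive H' h' m' ->
  primitive (fun x => H x + r * H' x) (fun x => h x + r * h' x) (m + r * m').
Proof.
move=> [c1 d1 z1 l1] [c2 d2 z2 l2]; split.
- by move=> x; apply: cvgD; [exact: c1|apply: cvgM; [exact: cvg_cst|exact: c2]].
- move=> x rx; apply: is_deriveD; first exact: d1.
  by have := d2 x rx; exact: is_deriveZ.
- by move=> x xh; rewrite z1 // z2 // mulr0 addr0.
- by move=> x xl; rewrite l1 // l2 // mulrN opprD.
Qed.

Lemma primitive_transfer_lin h h' r : primitive_transfer (fun x => h x + r * h' x) =
  (fun x => primitive_transfer h x + r * primitive_transfer h' x).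
Proof.
apply/funext => x; rewrite /primitive_transfer; case: ifP => _; first by ring.
by rewrite mulr0 addr0.
Qed.

Lemma iter_primitive_transfer_lin n h h' r :
  iter n primitive_transfer (fun x => h x + r * h' x) =
  (fun x => iter n primitive_transfer h x + r * iter n primitive_transfer h' x).
Proof. by elim: n => //= n ->; rewrite primitive_transfer_lin. Qed.

(** Subtracting [e] costs [e * (E - 1)] with [E = expR (A0 * d)], at most [e * A0 * d * E]. The
    spare unit of exponent yields [h y * (E - expR ((A0 - 1) * d))], at least [h y * d]. The lower
    bound assumed on [h] is what balances the two. *)
Lemma cone_subtract h e : cone (A0 - 1) h -> 0 <= e ->
  (forall x, lo < x < hi -> regular_point x ->
     e * (A0 * expR (A0 * (hi - lo))) <= h x) ->
  cone A0 (fun x => h x - e * uniform_density x).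
Proof.
move=> [sh h0 hA] e0 he; have A1 := cone_exponent_ge1.
have ll : 0 < hi - lo by rewrite subr_gt0.
have E1 : 1 <= expR (A0 * (hi - lo)) by rewrite -expR0 ler_expR mulr_ge0 ?ltW //; lra.
split.
- by move=> x nx; rewrite /uniform_density (negbTE nx) sh // mulr0 subr0.
- move=> x rx; rewrite /uniform_density; case: ifPn => [r|nr]; last first.
    by rewrite mulr0 subr0; exact: h0.
  have := he x (regular_lo rx r) rx; rewrite mulr1.
  have AE : 1 <= A0 * expR (A0 * (hi - lo)).
    by move: A1 E1; set E := expR _; nra.
  by have := ler_wpM2l e0 AE; lra.
move=> x y H; rewrite /uniform_density -(cell_range H); case: ifPn => [r|nr].
  rewrite !mulr1; set d := `|x - y|.
  have d0 : 0 <= d by exact: normr_ge0.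
  have dl : d <= hi - lo by exact: cell_dist.
  have rx := cellL H; have ry := cellR H.
  have hy := he y (regular_lo ry _) ry; rewrite -(cell_range H) in hy.
  have {}hy := hy r.
  have := hA _ _ H; rewrite -/d => hxy.
  have EA : expR (A0 * d) <= expR (A0 * (hi - lo)) by rewrite ler_expR ler_wpM2l //; lra.
  have e1 : 1 - A0 * d <= expR (- (A0 * d)) by have := expR_ge1Dx (- (A0 * d)).
  have e2 : 1 + d <= expR d by exact: expR_ge1Dx.
  have e3 : expR (A0 * d) * expR (- (A0 * d)) = 1 by rewrite -expRD subrr expR0.
  have e5 : 1 <= expR ((A0 - 1) * d).
    rewrite -[X in X <= _]expR0 ler_expR; apply: mulr_ge0 => //; lra.
  have e6 : expR (A0 * d) = expR ((A0 - 1) * d) * expR d.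
    by rewrite -expRD; congr expR; ring.
  have Eg := expR_gt0 (A0 * (hi - lo)).
  have Ed := expR_gt0 (A0 * d).
  have s1 : expR (A0 * d) - 1 <= A0 * d * expR (A0 * d) by nra.
  have s2 : e * (A0 * d * expR (A0 * d)) <= h y * d.
    have : e * (A0 * expR (A0 * d)) <= h y.
      by apply: le_trans hy; rewrite ler_wpM2l // ler_wpM2l //; lra.
    by move=> /(ler_wpM2r d0); lra.
  have hy0 : 0 <= h y by exact: h0.
  have s3 : d <= expR (A0 * d) - expR ((A0 - 1) * d) by rewrite e6; nra.
  have := ler_wpM2l hy0 s3; have := ler_wpM2l e0 s1; lra.
by rewrite !mulr0 !subr0; apply: le_trans (hA _ _ H) _; rewrite sh ?mul0r // -(cell_range H).
Qed.

(* Subtracting from the iterate a fixed fraction of the uniform density leaves the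
   cone invariant and shrinks the mass. *)
Lemma mass_contraction : exists N q, [/\ (0 < N)%N, 0 < q < 1 &
  exists e, forall H h m, cone A0 h -> primitive H h m ->
  cone A0 (fun x => iter N transfer h x + - (e * m) * uniform_density x) /\
  primitive (fun x => iter N primitive_transfer H x + - (e * m) * uniform_primitive x)
    (fun x => iter N transfer h x + - (e * m) * uniform_density x) (q * m)].
Proof.
have [[|N] [d [// N0 d0 dl Hd]]] := doeblin; have A1 := cone_exponent_ge1.
have ll : 0 < hi - lo by rewrite subr_gt0.
have E1 : 1 <= expR (A0 * (hi - lo)) by rewrite -expR0 ler_expR mulr_ge0 ?ltW //; lra.
have AE : 1 <= A0 * expR (A0 * (hi - lo)) by move: A1 E1; set E := expR _; nra.
(* With this [e] the Doeblin bound [d * m] is exactly the lower bound under which [cone_subtract]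
   allows [e * m] to be removed. *)
pose e := d / (A0 * expR (A0 * (hi - lo))).
have e0 : 0 < e by rewrite divr_gt0 //; lra.
have ed : e <= d by rewrite ler_pdivrMr ?ler_peMr //; lra.
exists N.+1, (1 - e * (hi - lo)); split => //.
  have : e * (hi - lo) <= d * (hi - lo) by rewrite ler_wpM2r // ltW.
  by have := mulr_gt0 e0 ll; lra.
exists e => H h m Ch P; have m0 := mass_ge0 Ch P.
have sh : supported h by case: Ch.
split.
  have -> : (fun x => iter N.+1 transfer h x + - (e * m) * uniform_density x) =
     (fun x => iter N.+1 transfer h x - (e * m) * uniform_density x).
    by apply/funext => x; rewrite mulNr.
  apply: cone_subtract; first exact/transfer_cone0/iter_transfer_cone.
    by rewrite mulr_ge0 // ltW.
  move=> x xr rx; apply: le_trans (Hd H h m Ch P x xr rx).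
  by rewrite mulrAC /e divfK // gt_eqF //; lra.
have [_ P'] := iter_transfer_primitive N.+1 sh P.
have := primitive_lin (- (e * m)) P' uniform_primitiveP.
by congr primitive; ring.
Qed.

(** Two densities of equal mass lose the same multiple of the uniform density at every block, so
    their difference is unaffected while the mass of each remainder shrinks. A primitive from the
    cone is bounded by its mass. *)
Lemma coupling : exists q, 0 < q < 1 /\ exists2 C, 0 <= C &
  forall H1 h1 H2 h2 m, cone A0 h1 -> cone A0 h2 ->
    primitive H1 h1 m -> primitive H2 h2 m -> forall n x,
  `|iter n primitive_transfer H1 x - iter n primitive_transfer H2 x| <= C * m * q ^+ n.
Proof.
have [N [q [N0 /andP[q0 q1] [e HN]]]] := mass_contraction.
have N0' : 0 < (N%:R : R) by rewrite ltr0n.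
(* A rate per step with [q <= r ^+ N], by the Bernoulli inequality; this replaces the [N]-th root of
   [q]. *)
pose r := 1 - (1 - q) / N%:R.
have N1 : 1 <= (N%:R : R) by rewrite ler1n.
have r0 : 0 < r.
  by rewrite /r subr_gt0 ltr_pdivrMr // mul1r; lra.
have r1 : r < 1 by rewrite /r; have := divr_gt0 (_ : 0 < 1 - q) N0'; lra.
have qr : q <= r ^+ N.
  have bern : forall k, 1 - k%:R * (1 - r) <= r ^+ k.
    elim=> [|k IH]; first by rewrite expr0; lra.
    rewrite exprS -natr1; have k0 : 0 <= (k%:R : R) by exact: ler0n.
    by have := ler_wpM2l (ltW r0) IH; have := mulr_ge0 k0 (sqr_ge0 (1 - r)); lra.
  by apply: le_trans (bern N); rewrite /r opprB addrCA subrr addr0 mulrCA divff ?gt_eqF //; lra.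
exists r; split; first by rewrite r0.
exists (r ^+ N)^-1; first by rewrite invr_ge0 exprn_ge0 // ltW.
have blocks j : forall H1 h1 H2 h2 m, cone A0 h1 -> cone A0 h2 ->
    primitive H1 h1 m -> primitive H2 h2 m -> forall k x,
  `|iter (k + j * N) primitive_transfer H1 x - iter (k + j * N) primitive_transfer H2 x|
     <= q ^+ j * m.
  elim: j => [|j IH] H1 h1 H2 h2 m C1 C2 P1 P2 k x.
    rewrite mul0n addn0 expr0 mul1r.
    have [s1 _ _] := C1; have [s2 _ _] := C2.
    have [_ /(primitive_bounds x (iter_transfer_cone k C1))/andP[? ?]] :=
      iter_transfer_primitive k s1 P1.
    have [_ /(primitive_bounds x (iter_transfer_cone k C2))/andP[? ?]] :=
      iter_transfer_primitive k s2 P2.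
    by rewrite ler_norml; apply/andP; split; lra.
  have [C1' P1'] := HN _ _ _ C1 P1; have [C2' P2'] := HN _ _ _ C2 P2.
  have := IH _ _ _ _ _ C1' C2' P1' P2' k x.
  rewrite !iter_primitive_transfer_lin -!iterD mulrA -exprSr mulSn.
  by rewrite opprD addrACA subrr addr0 -addnA [(j * N + N)%N]addnC.
move=> H1 h1 H2 h2 m C1 C2 P1 P2 n x.
have := blocks (n %/ N)%N _ _ _ _ _ C1 C2 P1 P2 (n %% N)%N x.
rewrite addnC -divn_eq => /le_trans; apply.
rewrite mulrAC ler_wpM2r ?(mass_ge0 C1 P1) //.
rewrite -(ler_pM2l (exprn_gt0 N r0)) mulrA divff ?gt_eqF ?exprn_gt0 // mul1r.
rewrite {2}(divn_eq n N) exprD [leRHS]mulrC.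
apply: ler_pM; try by rewrite exprn_ge0 // ltW.
  by apply: ler_wiXn2l; [exact: ltW|exact: ltW|rewrite ltnW // ltn_mod].
by rewrite mulnC exprM lerXn2r // ?nnegrE ltW // exprn_gt0.
Qed.

(** Adding [2 * B] on the support makes the density at least [B], so the Lipschitz constant [B]
    becomes a relative one of at most 1, and [1 <= A0] suffices. *)
Lemma lipschitz_cone k B (K := fun x => k x + 2 * B * uniform_density x) : supported k ->
  (forall x, regular_point x -> `|k x| <= B) ->
  (forall x y, cell x y -> `|k x - k y| <= B * `|x - y|) -> cone A0 K.
Proof.
move=> sk kB kL; have A1 := cone_exponent_ge1; rewrite /K.
split.
- by move=> x nx; rewrite /uniform_density (negbTE nx) sk // mulr0 addr0.
- move=> x rx; have := kB x rx; rewrite /uniform_density ler_norml => /andP[? ?].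
  case: ifPn => [_|/sk ->]; last by rewrite mulr0 addr0.
  by have := normr_ge0 (k x); have := kB x rx; lra.
move=> x y H; rewrite /uniform_density -(cell_range H).
have := kB y (cellR H); have := kL x y H; rewrite !ler_norml => /andP[_ h1] /andP[h2 h3].
case: ifPn => [_|nr]; last by rewrite (sk x) // (sk y) -?(cell_range H) // mulr0 addr0 mul0r.
have B0 : 0 <= B by lra.
have : 1 + `|x - y| <= expR (A0 * `|x - y|).
  by apply: le_trans (expR_ge1Dx _); rewrite lerD2l ler_peMl.
have d0 := normr_ge0 (x - y); rewrite mulr1.
have : B <= k y + 2 * B by lra.
by move=> h4 h5; have := ler_wpM2l (_ : 0 <= k y + 2 * B) h5; nra.
Qed.

Lemma primitive0 : primitive (fun=> 0) (fun=> 0) 0.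
Proof. by split => // *; [exact: cst_continuous|exact: is_derive_cst|rewrite oppr0]. Qed.

Lemma iter_primitive_transfer0 n x : iter n primitive_transfer (fun=> 0) x = 0.
Proof.
elim: n x => //= n IH x; rewrite /primitive_transfer !IH subrr.
by case: ifP.
Qed.

(** [K] is the difference of two primitives of cone densities, itself plus [2 * B] uniform and
    [2 * B] uniform; their masses agree because [K] has mass zero, so [coupling] applies. *)
Lemma decay : exists2 q, 0 < q < 1 & forall K k B, 0 <= B ->
  supported k -> primitive K k 0 ->
  (forall x, regular_point x -> `|k x| <= B) ->
  (forall x y, cell x y -> `|k x - k y| <= B * `|x - y|) ->
  exists2 C, 0 <= C & forall n x, `|iter n primitive_transfer K x| <= C * q ^+ n.
Proof.
have [q [q01 [C C0 HC]]] := coupling; exists q => // K k B B0 sk Pk kB kL.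
have ll : 0 < hi - lo by rewrite subr_gt0.
have P1 := primitive_lin (2 * B) Pk uniform_primitiveP.
have P2 := primitive_lin (2 * B) primitive0 uniform_primitiveP.
have C1 := lipschitz_cone sk kB kL.
have C2 : cone A0 (fun x => (fun=> 0) x + 2 * B * uniform_density x).
  apply: lipschitz_cone => // *; first by rewrite normr0.
  by rewrite subrr normr0 mulr_ge0.
exists (C * (0 + 2 * B * (hi - lo))).
  by rewrite mulr_ge0 // add0r mulr_ge0 ?mulr_ge0 // ltW.
move=> n x; have := HC _ _ _ _ _ C1 C2 P1 P2 n x.
by rewrite !iter_primitive_transfer_lin iter_primitive_transfer0 add0r addrK.
Qed.

(** * Sup bounds and first-order regularity of the iterates *)

Lemma cell_balls : exists2 d, 0 < d & forall x, lo < x < hi -> regular_point x ->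
  exists y, forall z, `|z - y| < d -> cell x z.
Proof.
pose Q n x (_ : R) := exists y, forall z, `|z - y| < n.+1%:R^-1 -> cell x z.
have [||n0 Hn0] := @cells_eventually Q; last 1 first.
- exists n0.+1%:R^-1; first by rewrite invr_gt0 ltr0n.
  by move=> x xr rx; exact: (Hn0 n0 (leqnn _) x x).
- move=> n x y x' y' xx' _ [z Hz]; exists z => w /Hz; apply: cell_trans.
  exact: cell_sym.
move=> x y _ rx _ _; have [d d0 Hd] := regular_ball rx.
have [n0 Hn0] := ltr_add_invr d0.
exists n0 => n nn; exists x => z zn; apply: Hd; apply: lt_le_trans zn _.
apply: le_trans (_ : n0.+1%:R^-1 <= _); first by rewrite lef_pV2 ?posrE ?ltr0n // ler_nat.
by rewrite -[leLHS]add0r; exact: ltW.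
Qed.

(** A ball of uniform size inside the cell of [x] carries mass at least a constant times [h x],
    because the cone keeps [h] comparable to [h x] there. *)
Lemma density_bound : exists2 C, 0 <= C & forall H h m,
  cone A0 h -> primitive H h m -> forall x, regular_point x -> h x <= C * m.
Proof.
have [d d0 Hd] := cell_balls; have A1 := cone_exponent_ge1.
have ll : 0 < hi - lo by rewrite subr_gt0.
set E := expR (A0 * (hi - lo)); have E0 : 0 < E by exact: expR_gt0.
exists (E / d); first by rewrite divr_ge0 // ltW.
move=> H h m Ch P x rx; have m0 := mass_ge0 Ch P; have [sh h0 hc] := Ch.
have [r|nr] := boolP (lo <= x <= hi); last first.
  by rewrite sh // mulr_ge0 // divr_ge0 // ltW.
have [y Hy] := Hd x (regular_lo rx r) rx.
pose u := y - d / 2; pose v := y + d / 2.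
have inb z : u < z < v -> cell x z.
  by rewrite /u /v => /andP[? ?]; apply: Hy; rewrite ltr_norml; apply/andP; split; lra.
have uv : u <= v by rewrite /u /v; lra.
have hz z : u < z < v -> h x / E <= h z.
  move=> /inb xz; rewrite ler_pdivrMr //; apply: le_trans (hc _ _ xz) _.
  apply: ler_wpM2l; first exact/h0/(cellR xz).
  by rewrite ler_expR ler_wpM2l //; [lra|exact: cell_dist].
have := @primitive_ge H h m u v (h x / E) P uv (fun z zr _ => hz z zr).
have /andP[? _] := primitive_bounds u Ch P; have /andP[_ ?] := primitive_bounds v Ch P.
have -> : v - u = d by rewrite /u /v; field.
move=> hd; have {}hd : h x / E * d <= m by lra.
have -> : h x = h x / E * d * (E / d) by field; rewrite !gt_eqF.
by rewrite [leRHS]mulrC ler_wpM2r // divr_ge0 // ltW.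
Qed.

Lemma cone_lip h x y : cone A0 h -> cell x y -> lo <= x <= hi ->
  `|h x - h y| <= A0 * expR (A0 * (hi - lo)) * `|x - y| * h x /\
  h y <= expR (A0 * (hi - lo)) * h x.
Proof.
move=> [sh h0 hc] H r; have A1 := cone_exponent_ge1.
have d0 := normr_ge0 (x - y); have dl := cell_dist H r.
have := hc _ _ H; have := hc _ _ (cell_sym H); rewrite [`|y - x|]distrC.
have := h0 x (cellL H); have := h0 y (cellR H).
set d := `|x - y| in d0 dl *.
have EA : expR (A0 * d) <= expR (A0 * (hi - lo)) by rewrite ler_expR ler_wpM2l //; lra.
have e1 : 1 - A0 * d <= expR (- (A0 * d)) by have := expR_ge1Dx (- (A0 * d)).
have e3 : expR (A0 * d) * expR (- (A0 * d)) = 1 by rewrite -expRD subrr expR0.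
move: EA e1 e3.
have := expR_gt0 (A0 * d); have := expR_gt0 (- (A0 * d)).
set E := expR (A0 * (hi - lo)); set e := expR (A0 * d); set e' := expR (- (A0 * d)).
move=> e'0 e0 EA e1 e3 hy0 hx0 h1 h2.
have ed0 : 0 <= A0 * d by rewrite mulr_ge0 //; lra.
have s1 : e - 1 <= A0 * d * e by nra.
have s2 : A0 * d * e <= A0 * d * E by rewrite ler_wpM2l.
have E1 : 1 <= E by rewrite -[X in X <= _]expR0 ler_expR mulr_ge0 //; lra.
have s3 : A0 * d <= A0 * d * E by rewrite ler_peMr.
split; last by have := ler_wpM2l hx0 EA; lra.
have t1 := ler_wpM2l hx0 s1; have t2 := ler_wpM2l hx0 s2.
have t3 := ler_wpM2l hx0 s3; have t4 := ler_wpM2l hx0 e1.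
have t5 : h x * e' <= h y by have := ler_wpM2r (ltW e'0) h2; rewrite -mulrA e3 mulr1.
by rewrite ler_norml; apply/andP; split; lra.
Qed.

(** The fixed point of [B0 = lam ^+ 2 * B0 + (3 * A0 * E * D + D) / kap], with [E] the exponential
    above. Of the three terms in [A0 * E * D], two come from the increment of the squared branch
    derivative and one from that of [h]; the single [D] comes from the second derivative of the
    branch. *)
Definition smooth_exponent : R :=
  (3 * A0 * expR (A0 * (hi - lo)) * D + D) / kap / (1 - lam ^+ 2).
Notation B0 := smooth_exponent.

Lemma smooth_exponent_ge0 : 0 <= B0.
Proof.
have /andP[l0 l1] := mk_lam M; have /andP[k0 k1] := mk_kap M; have D0 := mk_D M.
have A1 := cone_exponent_ge1; have E0 := expR_ge0 (A0 * (hi - lo)).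
have A00 : 0 <= A0 by lra.
apply: divr_ge0; last by rewrite subr_ge0 exprn_ile1 // ltW.
apply: divr_ge0; last exact: ltW.
by have := mulr_ge0 (mulr_ge0 A00 E0) D0; lra.
Qed.

Definition transfer_derivative (h g : R -> R) x :=
  if x < hi then
    side true * (g (br true x) * dbr true x ^+ 2 + h (br true x) * ddbr true x) +
    side false * (g (br false x) * dbr false x ^+ 2 + h (br false x) * ddbr false x)
  else 0.

(** A cone condition of the next order, with [g] the derivative of [h]. Bounds relative to [h] can
    be added over the two branches, which makes the condition invariant with fixed constants. *)
Definition smooth (h g : R -> R) :=
  [/\ supported g, forall x, regular_point x -> is_derive x 1 h (g x),
      forall x, regular_point x -> `|g x| <= A0 * h x &
      forall x y, cell x y -> `|g x - g y| <= B0 * `|x - y| * h x].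

Lemma transfer_smooth h g : cone A0 h -> smooth h g ->
  smooth (transfer h) (transfer_derivative h g).
Proof.
move=> Ch [sg dh gA gB]; have [sh h0 hc] := Ch.
have /andP[l0 l1] := mk_lam M; have /andP[k0 k1] := mk_kap M; have D0 := mk_D M.
have A1 := cone_exponent_ge1; have ll : 0 < hi - lo by rewrite subr_gt0.
split.
- move=> x; rewrite negb_and -!ltNge /transfer_derivative => /orP[xl|xh]; last first.
    by rewrite ltNge ltW.
  case: ifP => // _; have nb s := br_below s xl.
  by rewrite !sg // !sh // !mul0r !addr0 !mulr0 addr0.
- move=> x rx; have [xh|hx|xh] := ltgtP x hi; last by have := rx 1%N; rewrite xh eqxx.
    have Db s : is_derive x 1 (fun x => h (br s x) * weight s x)
        (side s * (g (br s x) * dbr s x ^+ 2 + h (br s x) * ddbr s x)).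
      have rb := regular_br s xh rx.
      have [r|nr] := boolP (lo <= br s x <= hi).
        have [D2 _] := mk_derive2 M (ltW xh) r.
        have D1 : is_derive x 1 (h \o br s) (g (br s x) * dbr s x).
          by exact: (is_derive1_comp (dh _ rb) (mk_derive M s (ltW xh))).
        have D3 : is_derive x 1 (fun x => side s *: dbr s x) (side s *: ddbr s x).
          exact: is_deriveZ.
        have -> : side s * (g (br s x) * dbr s x ^+ 2 + h (br s x) * ddbr s x) =
          (h \o br s) x *: (side s *: ddbr s x) +
          (side s *: dbr s x) *: (g (br s x) * dbr s x).
          by rewrite /GRing.scale /=; ring.
        exact: is_deriveM.
      rewrite sg // sh // !mul0r addr0 mulr0.
      apply: (@near_eq_is_derive _ _ _ (cst 0)).
      have [d d0 Hd] := regular_ball rx.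
      near=> y; have xy : cell x y.
        apply: Hd; rewrite distrC; near: y.
        exact: (nbhsx_ballx x d d0).
      by rewrite sh ?mul0r // -(cell_range (cell_br s xy xh)).
    apply: (@near_eq_is_derive _ _ _ (fun x => h (br true x) * weight true x +
       h (br false x) * weight false x)).
      near=> y; rewrite /transfer.
      by have -> : y < hi by near: y; exact: lt_nbhsl.
    by rewrite /transfer_derivative xh; exact: is_deriveD.
  rewrite /transfer_derivative ltNge (ltW hx) /=.
  apply: (@near_eq_is_derive _ _ _ (cst 0)).
  near=> y; rewrite /transfer ltNge.
  by have /ltW -> : hi < y by near: y; exact: lt_nbhsr.
- move=> x rx; rewrite /transfer /transfer_derivative; case: ifP => [xh|_]; last first.
    by rewrite normr0 mulr0.
  suff P s : `|side s * (g (br s x) * dbr s x ^+ 2 + h (br s x) * ddbr s x)| <=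
      A0 * (h (br s x) * weight s x).
    by rewrite [leRHS]mulrDr; apply: le_trans (ler_normD _ _) _; exact: lerD.
  have [r|nr] := boolP (lo <= br s x <= hi); last first.
    by rewrite sg // sh // !mul0r addr0 !mulr0 normr0.
  have [_ dD] := mk_derive2 M (ltW xh) r; have wk := mk_expand M xh r.
  have pl := mk_contract M s (ltW xh); have rb := regular_br s xh rx.
  have hb := h0 _ rb; have gb := gA _ rb.
  rewrite /weight; set w := side s * dbr s x in wk *.
  have w2 : dbr s x ^+ 2 = w ^+ 2 by rewrite /w /side; case: (s); ring.
  have wl : w <= lam.
    by move: pl; rewrite /w /side ler_norml; case: (s) => /andP[? ?]; lra.
  have w0 : 0 < w by exact: lt_le_trans wk.
  have -> : `|side s * (g (br s x) * dbr s x ^+ 2 + h (br s x) * ddbr s x)| =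
     `|g (br s x) * w ^+ 2 + h (br s x) * ddbr s x|.
    by rewrite w2 normrM /side; case: (s); rewrite ?normrN normr1 mul1r.
  have E : A0 * (h (br s x) * w) = A0 * lam * (h (br s x) * w) + (D / kap + 1) * (h (br s x) * w).
    by rewrite /cone_exponent; field; rewrite gt_eqF // subr_eq0 gt_eqF.
  rewrite E; apply: le_trans (ler_normD _ _) _; rewrite (normrM (g _)) (normrM (h _)) (ger0_norm hb).
  have hw0 : 0 <= h (br s x) * w by rewrite mulr_ge0 // ltW.
  apply: lerD.
    rewrite (ger0_norm (sqr_ge0 w)) expr2 [leLHS]mulrA.
    apply: le_trans (_ : A0 * h (br s x) * w * lam <= _); last by rewrite le_eqVlt; apply/orP; left; apply/eqP; ring.
    apply: ler_pM => //; [by rewrite mulr_ge0 // ltW|exact: ltW|].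
    by rewrite ler_wpM2r // ltW.
  apply: le_trans (_ : D / kap * (h (br s x) * w) <= _); last by rewrite ler_wpM2r // lerDl.
  rewrite mulrCA; apply: ler_wpM2l => //; apply: le_trans dD _.
  by rewrite mulrAC ler_pdivlMr // ler_wpM2l.
move=> x y H; rewrite /transfer /transfer_derivative -(cell_hi H).
case: ifP => [xh|_]; last by rewrite subrr normr0 mulr0.
have yh : y < hi by rewrite -(cell_hi H).
suff P s : `|side s * (g (br s x) * dbr s x ^+ 2 + h (br s x) * ddbr s x) -
    side s * (g (br s y) * dbr s y ^+ 2 + h (br s y) * ddbr s y)| <=
      B0 * `|x - y| * (h (br s x) * weight s x).
  rewrite [leRHS]mulrDr opprD addrACA; apply: le_trans (ler_normD _ _) _; exact: lerD.
have Hb := cell_br s H xh.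
have [r|nr] := boolP (lo <= br s x <= hi); last first.
  have nr' : ~~ (lo <= br s y <= hi) by rewrite -(cell_range Hb).
  by rewrite !sg // !sh // !mul0r !addr0 !mulr0 subrr normr0.
have r' : lo <= br s y <= hi by rewrite -(cell_range Hb).
have [_ dD] := mk_derive2 M (ltW yh) r'.
have wk := mk_expand M xh r.
have pl := mk_contract M s (ltW xh); have pl' := mk_contract M s (ltW yh).
have L1 := mk_lip M (ltW xh) (ltW yh) r r'; have L2 := mk_lip2 M (ltW xh) (ltW yh) r r'.
have Lb := br_lip s (ltW xh) (ltW yh).
have hb := h0 _ (cellL Hb); have gb := gA _ (cellR Hb); have gl := gB _ _ Hb.
have [hl hE] := cone_lip Ch Hb r.
rewrite -mulrBr normrM.
have -> : `|side s| = 1 :> R by rewrite /side; case: (s); rewrite ?normrN normr1.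
rewrite mul1r /weight; set w := side s * dbr s x in wk *.
have w2 : dbr s x ^+ 2 = w ^+ 2 by rewrite /w /side; case: (s); ring.
have wl : w <= lam.
  by move: pl; rewrite /w /side ler_norml; case: (s) => /andP[? ?]; lra.
have w0 : 0 < w by exact: lt_le_trans wk.
set E := expR _ in hl hE; set d := `|x - y| in Lb L1 L2 *.
have d0 : 0 <= d by exact: normr_ge0.
have E0 : 0 < E by exact: expR_gt0.
set t := `|br s x - br s y| in Lb gl hl.
have t0 : 0 <= t by exact: normr_ge0.
have td : t <= d by apply: le_trans Lb _; rewrite ler_piMl // ltW.
have l2 : lam ^+ 2 < 1 by rewrite expr_lt1 // ltW.
have A00 : 0 <= A0 by lra.
have num0 : 0 <= 3 * A0 * E * D + D.
  by have := mulr_ge0 (mulr_ge0 A00 (ltW E0)) D0; lra.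
have B00 := smooth_exponent_ge0.
set hx := h (br s x) in hb hl hE gl *; set hy := h (br s y) in hl hE gb *.
have hw : kap * hx <= hx * w by rewrite mulrC ler_wpM2l.
(* Four increments are separated: of [g], of the squared branch derivative, of the second branch
   derivative, and of [h]. Only the first involves [B0], and it comes with the factor [lam ^+ 2]. *)
have -> : g (br s x) * dbr s x ^+ 2 + hx * ddbr s x -
   (g (br s y) * dbr s y ^+ 2 + hy * ddbr s y) =
   (g (br s x) - g (br s y)) * w ^+ 2 +
   g (br s y) * ((dbr s x - dbr s y) * (dbr s x + dbr s y)) +
   hx * (ddbr s x - ddbr s y) + (hx - hy) * ddbr s y by rewrite -w2; ring.
have n1 : `|(g (br s x) - g (br s y)) * w ^+ 2| <= B0 * lam ^+ 2 * d * (hx * w).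
  rewrite normrM (ger0_norm (sqr_ge0 w)).
  apply: le_trans (_ : B0 * (lam * d) * hx * (w * lam) <= _); last first.
    by rewrite le_eqVlt; apply/orP; left; apply/eqP; ring.
  apply: ler_pM => //; first exact: sqr_ge0.
    by apply: le_trans gl _; rewrite ler_wpM2r // ler_wpM2l.
  by rewrite expr2 ler_wpM2l // ltW.
have n2 : `|g (br s y) * ((dbr s x - dbr s y) * (dbr s x + dbr s y))| <=
   A0 * (E * hx) * (D * d * 2).
  rewrite normrM; apply: ler_pM => //.
    by apply: le_trans gb _; rewrite ler_wpM2l.
  rewrite normrM; apply: ler_pM => //; apply: le_trans (ler_normD _ _) _; lra.
have n3 : `|hx * (ddbr s x - ddbr s y)| <= hx * (D * d).
  by rewrite normrM (ger0_norm hb) ler_wpM2l.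
have n4 : `|(hx - hy) * ddbr s y| <= A0 * E * d * hx * D.
  rewrite normrM; apply: ler_pM => //; apply: le_trans hl _.
  by rewrite ler_wpM2r // ler_wpM2l // mulr_ge0 // ltW.
have tot : B0 * d * (hx * w) = B0 * lam ^+ 2 * d * (hx * w) +
    (3 * A0 * E * D + D) / kap * d * (hx * w).
  rewrite /smooth_exponent -/E; field.
  by rewrite gt_eqF // subr_eq0 gt_eqF.
rewrite tot; have : (3 * A0 * E * D + D) * d * hx <= (3 * A0 * E * D + D) / kap * d * (hx * w).
  have -> : (3 * A0 * E * D + D) / kap * d * (hx * w) =
      (3 * A0 * E * D + D) * d * (hx * w / kap) by ring.
  by apply: ler_wpM2l; [exact: mulr_ge0|rewrite ler_pdivlMr // mulrC].
move=> last; apply: le_trans (ler_normD _ _) _.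
apply: le_trans (lerD (ler_normD _ _) n4) _.
apply: le_trans (lerD (lerD (ler_normD _ _) n3) (lexx _)) _; lra.
Unshelve. all: by end_near. Qed.

Lemma uniform_cone r : 0 <= r -> cone A0 (fun x => (fun=> 0) x + r * uniform_density x).
Proof.
move=> r0; have -> : r = 2 * (r / 2) by field.
apply: lipschitz_cone => // *; rewrite ?subrr normr0 ?mulr_ge0 //; lra.
Qed.

(** * The limit of the iterates of the uniform density *)

Let r0 : R := (hi - lo)^-1.
(** The zero summand makes the start an instance of [uniform_cone] and [primitive_lin] as they are
    stated. *)
Let h0 x : R := (fun=> 0) x + r0 * uniform_density x.
Let G0 x : R := (fun=> 0) x + r0 * uniform_primitive x.
Let hseq n : R -> R := iter n transfer h0.
Fixpoint derivative_seq n : R -> R :=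
  if n is n'.+1 then transfer_derivative (hseq n') (derivative_seq n') else fun=> 0.
Let gseq := derivative_seq.

Let r0_ge0 : 0 <= r0. Proof. by rewrite invr_ge0 subr_ge0 ltW. Qed.

Let hseq_cone n : cone A0 (hseq n).
Proof. exact/iter_transfer_cone/uniform_cone. Qed.

Let Gseq_primitive n : primitive (iter n primitive_transfer G0) (hseq n) 1.
Proof.
have sh : supported h0 by have [] := uniform_cone r0_ge0.
apply: (iter_transfer_primitive n sh _).2.
have := primitive_lin r0 primitive0 uniform_primitiveP.
by rewrite add0r mulVf // subr_eq0 gt_eqF.
Qed.

Let gseq_smooth n : smooth (hseq n) (gseq n).
Proof.
elim: n => [|n IH]; last exact: transfer_smooth.
split => //.
- move=> x rx; have [d d0 Hd] := regular_ball rx.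
  apply: (@near_eq_is_derive _ _ _ (cst (h0 x))).
  near=> y; rewrite /= /h0 /uniform_density (@cell_range x y) //.
  by apply: Hd; rewrite distrC; near: y; exact: (nbhsx_ballx x d d0).
- move=> x rx; rewrite normr0 mulr_ge0 //; first by have := cone_exponent_ge1; lra.
  by have [_ + _] := hseq_cone 0; apply.
move=> x y H; rewrite subrr normr0 mulr_ge0 //; last first.
  by have [_ + _] := hseq_cone 0; apply; exact: cellL H.
by rewrite mulr_ge0 // smooth_exponent_ge0.
Unshelve. all: by end_near. Qed.

(** Only the primitives are assumed to converge. Uniform Lipschitz bounds for the densities and for
    their derivatives allow [derivative_interpolation] to be used twice: convergence descends to the
    densities, then to their derivatives, and all bounds pass to the limit. *)
Lemma invariant_regularity (G : R -> R) :
  (forall x, iter n primitive_transfer G0 x @[n --> \oo] --> G x) ->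
  exists h g C, [/\ supported h /\ supported g,
    forall x, regular_point x -> is_derive x 1 G (h x) /\ is_derive x 1 h (g x),
    forall x, regular_point x -> `|h x| <= C /\ `|g x| <= C,
    forall x y, cell x y ->
      `|h x - h y| <= C * `|x - y| /\ `|g x - g y| <= C * `|x - y| &
    forall x, regular_point x -> h x = transfer h x].
Proof.
move=> GG; have [Cd Cd0 HCd] := density_bound; have A1 := cone_exponent_ge1.
have B00 := smooth_exponent_ge0; have E1 : 1 <= expR (A0 * (hi - lo)).
  by rewrite -[X in X <= _]expR0 ler_expR mulr_ge0 ?subr_ge0 ?(ltW lohi) //; lra.
set E := expR _ in E1; have A00 : 0 <= A0 by lra.
have AE1 : 1 <= A0 * E by rewrite -[X in X <= _]mulr1; apply: ler_pM.
have hb n x : regular_point x -> 0 <= hseq n x <= Cd.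
  move=> rx; have := HCd _ _ _ (hseq_cone n) (Gseq_primitive n) x rx.
  by rewrite mulr1 => ->; have [_ + _] := hseq_cone n => ->.
have AE0 : 0 <= A0 * E by lra.
pose C := (A0 * E + B0) * Cd.
have ACd : 0 <= A0 * E * Cd by rewrite mulr_ge0 //; lra.
have BCd : 0 <= B0 * Cd by exact: mulr_ge0.
have CdC : Cd <= C by rewrite /C mulrDl; have := ler_wpM2r Cd0 AE1; lra.
have hC n x : regular_point x -> `|hseq n x| <= C.
  by move=> /(hb n)/andP[? ?]; rewrite ger0_norm //; lra.
have gC n x : regular_point x -> `|gseq n x| <= C.
  move=> rx; have [_ _ /(_ x rx) + _] := gseq_smooth n.
  move=> /le_trans; apply; have /andP[? ?] := hb n x rx.
  apply: le_trans (_ : A0 * Cd <= _); first by rewrite ler_wpM2l.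
  rewrite /C mulrDl; have := ler_wpM2r Cd0 (ler_wpM2l A00 E1); lra.
have hL n x y : cell x y -> `|hseq n x - hseq n y| <= C * `|x - y|.
  move=> H; have [r|nr] := boolP (lo <= x <= hi); last first.
    have [sh _ _] := hseq_cone n; rewrite !sh // -?(cell_range H) //.
    by rewrite subrr normr0 mulr_ge0 //; lra.
  have [+ _] := cone_lip (hseq_cone n) H r; move=> /le_trans; apply.
  have /andP[? ?] := hb n x (cellL H); rewrite mulrAC ler_wpM2r //.
  apply: le_trans (_ : A0 * E * Cd <= _); first exact: ler_wpM2l.
  by rewrite /C mulrDl lerDl.
have gL n x y : cell x y -> `|gseq n x - gseq n y| <= C * `|x - y|.
  move=> H; have [_ _ _ /(_ _ _ H) + ] := gseq_smooth n; move=> /le_trans; apply.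
  have /andP[? ?] := hb n x (cellL H); rewrite mulrAC ler_wpM2r //.
  apply: le_trans (_ : B0 * Cd <= _); first exact: ler_wpM2l.
  by rewrite /C mulrDl lerDr.
have between x y d z : (forall z, `|z - y| < d -> cell y z) -> `|x - y| < d ->
    Num.min x y <= z <= Num.max x y -> cell y z.
  move=> Hd xd zr; apply: Hd; apply: le_lt_trans xd; move: zr.
  case: (leP x y) => xy /andP[z1 z2].
    by rewrite !ler0_norm ?subr_le0 // !opprB lerD2l lerN2.
  by rewrite !ger0_norm ?subr_ge0 ?(ltW xy) // lerD2r.
have ry x y : (forall z, `|z - y| < x -> cell y z) -> forall z, `|z - y| < x ->
  regular_point z by move=> H z /H /cellR.
have lim1 y : regular_point y ->
    exists2 l, hseq n y @[n --> \oo] --> l & is_derive y 1 G l.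
  move=> rg; have [d d0 Hd] := regular_ball rg.
  apply: (@derivative_interpolation _ (fun n => iter n primitive_transfer G0) hseq G y d C) => //.
  move=> n x xd; apply: first_order_remainder => z /(between _ _ _ _ Hd xd) yz.
  have [_ dG _ _] := Gseq_primitive n; split; first exact/dG/(cellR yz).
  by rewrite distrC [`|z - y|]distrC; exact: hL.
pose h y := lim (hseq n y @[n --> \oo]).
have limh y : regular_point y -> hseq n y @[n --> \oo] --> h y.
  by move=> /lim1[l hl _]; rewrite /h (cvg_lim _ hl).
have lim2 y : regular_point y ->
    exists2 l, gseq n y @[n --> \oo] --> l & is_derive y 1 h l.
  move=> rg; have [d d0 Hd] := regular_ball rg.
  apply: (@derivative_interpolation _ hseq gseq h y d C) => //; last first.
    by move=> x /(ry _ _ Hd) /limh.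
  move=> n x xd; apply: first_order_remainder => z /(between _ _ _ _ Hd xd) yz.
  have [_ dG _ _] := gseq_smooth n; split; first exact/dG/(cellR yz).
  by rewrite distrC [`|z - y|]distrC; exact: gL.
pose g y := lim (gseq n y @[n --> \oo]).
have limg y : regular_point y -> gseq n y @[n --> \oo] --> g y.
  by move=> /lim2[l hl _]; rewrite /g (cvg_lim _ hl).
exists h, g, C; split.
- split=> x nx.
    rewrite /h (_ : (fun n => hseq n x) = cst 0) ?lim_cst //.
    by apply/funext => n; have [-> //] := hseq_cone n.
  rewrite /g (_ : (fun n => gseq n x) = cst 0) ?lim_cst //.
  by apply/funext => n; have [-> //] := gseq_smooth n.
- move=> x rx; have [l hl dl] := lim1 x rx; have [k hk dk] := lim2 x rx.
  by rewrite /h /g (cvg_lim _ hl) // (cvg_lim _ hk).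
- move=> x rx; split.
    by apply: (cvgr_to_le (cvg_norm (limh x rx))); near=> n; exact: hC.
  by apply: (cvgr_to_le (cvg_norm (limg x rx))); near=> n; exact: gC.
- move=> x y H; have rx := cellL H; have ryy := cellR H; split.
    apply: (cvgr_to_le (cvg_norm (cvgB (limh x rx) (limh y ryy)))).
    by near=> n; exact: hL.
  apply: (cvgr_to_le (cvg_norm (cvgB (limg x rx) (limg y ryy)))).
  by near=> n; exact: gL.
- move=> x rx; have c1 := limh x rx.
  have c2 : hseq n.+1 x @[n --> \oo] --> transfer h x.
    rewrite /hseq /=; rewrite /transfer; case: ifP => xh; last exact: cvg_cst.
    by apply: cvgD; (apply: cvgM; [exact/limh/regular_br|exact: cvg_cst]).
  have c3 : hseq n.+1 x @[n --> \oo] --> h x.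
    by have := c1; rewrite -(cvg_shiftS (fun n => hseq n x)).
  by rewrite -(cvg_lim _ c3) // (cvg_lim _ c2).
Unshelve. all: by end_near. Qed.

(* Tail primitives of positive measures of mass at most [e], without any regularity. *)
Definition small_distribution (e : R) (K : R -> R) :=
  [/\ forall x y, x <= y -> K x <= K y, forall x, hi <= x -> K x = 0 &
      forall x, - e <= K x].

(** The left branch increases, the right one decreases and lies further right, so monotonicity and
    the sign persist; the lower bound persists because the subtracted value is nonpositive. The
    error does not grow under iteration. *)
Lemma iter_small_distribution n e K : small_distribution e K ->
  forall x, `|iter n primitive_transfer K x| <= e.
Proof.
move=> dK x; suff [m z b] : small_distribution e (iter n primitive_transfer K).
  have e0 : 0 <= e by have := b hi; rewrite z //; lra.
  have [hx|/ltW xh] := leP hi x; first by rewrite z // normr0.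
  have := m _ _ xh; rewrite (z hi) // => ?; have ? := b x.
  by rewrite ler_norml; apply/andP; split; lra.
elim: n {x} => // n [m z b]; rewrite iterS; set K' := iter n _ _ in m z b *.
have neg x : K' x <= 0.
  have [hx|/ltW xh] := leP hi x; first by rewrite z.
  by rewrite -(z hi) // m.
have brm x : x < hi -> br true x <= br false x.
  move=> /ltW xh; have := mk_side M true xh; have := mk_side M false xh.
  by rewrite /side; lra.
split=> [x y|x hx|x]; rewrite /primitive_transfer.
- rewrite le_eqVlt => /predU1P[->//|xy]; have [yh|hy] := ltP y hi.
    rewrite (lt_trans xy yh); apply: lerB; apply: m; apply: ltW.
      exact: (br_lt true xy (ltW yh)).
    exact: (br_lt false xy (ltW yh)).
  by case: ifP => // xh; rewrite subr_le0; exact/m/brm.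
- by rewrite ltNge hx.
- case: ifP => xh; last by have := b x; have := neg x; lra.
  by have := b (br true x); have := neg (br false x); lra.
Qed.

(** An invariant [F] equals its own iterates. Up to a small distribution it is a primitive with
    Lipschitz density, and that one, minus its mass times the normalised uniform primitive,
    decays. *)
Lemma invariant_unique (F : R -> R) : (forall x, F x = primitive_transfer F x) ->
  (forall x, x <= lo -> F x = - 1) ->
  (forall e, 0 < e -> exists P k m B, [/\ 0 <= B, supported k, primitive P k m,
      (forall x, regular_point x -> `|k x| <= B) /\
      (forall x y, cell x y -> `|k x - k y| <= B * `|x - y|) &
      exists K1 K2, [/\ small_distribution e K1, small_distribution e K2 &
        forall x, F x = P x + (K1 x - K2 x)]]) ->
  forall x, iter n primitive_transfer G0 x @[n --> \oo] --> F x.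
Proof.
move=> Finv Flo approx x; have [q /andP[q0 q1] Hq] := decay.
have Fn n : iter n primitive_transfer F = F.
  by elim: n => //= n ->; apply/funext => z; rewrite -Finv.
apply/cvgrPdist_lt => e e0.
(* The total error is below [5 * e / 8]: two small distributions and the decayed term give [e / 8]
   each, and the mass defect [|m - 1|] gives [e / 4]. *)
have e4 : 0 < e / 8 by lra.
have [P [k [m [B [B0 sk Pk [kB kL] [K1 [K2 [D1 D2 HF]]]]]]]] := approx _ e4.
have r0' := r0_ge0.
have PG : primitive G0 h0 1 by exact: (Gseq_primitive 0).
have Pd := primitive_lin (- m) Pk PG; rewrite mulr1 subrr in Pd.
have Bs : 0 <= B + `|m| * r0 by rewrite addr_ge0 // mulr_ge0.
have Ss : supported (fun x => k x + - m * h0 x).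
  move=> y ny; rewrite /h0 /uniform_density (negbTE ny) sk //; ring.
have Sb y : regular_point y -> `|k y + - m * h0 y| <= B + `|m| * r0.
  move=> ry; rewrite mulNr; apply: le_trans (ler_normB _ _) _; apply: lerD; first exact: kB.
  rewrite normrM ler_wpM2l // /h0 /uniform_density add0r; case: ifP => _.
    by rewrite mulr1 ger0_norm.
  by rewrite mulr0 normr0.
have Sl y z : cell y z -> `|(k y + - m * h0 y) - (k z + - m * h0 z)| <=
    (B + `|m| * r0) * `|y - z|.
  move=> yz; rewrite /h0 /uniform_density (cell_range yz).
  rewrite opprD addrACA subrr addr0; apply: le_trans (kL _ _ yz) _.
  by rewrite ler_wpM2r // lerDl mulr_ge0.
have [C C0 HC] := Hq _ _ _ Bs Ss Pd Sb Sl.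
have cq : C * q ^+ n @[n --> \oo] --> (0 : R).
  rewrite -[X in _ --> X](mulr0 C); apply: cvgM; first exact: cvg_cst.
  by apply: cvg_expr; rewrite ger0_norm // ltW.
move/cvgrPdist_lt : cq => /(_ _ e4) cq; near=> n.
have /= cn : `|0 - C * q ^+ n| < e / 8 by near: n.
rewrite sub0r normrN ger0_norm ?mulr_ge0 ?exprn_ge0 ?(ltW q0) // in cn.
have := HC n x; rewrite iter_primitive_transfer_lin.
have -> : F x = iter n primitive_transfer P x +
    (iter n primitive_transfer K1 x - iter n primitive_transfer K2 x).
  rewrite -[in LHS](Fn n) (_ : F = fun x => P x + 1 * (K1 x + (- 1) * K2 x)); last first.
    by apply/funext => z; rewrite HF; ring.
  by rewrite !iter_primitive_transfer_lin; ring.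
have := iter_small_distribution n D1 x; have := iter_small_distribution n D2 x.
have /andP[g1 g2] := primitive_bounds x (hseq_cone n) (Gseq_primitive n).
have m1 : `|m - 1| <= e / 4.
  have [_ z1 b1] := D1; have [_ z2 b2] := D2; have [d1 d2 _] := D1.
  have := HF lo; rewrite Flo //; have [_ _ _ ->] := Pk => //.
  have := b1 lo; have := b2 lo; have [n1 _ _] := D1; have [n2 _ _] := D2.
  have := n1 _ _ (ltW lohi); have := n2 _ _ (ltW lohi); rewrite (z1 hi) // (z2 hi) //.
  by move=> *; rewrite ler_norml; apply/andP; split; lra.
set a := iter n _ P x; set g := iter n _ G0 x in g1 g2 *.
rewrite !ler_norml !ltr_norml => /andP[? ?] /andP[? ?] /andP[? ?].
move: m1; rewrite ler_norml => /andP[? ?].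
by apply/andP; split; nra.
Unshelve. all: by end_near. Qed.

(** * Unit steps on the critical orbit *)

Definition step (p x : R) : R := if x <= p then - 1 else 0.

(** The branch on the side of [orb k] moves the step to [orb k.+1]. The other branch is constant: 0
    if it lies to the right, and [- 1] if it lies to the left, where it restores the normalisation.
    For [orb k = c] both branches stop at the step, which gives the step at [hi]. *)
Lemma primitive_transfer_step k x : regular_point x ->
  primitive_transfer (step (orb k)) x = step (orb k.+1) x.
Proof.
move=> rx; rewrite /primitive_transfer /step.
have le y j : regular_point y -> (y <= orb j) = (y < orb j).
  by move=> ry; rewrite le_eqVlt (negbTE (ry j)).
case: ifP => xh.
  rewrite !le // ?br_ltP //; try exact: regular_br.
  rewrite /side; case: (ltgtP (orb k) c) => kc.
  - have -> : (0 <= 1 * (c - orb k)) by lra.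
    have -> : (0 <= -1 * (c - orb k)) = false by apply/negbTE; rewrite -ltNge; lra.
    by rewrite subr0.
  - have -> : (0 <= -1 * (c - orb k)) by lra.
    have -> : (0 <= 1 * (c - orb k)) = false by apply/negbTE; rewrite -ltNge; lra.
    have := rx k.+1; rewrite neq_lt => /orP[] h; rewrite h (lt_gtF h) ?subr0 //.
    by rewrite opprK addNr.
  - have e : orb k.+1 = hi by rewrite /= kc.
    by rewrite kc subrr !mulr0 !lexx e xh (lt_gtF xh) subr0.
have : hi < x by rewrite lt_neqAle eq_sym (rx 1%N) leNgt xh.
by move=> hx; rewrite ifF //; apply/negbTE; rewrite -ltNge (le_lt_trans _ hx) //;
  have /andP[] := mk_range M k.+1.
Qed.

Lemma iter_primitive_transfer_eq n F H : (forall x, regular_point x -> F x = H x) ->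
  forall x, regular_point x ->
  iter n primitive_transfer F x = iter n primitive_transfer H x.
Proof.
move=> FH; elim: n => // n IH x rx; rewrite !iterS /primitive_transfer.
by case: ifP => // xh; rewrite !IH //; exact: regular_br.
Qed.

Lemma iter_primitive_transfer_step n k x : regular_point x ->
  iter n primitive_transfer (step (orb k)) x = step (orb (n + k)) x.
Proof.
elim: n x => // n IH x rx; rewrite iterS addSn -primitive_transfer_step //.
rewrite /primitive_transfer; case: ifP => // xh.
by rewrite !IH //; exact: regular_br.
Qed.

Lemma near_regular p : \forall x \near p^', regular_point x.
Proof.
have [K HK] := mk_finite M.
suff near1 (j : 'I_K) : \forall x \near p^', x != orb j.
  apply: (@filterS _ _ _ (fun x => forall j : 'I_K, x != orb j)); last exact: filter_forall near1.
  by move=> x Hx k; have [j jK ->] := HK k; exact: (Hx (Ordinal jK)).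
have [->|/eqP pj] := eqVneq p (orb j); first exact: nbhs_dnbhs_neq.
apply: nbhs_dnbhs; have /eqP := pj; rewrite neq_lt => /orP[pj'|pj'].
  by near=> x; rewrite lt_eqF //; near: x; exact: lt_nbhsl.
by near=> x; rewrite gt_eqF //; near: x; exact: lt_nbhsr.
Unshelve. all: by end_near. Qed.

Lemma step_left p x : step p z @[z --> x^'-] --> step p x.
Proof.
apply: cvg_near_cst; rewrite /step.
have [xp|px] := leP x p.
  near=> z; have zx : z < x by near: z; exact: nbhs_left_lt.
  by rewrite (le_trans (ltW zx)).
near=> z; have zx : p < z by near: z; exact: nbhs_left_gt.
by rewrite leNgt zx.
Unshelve. all: by end_near. Qed.

Lemma step_right p x : step p z @[z --> x^'+] --> step p x + (x == p)%:R.
Proof.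
apply: cvg_near_cst; rewrite /step.
have [xp|px|->] := ltgtP x p.
- near=> z; have zx : z < p by near: z; exact: nbhs_right_lt.
  by rewrite ltW //= addr0.
- near=> z; have zx : x < z by near: z; exact: nbhs_right_gt.
  by rewrite leNgt (lt_trans px) //= addr0.
- near=> z; have zx : p < z by near: z; exact: nbhs_right_gt.
  by rewrite leNgt zx /= addNr.
Unshelve. all: by end_near. Qed.

(* Subtracting a step at each jump and a multiple of the invariant primitive leaves
   a continuous primitive of mass zero, to which [decay] applies. *)
Lemma jump_decomposition N (y y' yl : R -> R) (j : nat -> R) (F h : R -> R) :
  (forall i k, (i < N)%N -> (k < N)%N -> orb i = orb k -> i = k) ->
  (forall k, exists2 i, (i < N)%N & orb k = orb i) ->
  supported y -> (forall x, regular_point x -> is_derive x 1 y (y' x)) ->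
  (forall k, (k < N)%N -> y x @[x --> (orb k)^'-] --> yl (orb k) /\
                        y x @[x --> (orb k)^'+] --> yl (orb k) + j k) ->
  primitive F h 1 -> let J := \sum_(k < N) j k in
  exists2 K, primitive K (fun x => y' x + J * h x) 0 &
    forall x, regular_point x ->
      y x = K x - J * F x + \sum_(k < N) j k * step (orb k) x.
Proof.
move=> inj sur sy dy lim PF J; have [cF dF F0 Flo] := PF.
pose S x := \sum_(k < N) j k * step (orb k) x.
(* On the orbit the left limits [yl] are filled in, because [step] is continuous from the left. *)
pose K x := (if `[< regular_point x >] then y x else yl x) - S x + J * F x.
have Kreg x : regular_point x -> K x = y x - S x + J * F x.
  by move=> rx; rewrite /K ifT //; exact/asboolP.
have Scell x z : cell x z -> S z = S x.
  move=> xz; apply: eq_bigr => k _; have [n1 n2 e] := xz k.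
  by rewrite /step !(le_eqVlt _ (orb k)) (negbTE n1) (negbTE n2) e.
have dK x : regular_point x -> is_derive x 1 K (y' x + J * h x).
  move=> rx; have [d d0 Hd] := regular_ball rx.
  have D1 : is_derive x 1 (fun z => y z - S x + J *: F z) (y' x - 0 + J *: h x).
    apply: is_deriveD; last by apply: is_deriveZ; exact: dF.
    by apply: is_deriveB; exact: dy.
  rewrite subr0 in D1; apply: near_eq_is_derive D1; near=> z.
  have xz : cell x z by apply: Hd; rewrite distrC; near: z; exact: (nbhsx_ballx x d d0).
  by rewrite Kreg ?(Scell _ _ xz) //; exact: cellR xz.
have Sleft x : S z @[z --> x^'-] --> S x.
  by apply: (@cvg_sum_ord R R x^'- _ N (fun k z => j k * step (orb k) z)
    (fun k => j k * step (orb k) x)) => k _; apply: cvgM; [exact: cvg_cst|exact: step_left].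
have Sright (i : 'I_N) : S z @[z --> (orb i)^'+] --> S (orb i) + j i.
  have -> : S (orb i) + j i = \sum_(k < N) j k * (step (orb k) (orb i) + (orb i == orb k)%:R).
    under [RHS]eq_bigr do rewrite mulrDr.
    rewrite big_split /= -/(S _); congr (_ + _).
    rewrite (bigD1 i) //= eqxx mulr1 big1 ?addr0 // => k ki.
    case: eqP => [e|_]; last by rewrite mulr0.
    by move: ki; rewrite (ord_inj (inj _ _ _ _ e)) ?eqxx.
  apply: (@cvg_sum_ord R R (orb i)^'+ _ N (fun k z => j k * step (orb k) z)
    (fun k => j k * (step (orb k) (orb i) + (orb i == orb k)%:R))) => k _.
  by apply: cvgM; [exact: cvg_cst|exact: step_right].
have cK : continuous K.
  move=> x; have [rx|nrx] := pselect (regular_point x).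
    exact: is_derive_continuous (dK x rx).
  have [i ei] : exists i : 'I_N, x = orb i.
    have [k] : exists k, x = orb k.
      by apply: contrapT => no; apply: nrx => k; apply/eqP => e; apply: no; exists k.
    by have [i iN ->] := sur k => ->; exists (Ordinal iN).
  have Kx : K x = yl x - S x + J * F x by rewrite /K ifF //; apply/asboolP.
  have [l1 l2] := lim i (ltn_ord i); rewrite -ei in l1 l2.
  have nr := near_regular x.
  apply/continuous_withinNx; rewrite Kx; apply: (@cvg_at_right_left_dnbhs _ R^o).
    apply: (@cvg_trans _ ((y z - S z + J * F z) @[z --> x^'+])).
      by apply: near_eq_cvg; have := near_right_dnbhs nr; apply: filterS => z /Kreg.
    have -> : yl x - S x + J * F x = yl x + j i - (S x + j i) + J * F x by ring.
    apply: cvgD; first by apply: cvgB => //; rewrite ei; exact: Sright.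
    by apply: cvgM; [exact: cvg_cst|apply: cvg_at_right_filter; exact: cF].
  apply: (@cvg_trans _ ((y z - S z + J * F z) @[z --> x^'-])).
    by apply: near_eq_cvg; have := near_left_dnbhs nr; apply: filterS => z /Kreg.
  apply: cvgD; first by apply: cvgB.
  by apply: cvgM; [exact: cvg_cst|apply: cvg_at_left_filter; exact: cF].
have out x : ~~ (lo <= x <= hi) -> regular_point x.
  by move=> nx k; apply: contra nx => /eqP ->; exact: (mk_range M).
(* Right of the support every term vanishes. Left of it the steps add up to [- J] and [J * F] is
   also [- J], so they cancel; this determines the coefficient of [F]. *)
have Kout x : ~~ (lo <= x <= hi) -> K x = 0.
  move=> nx; rewrite Kreg; last exact: out.
  rewrite sy //; move: nx; rewrite negb_and -!ltNge => /orP[xl|xh]; last first.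
    rewrite F0 ?(ltW xh) // /S big1 ?mulr0; first by ring.
    move=> k _; rewrite /step ifF ?mulr0 //; apply/negbTE; rewrite -ltNge.
    by apply: le_lt_trans xh; have /andP[] := mk_range M k.
  rewrite Flo ?(ltW xl) // /S (eq_bigr (fun k : 'I_N => - j k)) ?sumrN /J; first by ring.
  move=> k _; rewrite /step ifT ?mulrN1 //; apply: ltW; apply: lt_le_trans xl _.
  by have /andP[] := mk_range M k.
exists K; last by move=> x rx; rewrite Kreg // /S; ring.
split => //.
(* The value at the endpoint itself follows from continuity of [K]. *)
- move=> x; rewrite le_eqVlt => /predU1P[<-|hx]; last first.
    by apply: Kout; rewrite negb_and -!ltNge hx orbT.
  have l1 : K z @[z --> hi^'+] --> K hi by apply: cvg_at_right_filter; exact: cK.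
  rewrite -(cvg_lim _ l1) //; apply: cvg_lim => //; apply: cvg_near_cst.
  near=> z; apply: Kout; rewrite negb_and -!ltNge; apply/orP; right.
  by near: z; exact: nbhs_right_gt.
- move=> x; rewrite oppr0 le_eqVlt => /predU1P[->|hx]; last first.
    by apply: Kout; rewrite negb_and -!ltNge hx.
  have l1 : K z @[z --> lo^'-] --> K lo by apply: cvg_at_left_filter; exact: cK.
  rewrite -(cvg_lim _ l1) //; apply: cvg_lim => //; apply: cvg_near_cst.
  near=> z; apply: Kout; rewrite negb_and -!ltNge; apply/orP; left.
  by near: z; exact: nbhs_left_lt.
Unshelve. all: by end_near. Qed.

Lemma iter_primitive_transfer_steps N (j : nat -> R) n x : regular_point x ->
  iter n primitive_transfer (fun x => \sum_(k < N) j k * step (orb k) x) x =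
  \sum_(k < N) j k * step (orb (n + k)) x.
Proof.
move=> rx; elim: N => [|N IH].
  rewrite big_ord0 (_ : (fun x => _) = fun=> 0) ?iter_primitive_transfer0 //.
  by apply/funext => z; rewrite big_ord0.
rewrite big_ord_recr /= -IH -iter_primitive_transfer_step //.
rewrite (_ : (fun x0 => \sum_(k < N.+1) j k * step (orb k) x0) =
  fun x0 => \sum_(k < N) j k * step (orb k) x0 + j N * step (orb N) x0).
  by rewrite iter_primitive_transfer_lin.
by apply/funext => z; rewrite big_ord_recr.
Qed.

(** In the decomposition [K] decays, [F] is fixed and the steps travel along the orbit. [v] only has
    to agree with the smooth representative [y] off the orbit, since branches send regular points to
    regular points. *)
Lemma expansion : exists2 q, 0 < q < 1 &
  forall N (v y y' yl : R -> R) (j : nat -> R) (F h : R -> R) B,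
  (forall i k, (i < N)%N -> (k < N)%N -> orb i = orb k -> i = k) ->
  (forall k, exists2 i, (i < N)%N & orb k = orb i) ->
  0 <= B -> supported y -> supported y' ->
  (forall x, regular_point x -> is_derive x 1 y (y' x)) ->
  (forall x, regular_point x -> `|y' x| <= B) ->
  (forall x z, cell x z -> `|y' x - y' z| <= B * `|x - z|) ->
  (forall k, (k < N)%N -> y x @[x --> (orb k)^'-] --> yl (orb k) /\
                        y x @[x --> (orb k)^'+] --> yl (orb k) + j k) ->
  primitive F h 1 -> supported h ->
  (forall x, regular_point x -> `|h x| <= B) ->
  (forall x z, cell x z -> `|h x - h z| <= B * `|x - z|) ->
  (forall x, F x = primitive_transfer F x) ->
  (forall x, regular_point x -> v x = y x) ->
  let J := \sum_(k < N) j k in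
  exists2 C, 0 <= C & forall n, exists K, [/\ continuous K,
    forall x, `|K x| <= C * q ^+ n &
    forall x, regular_point x -> iter n primitive_transfer v x =
      K x - J * F x + \sum_(k < N) j k * step (orb (n + k)) x].
Proof.
have [q q01 Hq] := decay; exists q => // N v y y' yl j F h B inj sur B0 sy sy' dy y'B y'L.
move=> lim PF sh hB hL Finv vy J.
have [K PK Ky] := jump_decomposition inj sur sy dy lim PF.
have sk : supported (fun x => y' x + J * h x).
  by move=> x nx; rewrite sy' // sh // mulr0 addr0.
have b1 x : regular_point x -> `|y' x + J * h x| <= B + `|J| * B.
  move=> rx; apply: le_trans (ler_normD _ _) _; rewrite normrM.
  by apply: lerD; [exact: y'B|rewrite ler_wpM2l // hB].
have b2 x z : cell x z -> `|y' x + J * h x - (y' z + J * h z)| <= (B + `|J| * B) * `|x - z|.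
  move=> xz; rewrite opprD addrACA -mulrBr mulrDl.
  apply: le_trans (ler_normD _ _) _; rewrite normrM -mulrA.
  by apply: lerD; [exact: y'L|rewrite ler_wpM2l // hL].
have B1 : 0 <= B + `|J| * B by rewrite addr_ge0 // mulr_ge0.
have [C C0 HC] := Hq _ _ _ B1 sk PK b1 b2.
exists C => // n; exists (iter n primitive_transfer K).
have [_ [cK _ _ _]] := iter_transfer_primitive n sk PK.
split => // x rx.
rewrite (iter_primitive_transfer_eq n (_ : forall x, regular_point x -> v x =
   (K x + (- J) * F x) + 1 * \sum_(k < N) j k * step (orb k) x)) //; last first.
  by move=> z rz; rewrite vy // Ky // mul1r mulNr.
rewrite !iter_primitive_transfer_lin mul1r mulNr.
have -> : iter n primitive_transfer F = F.
  by elim: (n) => //= m ->; apply/funext => z; rewrite -Finv.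
by rewrite iter_primitive_transfer_steps.
Qed.

(** As [c] is not periodic, neither preimage of [c] is an orbit point, so [h] is continuous at both,
    and [h = transfer h] carries the limits to [c]. *)
Lemma no_jump h : supported h -> (forall k, orb k.+1 != c) ->
  (forall x, regular_point x -> {for x, continuous h}) ->
  (forall x, regular_point x -> h x = transfer h x) ->
  exists l : R, h x @[x --> c^'] --> l.
Proof.
move=> sh np ch hT; have ch' : c < hi by exact: mk_hi M.
have rb s : regular_point (br s c).
  by move=> k; apply/eqP => /(br_orb ch') e; have := np k; rewrite -e eqxx.
have cb s : {for c, continuous (br s)}.
  exact: is_derive_continuous (mk_derive M s (ltW ch')).
have /choice[l hl] s : exists l : R, h (br s x) * weight s x @[x --> c^'] --> l.
  have [r|] := boolP (lo <= br s c <= hi).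
    exists (h (br s c) * weight s c); apply: cvgM.
      apply: continuous_cvg; first exact/ch/rb.
      exact/continuous_withinNx/cb.
    apply: cvgM; first exact: cvg_cst.
    have [D2 _] := mk_derive2 M (ltW ch') r.
    exact/continuous_withinNx/(is_derive_continuous D2).
  (* A branch that leaves the support at [c] stays outside nearby and contributes 0. *)
  rewrite negb_and -!ltNge => out; exists 0; apply: cvg_near_cst.
  have cbs : br s x @[x --> c^'] --> br s c by exact/continuous_withinNx/cb.
  have near_out : \forall x \near c^', ~~ (lo <= br s x <= hi).
    case/orP: out => lt.
      by apply: filterS (cvgr_lt _ cbs _ lt) => x h1; rewrite negb_and -ltNge h1.
    by apply: filterS (cvgr_gt _ cbs _ lt) => x h1; rewrite negb_and -!ltNge h1 orbT.
  by apply: filterS near_out => x nx; rewrite sh ?mul0r.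
exists (l true + l false); apply: cvg_trans (cvgD (hl true) (hl false)).
apply: near_eq_cvg; near=> x; rewrite hT; last by near: x; exact: near_regular.
rewrite /transfer ifT //; near: x; apply: nbhs_dnbhs; exact: lt_nbhsl.
Unshelve. all: by end_near. Qed.
End Markov.

(** * One-sided limits and indefinite integrals *)

Section OneSidedLimits.
Context {R : realType}.
Implicit Types (g : R -> R).

Lemma bounded_variation_bounded g : bounded_variation_line g ->
  exists B, forall x y, `|g x - g y| <= B.
Proof.
move=> [B HB]; exists B => x y; wlog yx : x y / y <= x => [W|].
  by have [|/ltW] := leP y x => ?; [exact: W|rewrite distrC; exact: W].
by rewrite -lee_fin; apply: le_trans (HB _ _ yx); exact: total_variation_ge.
Qed.

Lemma bounded_variation_local g u v : bounded_variation_line g -> u <= v ->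
  bounded_variation u v g.
Proof.
move=> [B HB] uv; apply/bounded_variationP => //.
rewrite ge0_fin_numE ?total_variation_ge0 //.
by apply: le_lt_trans (HB _ _ uv) _; rewrite ltry.
Qed.

Lemma nondecreasing_itv_limits g u v x : u < x -> x < v ->
  {in `[u, v] &, nondecreasing_fun g} ->
  cvg (g y @[y --> x^'+]) /\ cvg (g y @[y --> x^'-]).
Proof.
move=> ux xv nd.
have sub y : u <= y <= v -> y \in `[u, v] by rewrite in_itv.
split.
  apply: nondecreasing_at_right_is_cvgr; near=> z.
    have zv : z < v by near: z; exact: nbhs_right_lt.
    move=> p q; rewrite !in_itv /= => /andP[p1 p2] /andP[q1 q2] pq.
    by apply: nd => //; apply: sub; rewrite ltW ?(lt_trans ux) //= ltW // (lt_trans _ zv).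
  have zv : z < v by near: z; exact: nbhs_right_lt.
  exists (g x) => _ /= [p pz <-]; move: pz; rewrite in_itv /= => /andP[p1 p2].
  apply: nd; [apply: sub|apply: sub|exact: ltW].
    by rewrite !ltW.
  by rewrite ltW ?(lt_trans ux) //= ltW // (lt_trans _ zv).
apply: nondecreasing_at_left_is_cvgr; near=> z.
  have zv : u < z by near: z; exact: nbhs_left_gt.
  move=> p q; rewrite !in_itv /= => /andP[p1 p2] /andP[q1 q2] pq.
  by apply: nd => //; apply: sub; rewrite ltW ?(lt_trans zv) //= ltW // (lt_trans _ xv).
have zv : u < z by near: z; exact: nbhs_left_gt.
exists (g x) => _ /= [p pz <-]; move: pz; rewrite in_itv /= => /andP[p1 p2].
apply: nd; [apply: sub|apply: sub|exact: ltW].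
  by rewrite ltW ?(lt_trans zv) //= ltW // (lt_trans _ xv).
by rewrite !ltW.
Unshelve. all: by end_near. Qed.

(** By the Jordan decomposition into two monotone functions on a neighbourhood of [x]. *)
Lemma bounded_variation_limits g x : bounded_variation_line g ->
  cvg (g y @[y --> x^'+]) /\ cvg (g y @[y --> x^'-]).
Proof.
move=> bv; have u1 : x - 1 < x by rewrite ltrBlDr ltrDl.
have v1 : x < x + 1 by rewrite ltrDl.
have BV := bounded_variation_local bv (ltW (lt_trans u1 v1)).
have BVN := bounded_variationN BV.
have [p1 p2] := nondecreasing_itv_limits u1 v1 (fine_neg_tv_nondecreasing BVN).
have [n1 n2] := nondecreasing_itv_limits u1 v1 (fine_neg_tv_nondecreasing BV).
have E := bounded_variation_pos_neg_tvE BV.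
have near_E : \forall y \near x, g y = (fine \o neg_tv (x - 1) (\- g)) y - (fine \o neg_tv (x - 1) g) y.
  near=> y; rewrite E // in_itv /=; apply/andP; split; apply: ltW.
    by near: y; exact: lt_nbhsr.
  by near: y; exact: lt_nbhsl.
move/cvg_ex: p1 => [l1 p1]; move/cvg_ex: p2 => [l2 p2].
move/cvg_ex: n1 => [k1 n1]; move/cvg_ex: n2 => [k2 n2].
have nE := nbhs_dnbhs near_E.
split; apply/cvg_ex.
  exists (l1 - k1); apply: cvg_trans (cvgB p1 n1); apply: near_eq_cvg.
  by apply: filterS (near_right_dnbhs nE) => y ->.
exists (l2 - k2); apply: cvg_trans (cvgB p2 n2); apply: near_eq_cvg.
by apply: filterS (near_left_dnbhs nE) => y ->.
Unshelve. all: by end_near. Qed.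
End OneSidedLimits.

(** * Integrals over left half-lines *)

Section LeftIntegral.
Context {R : realType}.
Notation mu := (@lebesgue_measure R).
Implicit Types (w F f : R -> R) (x y u v B m e : R).

Definition left_integral w x : R := \int[mu]_(t in `]-oo, x]) w t.

Lemma left_integral_diff w x y : mu.-integrable setT (EFin \o w) -> x <= y ->
  left_integral w y - left_integral w x = \int[mu]_(t in `]x, y]) w t.
Proof.
move=> iw xy; rewrite /left_integral Rintegral_itvB ?bnd_simp //.
exact: integrableS iw.
Qed.

Lemma integrable_cst_itv u v m : mu.-integrable `]u, v] (EFin \o cst m).
Proof.
apply: measurable_bounded_integrable => //.
  by rewrite /= lebesgue_measure_itv /=; case: ifPn => _; rewrite -?EFinB ltry.
exact: bounded_cst.
Qed.

Lemma Rintegral_cst_itv u v m : u <= v -> \int[mu]_(t in `]u, v]) m = m * (v - u).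
Proof.
move=> uv; rewrite Rintegral_cst //= lebesgue_measure_itv /= lte_fin.
by move: uv; rewrite le_eqVlt => /predU1P[->|->//]; rewrite ltxx subrr.
Qed.

Lemma left_integral_bounds w x y m B : mu.-integrable setT (EFin \o w) -> x <= y ->
  (forall t, x < t < y -> m <= w t <= B) ->
  m * (y - x) <= left_integral w y - left_integral w x <= B * (y - x).
Proof.
move=> iw xy H; rewrite left_integral_diff // -!Rintegral_cst_itv //.
have iw' : mu.-integrable `]x, y[ (EFin \o w) by exact: integrableS iw.
have ic r : mu.-integrable `]x, y[ (EFin \o cst r).
  apply: integrableS (integrable_cst_itv x y r) => // t /=.
  by rewrite !in_itv /= => /andP[-> /ltW].
rewrite -!Rintegral_itv_bndo_bndc //; try exact: ic.
by apply/andP; split; apply: le_Rintegral => //; try exact: ic;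
  move=> t /=; rewrite in_itv /= => /H/andP[].
Qed.

Lemma left_integral_lipschitz w B x y : mu.-integrable setT (EFin \o w) ->
  (forall t, `|w t| <= B) -> `|left_integral w x - left_integral w y| <= B * `|x - y|.
Proof.
move=> iw wB; wlog yx : x y / y <= x => [W|].
  have [|/ltW] := leP y x => ?; first exact: W.
  by rewrite distrC [X in _ * X]distrC; exact: W.
have := @left_integral_bounds w y x (- B) B iw yx.
rewrite (ger0_norm (_ : 0 <= x - y)) ?subr_ge0 // ler_norml -mulNr; apply=> t _.
by have := wB t; rewrite ler_norml.
Qed.

Lemma lipschitz_continuous F B : (forall x y, `|F x - F y| <= B * `|x - y|) ->
  continuous F.
Proof.
move=> H x; apply/cvgrPdist_lt => e e0; have B0 : 0 <= B by have := H 1 0; rewrite subr0 normr1 mulr1; apply: le_trans.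
have e1 : 0 < e / (B + 1) by rewrite divr_gt0 //; lra.
near=> y; apply: le_lt_trans (H _ _) _.
have : `|x - y| < e / (B + 1).
  by near: y; exact: (nbhsx_ballx x (e / (B + 1)) e1).
rewrite ltr_pdivlMr; last by lra.
by have := normr_ge0 (x - y); nra.
Unshelve. all: by end_near. Qed.

Lemma left_integral_continuous w B : mu.-integrable setT (EFin \o w) ->
  (forall t, `|w t| <= B) -> continuous (left_integral w).
Proof. by move=> iw wB; apply: (@lipschitz_continuous _ B) => x y; exact: left_integral_lipschitz. Qed.

Lemma left_integral_derive w x : mu.-integrable setT (EFin \o w) ->
  {for x, continuous w} -> is_derive x 1 (left_integral w) (w x).
Proof.
move=> iw cw; have [|||D E] := @continuous_FTC1 _ w -oo%O x (x + 1) _ _ _ cw.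
- by rewrite ltrDl.
- exact: integrableS iw.
- exact: ltNyr.
apply: DeriveDef; first exact: D.
rewrite -derive1E; exact: E.
Qed.

Lemma left_integral_right w b x : (forall t, b < t -> w t = 0) -> b <= x ->
  left_integral w x = \int[mu]_t w t.
Proof.
move=> wb bx; rewrite /left_integral Rintegral_mkcond; apply: eq_Rintegral => t _.
rewrite patchE; case: ifPn => // /negP; rewrite inE /= in_itv /= => /negP.
by rewrite -ltNge => xt; rewrite wb // (le_lt_trans bx).
Qed.

Lemma left_integral_left w a x : (forall t, t < a -> w t = 0) -> x < a -> left_integral w x = 0.
Proof.
move=> wa xa; rewrite /left_integral (@eq_Rintegral _ _ _ _ _ (cst 0)).
  by rewrite Rintegral_cst // mul0r.
by move=> t; rewrite inE /= in_itv /= => tx; rewrite wa // (le_lt_trans tx).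
Qed.

Lemma left_integral_left_closed w a B x : mu.-integrable setT (EFin \o w) ->
  (forall t, `|w t| <= B) -> (forall t, t < a -> w t = 0) -> x <= a -> left_integral w x = 0.
Proof.
move=> iw wB wa; rewrite le_eqVlt => /predU1P[->|]; last exact: left_integral_left.
have c : left_integral w z @[z --> a^'-] --> left_integral w a.
  by apply: cvg_at_left_filter; exact: (left_integral_continuous iw wB).
rewrite -(cvg_lim _ c) //; apply: cvg_lim => //; apply: cvg_near_cst.
by near=> z; apply: (left_integral_left wa); near: z; exact: nbhs_left_lt.
Unshelve. all: by end_near. Qed.

Lemma bounded_itv_integrable (g : R -> R) u v B : measurable_fun `[u, v] g ->
  (forall x, u <= x <= v -> `|g x| <= B) -> mu.-integrable `[u, v] (EFin \o g).
Proof.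
move=> mg gB; apply: measurable_bounded_integrable => //.
  by rewrite /= lebesgue_measure_itv /=; case: ifPn => _; rewrite -?EFinB ltry.
exists B; split; first exact: num_real.
by move=> C BC x; rewrite /= in_itv /= => /gB/le_trans; apply; exact: ltW.
Qed.

(** The integrand may jump at the points of [s]. Off [s], [F] and the indefinite integral of the
    restricted integrand have the same derivative, and their difference is continuous, hence
    constant by the mean value bound with exceptions. *)
Lemma FTC2_exceptions (s : seq R) F f u v B : u < v -> continuous F ->
  measurable_fun `[u, v] f -> (forall x, u <= x <= v -> `|f x| <= B) ->
  (forall x, u < x < v -> x \notin s -> is_derive x 1 F (f x) /\ {for x, continuous f}) ->
  \int[mu]_(t in `[u, v]) f t = F v - F u.
Proof.
move=> uv cF mf fB H; pose w := f \_ `[u, v].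
have ifuv := bounded_itv_integrable mf fB.
have iw : mu.-integrable setT (EFin \o w).
  by have := ifuv; rewrite integrable_mkcond //= restrict_EFin.
have wE x : u <= x <= v -> w x = f x.
  by move=> xuv; rewrite /w patchE mem_set // /= in_itv.
have wB t : `|w t| <= B.
  rewrite /w patchE; case: ifPn => [/set_mem|_]; first by rewrite /= in_itv /= => /fB.
  by rewrite normr0; apply: le_trans (normr_ge0 (f u)) (fB u _); rewrite lexx ltW.
have cw := left_integral_continuous iw wB.
have : `|(F v - left_integral w v) - (F u - left_integral w u)| <= 0 * `|v - u|.
  apply: (@mean_value_exceptions_norm _ s (fun x => F x - left_integral w x) (fun=> 0)).
    by move=> x; apply: cvgB; [exact: cF|exact: cw].
  move=> x /orP[xuv xs|/andP[vx xu]]; last first.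
    by have := lt_trans vx (lt_trans xu uv); rewrite ltxx.
  rewrite normr0; split => //; have [dF cf] := H x xuv xs.
  have wx : w x = f x by apply: wE; case/andP: xuv => ? ?; rewrite !ltW.
  have -> : 0 = f x - w x by rewrite wx subrr.
  apply: is_deriveB; apply: left_integral_derive iw _; apply: continuous_near cf.
  case/andP: xuv => ux xv; near=> y; apply: wE; apply/andP; split; apply: ltW.
    by near: y; exact: lt_nbhsr.
  by near: y; exact: lt_nbhsl.
rewrite mul0r normr_le0 subr_eq0 => /eqP E.
have -> : F v - F u = left_integral w v - left_integral w u by lra.
rewrite left_integral_diff ?(ltW uv) // Rintegral_itv_obnd_cbnd; last exact: integrableS iw.
by apply: eq_Rintegral => x; rewrite inE /= in_itv /= => /wE.
Unshelve. all: by end_near. Qed.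

(** Difference quotients of the indefinite integral converge almost everywhere by Lebesgue
    differentiation and are bounded by [B], so dominated convergence applies. *)
Lemma smoothing_L1 w B (lo hi : R) e : mu.-integrable setT (EFin \o w) ->
  (forall x, `|w x| <= B) -> 0 < e ->
  exists2 d, 0 < d & \int[mu]_(x in `[lo, hi]) `|(left_integral w (x + d) - left_integral w x) / d - w x| < e.
Proof.
move=> iw wB e0; have locw : locally_integrable setT w.
  by apply: open_integrable_locally => //; exact: openT.
have mw : measurable_fun setT w by have [] := locw.
have cF := left_integral_continuous iw wB.
pose d n : R := n.+1%:R^-1.
have d0 n : 0 < d n by rewrite invr_gt0 ltr0n.
pose k n x := (left_integral w (x + d n) - left_integral w x) / d n.
have kB n x : `|k n x| <= B.
  rewrite normrM normfV ler_pdivrMr ?normr_gt0 ?gt_eqF //.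
  by apply: le_trans (left_integral_lipschitz _ _ iw wB) _; rewrite addrAC subrr add0r.
have mk n : measurable_fun setT (k n).
  apply: continuous_measurable_fun => x; apply: cvgM; last exact: cvg_cst.
  apply: cvgB; last exact: cF.
  apply: (@continuous_cvg _ _ _ _ _ _ (left_integral w)); first exact: cF.
  by apply: cvgD; [exact: cvg_id|exact: cvg_cst].
have ae : {ae mu, forall x, `[lo, hi]%classic x -> (EFin \o k n) x @[n --> \oo] --> (w x)%:E}.
  have iy y : mu.-integrable `]-oo, y] (EFin \o w) by exact: integrableS iw.
  have := FTC1Ny iy locw.
  apply: filterS; first exact: (ae_filter_ringOfSetsType mu).
  move=> x [D E] _; apply: cvg_EFin; first by near=> n.
  have l0 : h^-1 *: (left_integral w (h *: (1 : R) + x) - left_integral w x) @[h --> 0^'+] --> w x.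
    by apply: cvg_dnbhs_at_right; rewrite -E derive1E; exact: D.
  have /cvg_at_rightP /(_ d) l1 := l0.
  have {l1}l2 : (d n)^-1 *: (left_integral w (d n *: (1 : R) + x) - left_integral w x) @[n --> \oo] --> w x.
    by apply: l1; split; [exact: d0|exact: cvg_harmonic].
  rewrite /comp /k; under eq_fun do rewrite mulrC [x + _]addrC.
  by move: l2; rewrite /GRing.scale /=; under eq_fun do rewrite mulr1.
have mD : measurable (`[lo, hi] : set (measurableTypeR R)) by [].
have ib : mu.-integrable `[lo, hi] (cst B%:E).
  apply: (@measurable_bounded_integrable _ _ _ mu (cst B)) => //.
    by rewrite /= lebesgue_measure_itv /=; case: ifPn => _; rewrite -?EFinB ltry.
  exact: bounded_cst.
have h1 n : measurable_fun `[lo, hi] (EFin \o k n).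
  by apply/measurable_EFinP; exact: measurable_funS (mk n).
have h2 : measurable_fun `[lo, hi] (EFin \o w).
  by apply/measurable_EFinP; exact: measurable_funS mw.
have h3 : {ae mu, forall x n, `[lo, hi]%classic x -> (`|(EFin \o k n) x| <= cst B%:E x)%E}.
  by apply: aeW => x n _; rewrite /= lee_fin.
have [_ + _] := @dominated_convergence _ _ _ mu `[lo, hi]%classic mD
  (fun n => EFin \o k n) (EFin \o w) (cst B%:E) h1 h2 ae ib h3.
move=> /fine_cvgP[_ /cvgrPdist_lt /(_ e e0) [n _ /(_ n (leqnn n)) H]].
exists (d n) => //; move: H; rewrite /= sub0r normrN.
by apply: le_lt_trans; rewrite ler_norm.
Unshelve. all: by end_near. Qed.
End LeftIntegral.

(** * The critical orbit *)

Section SmoothExtensions.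
Context {R : realType}.
Implicit Types (F g h : R -> R) (A U : set R).

Lemma Ck_on_derive k U g i x : Ck_on k U g -> (i < k)%N -> U x ->
  is_derive x 1 (derive1n i g) (derive1n i.+1 g x).
Proof.
move=> [D _] ik Ux; apply: DeriveDef; first exact: D.
by rewrite derive1nS derive1E.
Qed.

Lemma Ck_on_continuous k U g i x : Ck_on k U g -> (i <= k)%N -> U x ->
  {for x, continuous (derive1n i g)}.
Proof.
move=> CU; rewrite leq_eqVlt => /predU1P[->|ik] Ux; first by case: CU => _; apply.
exact: is_derive_continuous (Ck_on_derive CU ik Ux).
Qed.

Lemma continuous_bounded F (u v : R) : u <= v ->
  (forall x, u <= x <= v -> {for x, continuous F}) ->
  exists2 B, 0 <= B & forall x, u <= x <= v -> `|F x| <= B.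
Proof.
move=> uv cF; have cN : {within `[u, v], continuous (fun x => `|F x|)}.
  apply: continuous_in_subspaceT => x; rewrite inE /= in_itv /= => /cF cx.
  by apply: cvg_norm.
by have [z _ Hz] := EVT_max uv cN; exists `|F z|.
Qed.

Lemma C1_lipschitz F h (u v : R) : u <= v ->
  (forall x, u <= x <= v -> is_derive x 1 F (h x) /\ {for x, continuous h}) ->
  exists2 B, 0 <= B & forall x y, u <= x <= v -> u <= y <= v ->
    `|F x - F y| <= B * `|x - y|.
Proof.
move=> uv H; have [x /H[]//|B B0 HB] := @continuous_bounded h u v uv.
exists B => //; apply: (@mean_value_norm _ F h) => x xuv.
by split; [case: (H x xuv)|exact: HB].
Qed.

Lemma contraction_rate A g : A !=set0 -> contracting_C3 A g ->
  exists h, Ck_extension 3 A g h /\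
    exists2 l, l < 1 & forall x, A x -> `|derive1 h x| <= l.
Proof.
move=> [x0 Ax0] [h [Eh]]; set S := ereal_sup _ => S1; exists h; split => //.
have ub x : A x -> (`|h^`()%classic x|%:E <= S)%E.
  by move=> Ax; apply: ereal_sup_ubound; exists x.
have := ub x0 Ax0; case: S S1 ub => [r r1 ub _|//|_ _]; last by rewrite leNgt ltNyr.
exists r; first by rewrite -lte_fin.
by move=> x /ub; rewrite lee_fin.
Qed.
End SmoothExtensions.

(** * Position of the first iterates of [c], and the period *)

Section Geometry.
Context {R : realType} (a b c : R) (f psip psim : R -> R) (n0 n1 : nat).
Context (hf : expanding_unimodal a b c f) (hpsi : inverse_branches a b c f psip psim).
Context (hn0 : (2 <= n0)%N) (hn1 : minimal_period f (iter n0 f c) n1).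
Context (hmin : forall k, (k < n0)%N -> ~ periodic_point f (iter k f c)).

Notation orb k := (iter k f c).

Lemma f_max y : a <= y <= b -> f y <= f c.
Proof.
move=> /andP[ay yb]; have [yc|cy|->//] := ltgtP y c.
  by apply: ltW; exact: (eu_increasing hf).
by apply: ltW; exact: (eu_decreasing hf).
Qed.

Lemma orbit_in k : a <= orb k <= b.
Proof.
elim: k => [|k IH]; last exact: (eu_maps hf).
by rewrite /= !ltW ?(eu_ac hf) ?(eu_cb hf).
Qed.

Lemma orbit_le k : orb k.+1 <= f c. Proof. exact/f_max/orbit_in. Qed.

Lemma n1_gt0 : (0 < n1)%N. Proof. by case: hn1. Qed.

Lemma orbit_shift k : orb (k + n0 + n1) = orb (k + n0).
Proof. by have [_ e _] := hn1; rewrite -addnA iterD [(n0 + n1)%N]addnC iterD e -iterD. Qed.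

Lemma orbit_not_decreasing k0 : ~ (forall k, (k0 <= k)%N -> orb k.+1 < orb k).
Proof.
move=> dec; have := orbit_shift k0; have H j : (0 < j)%N -> orb (k0 + n0 + j) < orb (k0 + n0).
  elim: j => // -[_ _|j IH _]; first by rewrite addn1; apply: dec; rewrite leq_addr.
  apply: lt_trans (IH isT); rewrite addnS; apply: dec.
  by rewrite -addnA leq_addr.
by move=> e; have := H n1 n1_gt0; rewrite e ltxx.
Qed.

Lemma orbit_neq_c k : orb k.+1 != c.
Proof. by apply/eqP => e; apply: (eu_critical hf); exists k.+1. Qed.

Lemma c1_not_fixed : f (f c) != f c.
Proof.
apply/eqP => e; apply: (hmin (_ : 1 < n0)%N) => //.
by exists 1%N.
Qed.

(** [psip] extends the inverse of [f] beyond the image of [[a, c]], so it inverts [f] only when its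
    value is at least [a]. Then [y] and [f (psip y)] have the same image under a strictly increasing
    map. *)
Lemma f_psip y : y <= f c -> a <= psip y -> psip y <= c /\ f (psip y) = y.
Proof.
move=> yc ay; have pc : psip y <= c.
  have : (psip @` `]-oo, f c]) (psip y) by exists y => //=; rewrite in_itv.
  by rewrite (ib_onto_p hpsi) /= in_itv.
split=> //; have e : psip (f (psip y)) = psip y by apply: (ib_inv_p hpsi); rewrite ay.
have fy : f (psip y) <= f c.
  by apply: f_max; rewrite ay (le_trans pc) // ltW // (eu_cb hf).
apply/eqP/negPn/negP; rewrite neq_lt => /orP[] h.
  by have := ib_increasing hpsi h yc; rewrite e ltxx.
by have := ib_increasing hpsi h fy; rewrite e ltxx.
Qed.

Lemma f_psim y : y <= f c -> psim y <= b -> c <= psim y /\ f (psim y) = y.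
Proof.
move=> yc ay; have pc : c <= psim y.
  have : (psim @` `]-oo, f c]) (psim y) by exists y => //=; rewrite in_itv.
  by rewrite (ib_onto_m hpsi) /= in_itv /= andbT.
split=> //; have e : psim (f (psim y)) = psim y by apply: (ib_inv_m hpsi); rewrite ay andbT.
have fy : f (psim y) <= f c.
  by apply: f_max; rewrite ay andbT (le_trans _ pc) // ltW // (eu_ac hf).
apply/eqP/negPn/negP; rewrite neq_lt => /orP[] h.
  by have := ib_decreasing hpsi h yc; rewrite e ltxx.
by have := ib_decreasing hpsi h fy; rewrite e ltxx.
Qed.

(** If [c_1 < c], the whole orbit lies on the increasing branch and decreases strictly, which an
    eventually periodic orbit cannot do. *)
Lemma c_lt_c1 : c < f c.
Proof.
have := orbit_neq_c 0; rewrite neq_lt => /orP[lt|//]; exfalso.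
have H k : orb k.+1 < orb k.
  elim: k => // k IH; rewrite [ltLHS]iterS [ltRHS]iterS.
  have lc : orb k <= c by elim: k {IH} => // k IH; apply: ltW; rewrite -/(orb k.+1); exact: le_lt_trans (orbit_le k) lt.
  by apply: (eu_increasing hf) => //; have /andP[] := orbit_in k.+1.
by apply: (@orbit_not_decreasing 0) => k _; exact: H.
Qed.

Lemma c1_le_b : f c <= b. Proof. by have /andP[] := orbit_in 1. Qed.
Lemma a_le_c2 : a <= orb 2. Proof. by have /andP[] := orbit_in 2. Qed.

Lemma lebesgue_branches : exists hp hm lam, [/\ 0 < lam < 1,
  Ck_extension 3 `]-oo, f c] psip hp, Ck_extension 3 `]-oo, f c] psim hm,
  forall x, x <= f c -> `|derive1 hp x| <= lam & forall x, x <= f c -> `|derive1 hm x| <= lam].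
Proof.
have ne : (`]-oo, f c]%classic : set R) !=set0 by exists (f c); rewrite /= in_itv /=.
have [hp [Ep [lp lp1 Hp]]] := contraction_rate ne (ib_contracting_p hpsi).
have [hm [Em [lm lm1 Hm]]] := contraction_rate ne (ib_contracting_m hpsi).
(* The maximum with 1/2 makes the rate positive. *)
exists hp, hm, (Num.max (Num.max lp lm) 2^-1).
have h1 : (2^-1 : R) < 1 by lra.
split => //.
- by rewrite !gt_max !lt_max lp1 lm1 h1 !andbT; apply/orP; right; lra.
- by move=> x xc; rewrite !le_max Hp //= in_itv.
- by move=> x xc; rewrite !le_max Hm ?orbT //= in_itv.
Qed.

Lemma psim_lipschitz : exists2 lam, 0 < lam < 1 & forall x y, x <= f c -> y <= f c ->
  `|psim x - psim y| <= lam * `|x - y|.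
Proof.
have [_ [hm [lam [l01 _ [Em [U [oU AU CU]]] _ Hm]]]] := lebesgue_branches.
exists lam => // x y xc yc.
have inJ z : z <= f c -> (`]-oo, f c]%classic : set R) z by rewrite /= in_itv.
rewrite -(Em x) ?inJ // -(Em y) ?inJ //.
apply: (@mean_value_norm _ hm (derive1 hm) (Num.min x y) (f c)).
- move=> z /andP[_ zc]; split; last exact: Hm.
  exact: (Ck_on_derive CU (isT : (0 < 3)%N) (AU z (inJ z zc))).
- by rewrite ge_min lexx.
- by rewrite ge_min lexx orbT.
Qed.

(** If [c_2 > c], then [psim] sends [c_2] and [c_3] to [c_1] and [c_2]. Since [c_2 < c_3 <= c_1],
    the distance does not shrink, although [psim] is a contraction. *)
Lemma c2_lt_c : orb 2 < c.
Proof.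
have := orbit_neq_c 1; rewrite neq_lt => /orP[//|gt]; exfalso.
have c21 : orb 2 < orb 1 by rewrite lt_neqAle (orbit_le 1) andbT; exact: c1_not_fixed.
have b1 := c1_le_b.
have [lam /andP[l0 l1] HL] := psim_lipschitz.
have e1 : psim (orb 2) = orb 1 by apply: (ib_inv_m hpsi); rewrite b1 ltW // c_lt_c1.
have e2 : psim (orb 3) = orb 2.
  by apply: (ib_inv_m hpsi); rewrite ltW //=; have /andP[] := orbit_in 2.
have c32 : orb 2 < orb 3 by apply: (eu_decreasing hf) => //; exact: ltW.
have := HL (orb 2) (orb 3) (orbit_le 1) (orbit_le 2).
rewrite e1 e2 ger0_norm ?subr_ge0 ?(ltW c21) // ltr0_norm ?subr_lt0 //.
have := orbit_le 2; move: c21 c32; rewrite -[f c]/(orb 1).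
set x1 := orb 1; set x2 := orb 2; set x3 := orb 3 => *; nra.
Qed.

(** Otherwise the orbit decreases from [c_2] on along the increasing branch, against eventual
    periodicity. *)
Lemma c2_le_c3 : orb 2 <= orb 3.
Proof.
rewrite leNgt; apply/negP => lt; apply: (@orbit_not_decreasing 2).
have H j : orb (2 + j).+1 < orb (2 + j) /\ orb (2 + j) < c.
  elim: j => [|j [IH1 IH2]]; first by rewrite addn0; split => //; exact: c2_lt_c.
  rewrite addnS; split; last exact: lt_trans IH2.
  rewrite [ltLHS]iterS [ltRHS]iterS; apply: (eu_increasing hf) => //; last exact: ltW.
  by have /andP[] := orbit_in (2 + j).+1.
by move=> k /subnKC <-; have [] := H (k - 2)%N.
Qed.

Lemma interval_maps y : orb 2 <= y <= f c -> orb 2 <= f y <= f c.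
Proof.
move=> /andP[y1 y2]; have ya : a <= y by exact: le_trans a_le_c2 y1.
have yb : y <= b by exact: le_trans y2 c1_le_b.
rewrite f_max ?ya // andbT; have [yc|cy] := leP y c.
  apply: le_trans c2_le_c3 _; move: y1; rewrite le_eqVlt => /predU1P[<-//|y1].
  by apply: ltW; apply: (eu_increasing hf) => //; exact: a_le_c2.
move: y2; rewrite le_eqVlt => /predU1P[->//|y2]; apply: ltW.
by apply: (eu_decreasing hf) => //; [exact: ltW|exact: c1_le_b].
Qed.

Lemma orbit_range k : orb 2 <= orb k <= f c.
Proof.
case: k => [|k]; first by rewrite !ltW ?c2_lt_c ?c_lt_c1.
elim: k => [|k IH]; last exact: interval_maps.
by rewrite lexx andbT; apply: orbit_le 1%N.
Qed.

Lemma orbit_finite k : exists2 j, (j < n0 + n1)%N & orb k = orb j.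
Proof.
elim/ltn_ind: k => k IH; have [lt|ge] := ltnP k (n0 + n1); first by exists k.
have [|j jN e] := IH (k - n1)%N.
  by rewrite ltn_subrL n1_gt0 (leq_trans _ ge) // addn_gt0 n1_gt0 orbT.
exists j => //; rewrite -e -[in LHS](subnK (leq_trans (leq_addl n0 n1) ge)).
have le : (n0 <= k - n1)%N by rewrite leq_subRL ?(leq_trans _ ge) ?leq_addl // addnC.
by rewrite -(subnK le) orbit_shift.
Qed.

(** A coincidence at times [i < j] makes [orb i] periodic, so [n0 <= i] and [j - i < n1]. Going
    round the cycle, [orb n0] is a later iterate of [orb i] and inherits the period [j - i], against
    minimality of [n1]. *)
Lemma orbit_injective i j : (i < n0 + n1)%N -> (j < n0 + n1)%N -> orb i = orb j -> i = j.
Proof.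
wlog ij : i j / (i <= j)%N => [W|].
  by have [|/ltnW] := leqP i j => h iN jN e; [exact: W|apply/esym/W].
move=> iN jN e; apply/eqP; rewrite eqn_leq ij leqNgt /=; apply/negP => lt.
have per : iter (j - i) f (orb i) = orb i by rewrite -iterD subnK.
have in0 : (n0 <= i)%N.
  rewrite leqNgt; apply/negP => /hmin; apply; exists (j - i)%N.
  by rewrite subn_gt0.
have [_ e1 no] := hn1.
have := no (j - i)%N; rewrite subn_gt0 lt /=.
have -> : (j - i < n1)%N.
  rewrite ltn_subLR ?(ltnW lt) //; apply: leq_trans jN _.
  by rewrite leq_add2r.
move=> /(_ isT); apply.
have pm m : orb (n0 + m * n1) = orb n0.
  elim: m => [|m IH]; first by rewrite addn0.
  have -> : (n0 + m.+1 * n1 = m * n1 + n0 + n1)%N by rewrite mulSn; lia.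
  by rewrite orbit_shift addnC.
rewrite -(pm i) -iterD.
have ile : (i <= n0 + i * n1)%N by rewrite (leq_trans _ (leq_addl _ _)) // leq_pmulr ?n1_gt0.
rewrite -[in RHS](subnK ile) [RHS]iterD -per -!iterD; congr (iter _ f c).
by move: ile ij lt; move: (i * n1)%N => p; lia.
Qed.

Lemma branch_lipschitz : exists2 B, 1 <= B & forall s x y,
  (if s then a <= x <= c else c <= x <= b) -> (if s then a <= y <= c else c <= y <= b) ->
  `|f x - f y| <= B * `|x - y|.
Proof.
have L u v : u <= v -> expanding_C3 `[u, v] f -> exists2 B, 0 <= B & forall x y,
    u <= x <= v -> u <= y <= v -> `|f x - f y| <= B * `|x - y|.
  move=> uv [h [[Eh [U [oU AU CU]]] _]].
  have inI z : u <= z <= v -> (`[u, v]%classic : set R) z by rewrite /= in_itv.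
  have [|B B0 HB] := @C1_lipschitz _ h (derive1 h) u v uv.
    move=> z zuv; have Uz := AU z (inI z zuv).
    split; first exact: (Ck_on_derive CU (isT : (0 < 3)%N) Uz).
    exact: (Ck_on_continuous CU (isT : (1 <= 3)%N) Uz).
  by exists B => // x y xI yI; rewrite -(Eh x) -?(Eh y); [exact: HB|exact: inI|exact: inI].
have [Bp Bp0 Hp] := L a c (ltW (eu_ac hf)) (eu_expanding_p hf).
have [Bm Bm0 Hm] := L c b (ltW (eu_cb hf)) (eu_expanding_m hf).
exists (1 + Bp + Bm); first by lra.
by move=> [] x y xI yI; [have := Hp x y xI yI|have := Hm x y xI yI] => /le_trans; apply;
  rewrite ler_wpM2r //; lra.
Qed.

(** The branches are the C^3 extensions, so two-sided derivatives exist at [f c] as well.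
    Second-order bounds come from compactness of [[c_2, c_1]], as the rays carrying the branches are
    unbounded; [kap] is the inverse of a Lipschitz constant of [f] on its two halves. *)
Lemma unimodal_markov : exists br dbr ddbr lam kap D,
  markov_unimodal c f br dbr ddbr lam kap D /\
  forall x, x <= f c -> br true x = psip x /\ br false x = psim x.
Proof.
have [hp [hm [lam [l01 [Ep [Up [oUp AUp CUp]]] [Em [Um [oUm AUm CUm]]] Hp Hm]]]] :=
  lebesgue_branches.
have [La La1 HLa] := branch_lipschitz.
have inJ z : z <= f c -> (`]-oo, f c]%classic : set R) z by rewrite /= in_itv.
pose br s := if s then hp else hm.
have brE x : x <= f c -> br true x = psip x /\ br false x = psim x.
  by move=> /inJ Jx; rewrite /br /= Ep // Em.
pose Us s : set R := if s then Up else Um.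
have CU s : Ck_on 3 (Us s) (br s) by case: s.
have JU s x : x <= f c -> Us s x by move=> /inJ Jx; case: s => /=; [exact: AUp|exact: AUm].
have lohi : orb 2 <= f c by exact: ltW (lt_trans c2_lt_c c_lt_c1).
have der s i x : (i < 3)%N -> x <= f c ->
    is_derive x 1 (derive1n i (br s)) (derive1n i.+1 (br s) x).
  by move=> i3 xc; exact: Ck_on_derive (CU s) i3 (JU s x xc).
have con s i x : (i <= 3)%N -> x <= f c -> {for x, continuous (derive1n i (br s))}.
  by move=> i3 xc; exact: Ck_on_continuous (CU s) i3 (JU s x xc).
have /choice[D0 HD0] s : exists B, 0 <= B /\ forall x, orb 2 <= x <= f c ->
    `|derive1n 2 (br s) x| <= B.
  have [x /andP[_ xc]|B ? ?] := @continuous_bounded _ (derive1n 2 (br s)) _ _ lohi.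
    exact: con.
  by exists B.
have lip s i : (i < 3)%N -> exists B, 0 <= B /\ forall x y,
    orb 2 <= x <= f c -> orb 2 <= y <= f c ->
    `|derive1n i (br s) x - derive1n i (br s) y| <= B * `|x - y|.
  move=> i3; have [x /andP[_ xc]|B ? ?] :=
      @C1_lipschitz _ (derive1n i (br s)) (derive1n i.+1 (br s)) _ _ lohi.
    by split; [exact: der|exact: con].
  by exists B.
have /choice[D1 HD1] s := lip s 1%N isT.
have /choice[D2 HD2] s := lip s 2%N isT.
pose D := \sum_(s : bool) (D0 s + D1 s + D2 s).
have DE : D = (D0 true + D1 true + D2 true) + (D0 false + D1 false + D2 false).
  by rewrite /D big_bool.
have [d0t d1t d2t] := And3 (HD0 true).1 (HD1 true).1 (HD2 true).1.
have [d0f d1f d2f] := And3 (HD0 false).1 (HD1 false).1 (HD2 false).1.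
have f_br s x : x <= f c -> orb 2 <= br s x <= f c ->
    (if s then a <= br s x <= c else c <= br s x <= b) /\ f (br s x) = x.
  move=> xc /andP[r1 r2]; have [e1 e2] := brE x xc; case: s r1 r2; rewrite ?e1 ?e2 => r1 r2.
    have ap := le_trans a_le_c2 r1.
    by have [pc fp] := f_psip xc ap; rewrite ap pc.
  have bp := le_trans r2 c1_le_b.
  by have [pc fp] := f_psim xc bp; rewrite pc bp.
have inI s x : x <= f c -> orb 2 <= br s x <= f c -> orb 2 <= x <= f c.
  by move=> xc r; have [_ <-] := f_br s x xc r; exact: interval_maps.
have mono s x y : x < y -> y <= f c -> 0 < side s * (br s y - br s x).
  move=> xy yc; have [x1 x2] := brE x (ltW (lt_le_trans xy yc)); have [y1 y2] := brE y yc.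
  case: s; rewrite /side ?x1 ?x2 ?y1 ?y2.
    by rewrite mul1r subr_gt0; exact: (ib_increasing hpsi).
  by rewrite mulN1r opprB subr_gt0; exact: (ib_decreasing hpsi).
have sideP s x : x <= f c -> 0 <= side s * (c - br s x).
  move=> xc; have [x1 x2] := brE x xc; case: s; rewrite /side ?x1 ?x2.
    rewrite mul1r subr_ge0; have : (psip @` `]-oo, f c]) (psip x) by exists x => //; exact: inJ.
    by rewrite (ib_onto_p hpsi) /= in_itv.
  rewrite mulN1r opprB subr_ge0; have : (psim @` `]-oo, f c]) (psim x) by exists x => //; exact: inJ.
  by rewrite (ib_onto_m hpsi) /= in_itv /= andbT.
exists br, (fun s => derive1n 1 (br s)), (fun s => derive1n 2 (br s)), lam, La^-1, D.
split; last exact: brE.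
apply: MarkovUnimodal.
- exact: c2_lt_c.
- exact: c_lt_c1.
- by exists (n0 + n1)%N; exact: orbit_finite.
- exact: orbit_range.
- exact: interval_maps.
- exact: mono.
- exact: sideP.
- move=> s y /andP[y1 y2] ys; have ya := le_trans a_le_c2 y1; have yb := le_trans y2 c1_le_b.
  have fy : f y <= f c by apply: f_max; rewrite ya.
  have [e1 e2] := brE _ fy; case: s ys; rewrite /side ?e1 ?e2 => ys.
    by apply: (ib_inv_p hpsi); rewrite ya /=; lra.
  by apply: (ib_inv_m hpsi); rewrite yb andbT; lra.
- by move=> s x xc; exact: (der s 0%N x).
- exact: l01.
- by move=> s x xc; case: s => /=; [exact: Hp|exact: Hm].
- by rewrite invr_gt0 invf_le1 ?La1 ?andbT; lra.
(* To the right of [x] the branch moves towards [c] and so stays in the support, where it inverts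
   [f]. The Lipschitz bound for [f] then bounds its right difference quotients from below. *)
- move=> s x xc r; have La0 : 0 < La by lra.
  have D1' : is_derive x 1 (fun z => side s *: br s z) (side s *: derive1n 1 (br s) x).
    exact: is_deriveZ (der s 0%N x isT (ltW xc)).
  apply: (@derive_ge_right _ _ _ _ (f c - x) _ _ D1'); first by rewrite subr_gt0.
  move=> y /andP[xy]; rewrite addrC subrK => yc.
  have m := mono s x y xy (ltW yc); have sy := sideP s y (ltW yc).
  have ry : orb 2 <= br s y <= f c.
    have c1 := c2_lt_c; have c2 := c_lt_c1.
    move: c1 c2 m sy r; rewrite -[f c]/(orb 1).
    move: (orb 2) (orb 1) (br s y) (br s x) => u v p q c1 c2 m sy /andP[r1 r2].
    by apply/andP; case: s m sy {D1'}; rewrite /side /= ?mul1r ?mulN1r => m sy; split; lra.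
  have [Ix fx] := f_br s x (ltW xc) r; have [Iy fy] := f_br s y (ltW yc) ry.
  have := HLa s (br s y) (br s x) Iy Ix; rewrite fx fy ger0_norm ?subr_ge0 ?(ltW xy) //.
  rewrite -scalerBr /GRing.scale /= ler_pdivrMl //.
  suff -> : `|br s y - br s x| = side s * (br s y - br s x) by [].
  case: s m {D1' sy ry r Ix Iy fx fy}; rewrite /side ?mul1r ?mulN1r => m.
    by rewrite gtr0_norm.
  by rewrite ltr0_norm // -oppr_gt0.
- by rewrite DE; lra.
- move=> s x xc r; split; first exact: (der s 1%N x).
  by apply: le_trans ((HD0 s).2 x (inI s x xc r)) _; rewrite DE; case: (s); lra.
- move=> s x y xc yc rx ry; apply: le_trans ((HD1 s).2 x y (inI s x xc rx) (inI s y yc ry)) _.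
  by rewrite ler_wpM2r // DE; case: (s); lra.
- move=> s x y xc yc rx ry; apply: le_trans ((HD2 s).2 x y (inI s x xc rx) (inI s y yc ry)) _.
  by rewrite ler_wpM2r // DE; case: (s); lra.
- exact: (eu_mixing hf).
Qed.
End Geometry.

(** * The invariant density *)

Section RealIntegrable.
Context {R : realType}.
Notation mu := (@lebesgue_measure R).
Implicit Types (f g : R -> R) (D : set (measurableTypeR R)).

Lemma real_integrableD D f g : measurable D -> mu.-integrable D (EFin \o f) ->
  mu.-integrable D (EFin \o g) -> mu.-integrable D (EFin \o (fun x => f x + g x)).
Proof.
move=> mD i1 i2; rewrite (_ : EFin \o _ = (EFin \o f) \+ (EFin \o g))%E; first exact: integrableD.
by apply/funext => x; rewrite /= EFinD.
Qed.

Lemma real_integrableB D f g : measurable D -> mu.-integrable D (EFin \o f) ->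
  mu.-integrable D (EFin \o g) -> mu.-integrable D (EFin \o (fun x => f x - g x)).
Proof.
move=> mD i1 i2; rewrite (_ : EFin \o _ = (EFin \o f) \- (EFin \o g))%E; first exact: integrableB.
by apply/funext => x; rewrite /= EFinB.
Qed.
End RealIntegrable.

(** * Changes at finitely many points, and one-sided derivatives *)

Section FiniteModifications.
Context {R : realType}.
Notation mu := (@lebesgue_measure R).
Implicit Types (f g F : R -> R) (D : set R) (s : seq R).

Lemma seq_measurable s (A : set R) : A `<=` [set` s] -> measurable (A : set (measurableTypeR R)).
Proof.
move=> As; apply: countable_measurable; first by move=> t; exact: measurable_set1.
by apply: sub_countable (finite_set_countable (finite_seq s)); exact: subset_card_le.
Qed.

Lemma measurable_fun_modify s D f g : measurable (D : set (measurableTypeR R)) -> measurable_fun D f ->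
  (forall x, D x -> x \notin s -> g x = f x) -> measurable_fun D g.
Proof.
move=> mD mf gf _ Y mY.
have -> : D `&` g @^-1` Y = ((D `&` f @^-1` Y) `\` [set` s]) `|` (D `&` g @^-1` Y `&` [set` s]).
  apply/seteqP; split => x /=.
    move=> [Dx Yx]; have [xs|xs] := boolP (x \in s); first by right.
    by left; split => //; split => //; rewrite -gf.
  move=> [[[Dx Yx] /negP xs]|[]//]; split => //.
  by rewrite gf.
apply: measurableU; last by apply: (@seq_measurable s) => x [].
by apply: measurableD; [exact: mf|exact: (@seq_measurable s)].
Qed.

Lemma Rintegral_modify s D f g : measurable (D : set (measurableTypeR R)) -> measurable_fun D f ->
  (forall x, D x -> x \notin s -> g x = f x) ->
  \int[mu]_(x in D) g x = \int[mu]_(x in D) f x.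
Proof.
move=> mD mf gf; congr fine; apply: ae_eq_integral => //.
- apply/measurable_EFinP; exact: measurable_fun_modify mf gf.
- exact/measurable_EFinP.
exists [set` s]; split; first exact: (@seq_measurable s).
  by apply: countable_lebesgue_measure0; apply: finite_set_countable; exact: finite_seq.
move=> x /= H; apply: contrapT => /negP xs; apply: H => Dx.
by rewrite gf.
Qed.

Lemma derive_le_right F (x l d B : R) : 0 < d -> is_derive x 1 F l ->
  (forall y, x < y < x + d -> F y - F x <= B * (y - x)) -> l <= B.
Proof.
move=> d0 dF H; have dN := is_deriveN dF.
rewrite -lerN2; apply: (derive_ge_right d0 dN) => y /H.
by rewrite fctE; lra.
Qed.

(** [F] has the increments of an integral of [w], so just right of [x] they are squeezed around [r].
    Since [F] is known to be differentiable, its one-sided quotients determine [l]. *)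
Lemma right_derivative (w : R -> R) F (x l r : R) : is_derive x 1 F l ->
  w y @[y --> x^'+] --> r ->
  (forall u v m B, u <= v -> (forall t, u < t < v -> m <= w t <= B) ->
     m * (v - u) <= F v - F u <= B * (v - u)) -> l = r.
Proof.
move=> dF wr FB; apply/eqP; rewrite eq_le.
have close e : 0 < e -> exists2 d, 0 < d & forall y, x < y < x + d -> r - e <= w y <= r + e.
  move=> e0; move/cvgrPdist_le : wr => /(_ e e0); rewrite near_withinE.
  move=> /nbhs_ballP[d /= d0 Hd]; exists d => // y /andP[xy yd].
  have : `|r - w y| <= e by apply: Hd => //; rewrite -ball_normE /= ltr_distlC; apply/andP; split; lra.
  by rewrite ler_distlC.
have bnd e : 0 < e -> r - e <= l <= r + e.
  move=> e0; have [d d0 Hd] := close e e0.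
  have H y : x < y < x + d -> (r - e) * (y - x) <= F y - F x <= (r + e) * (y - x).
    move=> /andP[xy yd]; apply: FB (ltW xy) _ => // t /andP[xt ty].
    by apply: Hd; rewrite xt (lt_trans ty).
  apply/andP; split.
    by apply: (derive_ge_right d0 dF) => y /H/andP[].
  by apply: (derive_le_right d0 dF) => y /H/andP[].
by apply/andP; split; apply/ler_addgt0Pr => e /bnd/andP[]; lra.
Qed.

Lemma left_derivative (w : R -> R) F (x l r : R) : is_derive x 1 F l ->
  w y @[y --> x^'-] --> r ->
  (forall u v m B, u <= v -> (forall t, u < t < v -> m <= w t <= B) ->
     m * (v - u) <= F v - F u <= B * (v - u)) -> l = r.
Proof.
move=> dF wr FB.
apply: (@right_derivative (fun y => w (- y)) (fun y => - F (- y)) (- x)).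
- have dx : is_derive (- x) 1 (-%R : R -> R) (- 1) by exact: is_deriveN.
  have dF' : is_derive (- - x) 1 F l by rewrite opprK.
  have := is_deriveN (is_derive1_comp dF' dx).
  by rewrite /GRing.scale /= mulrN1 opprK.
- move/cvgrPdist_le : wr => wr; apply/cvgrPdist_le => e /wr.
  rewrite !near_withinE => /nbhs_ballP[d /= d0 Hd]; apply/nbhs_ballP; exists d => //= y.
  rewrite /ball /= => dy yx; apply: Hd; last by rewrite ltrNl.
  by rewrite -ball_normE /= opprK -normrN opprD.
move=> u v m B uv H; have := FB (- v) (- u) m B.
rewrite lerN2 opprK => /(_ uv) H'; rewrite opprK [v - u]addrC [- F (- v) + _]addrC.
apply: H' => t tuv; rewrite -[t]opprK; apply: H; lra.
Qed.
End FiniteModifications.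

Lemma near_outside {R : realType} (u v x : R) : ~~ (u <= x <= v) ->
  \forall z \near x, ~~ (u <= z <= v).
Proof.
rewrite negb_and -!ltNge => /orP[] h; near=> y; rewrite negb_and -!ltNge; apply/orP.
  by left; near: y; exact: lt_nbhsl.
by right; near: y; exact: lt_nbhsr.
Unshelve. all: by end_near. Qed.

Section Distributions.
Context {R : realType} (c : R) (f : R -> R).
Notation mu := (@lebesgue_measure R).

Lemma small_distribution_left_integral (w : R -> R) e : mu.-integrable setT (EFin \o w) ->
  (forall x, 0 <= w x) -> (forall x, f c < x -> w x = 0) -> \int[mu]_x w x <= e ->
  small_distribution c f e (fun x => left_integral w x - \int[mu]_x w x).
Proof.
move=> iw w0 wh we.
have pos x : 0 <= left_integral w x by exact: Rintegral_ge0.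
split=> [x y xy|x hx|x].
- rewrite lerD2r -subr_ge0 left_integral_diff //; exact: Rintegral_ge0.
- by rewrite (left_integral_right wh hx) subrr.
- by have := pos x; lra.
Qed.

Lemma left_integralB (v w : R -> R) x : mu.-integrable setT (EFin \o v) ->
  mu.-integrable setT (EFin \o w) ->
  left_integral (fun t => v t - w t) x = left_integral v x - left_integral w x.
Proof.
by move=> iv iw; rewrite /left_integral RintegralB //; [exact: integrableS iv|exact: integrableS iw].
Qed.
End Distributions.

(** * From invariance of the measure to regularity of its density *)

Section Density.
Context {R : realType} (a b c : R) (f psip psim rho : R -> R) (n0 n1 : nat).
Context (hf : expanding_unimodal a b c f) (hpsi : inverse_branches a b c f psip psim).
Context (hn0 : (2 <= n0)%N) (hn1 : minimal_period f (iter n0 f c) n1).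
Context (hmin : forall k, (k < n0)%N -> ~ periodic_point f (iter k f c)).
Context (hrho : regular_invariant_density a b c f rho).
Context (br dbr ddbr : bool -> R -> R) (lam kap D : R).
Context (M : markov_unimodal c f br dbr ddbr lam kap D).
Context (brE : forall x, x <= f c -> br true x = psip x /\ br false x = psim x).

Notation mu := (@lebesgue_measure R).
Notation orb k := (iter k f c).
Notation lo := (iter 2 f c).
Notation hi := (iter 1 f c).

Let lohi : lo < hi. Proof. exact: lt_trans (mk_lo M) (mk_hi M). Qed.

Lemma branches_c : psip (f c) = c /\ psim (f c) = c.
Proof.
split; first by apply: (ib_inv_p hpsi); rewrite lexx (ltW (eu_ac hf)).
by apply: (ib_inv_m hpsi); rewrite lexx (ltW (eu_cb hf)).
Qed.

(** The value 1/2 of [chi] at [f c] is harmless: both branches equal [c] there and the two terms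
    cancel. *)
Lemma L0_primitive_transfer : L0 c f psip psim = primitive_transfer c f br.
Proof.
apply/funext => u; apply/funext => x; rewrite /L0 /chi /primitive_transfer -[iter 1 f c]/(f c).
case: ltgtP => [xc|xc|->]; rewrite ?mul0r ?subrr //.
  by have [-> ->] := brE (ltW xc); rewrite !mul1r.
by have [-> ->] := branches_c; rewrite subrr.
Qed.

Let rho_off x : ~~ (lo <= x <= hi) -> rho x = 0. Proof. by case: hrho => _ /(_ x). Qed.

Lemma density_bounded : exists B, forall x, `|rho x| <= B.
Proof.
have [_ _ bv _] := hrho; have [B HB] := bounded_variation_bounded bv; exists B => x.
have := HB x (hi + 1); rewrite (@rho_off (hi + 1)) ?subr0 //.
by rewrite negb_and -!ltNge; apply/orP; right; lra.
Qed.

Lemma density_integrable : mu.-integrable setT (EFin \o rho).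
Proof.
have [[mr r0 r1 _ _] _ _ _] := hrho; apply/integrableP; split; first exact/measurable_EFinP.
by under eq_integral do rewrite /= ger0_norm //; rewrite r1 ltry.
Qed.

Lemma density_mass : \int[mu]_x rho x = 1.
Proof. by have [[_ _ r1 _ _] _ _ _] := hrho; rewrite /Rintegral r1. Qed.

Definition tail x := left_integral rho x - 1.

Lemma tail_hi x : hi <= x -> tail x = 0.
Proof.
move=> hx; rewrite /tail (@left_integral_right _ _ hi) ?density_mass ?subrr // => t ht.
by rewrite rho_off // negb_and -!ltNge ht orbT.
Qed.

Lemma tail_lo x : x <= lo -> tail x = - 1.
Proof.
move=> xl; have [B HB] := density_bounded.
rewrite /tail (left_integral_left_closed density_integrable HB _ xl) ?sub0r // => t tl.
by rewrite rho_off // negb_and -!ltNge tl.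
Qed.

Lemma tail_continuous : continuous tail.
Proof.
have [B HB] := density_bounded => x; apply: cvgB; last exact: cvg_cst.
exact: left_integral_continuous density_integrable HB x.
Qed.

Lemma tail_diff u v : tail u - tail v = left_integral rho u - left_integral rho v.
Proof. by rewrite /tail; ring. Qed.

Lemma preimage_branches x : x < f c ->
  `[a, b] `&` f @^-1` `]x, f c] = `[a, b] `&` `]psip x, psim x[%classic.
Proof.
move=> xc; have [p1 p2] := branches_c.
have pc : psip x < c by rewrite -p1; exact: ib_increasing hpsi _ _ xc (lexx _).
have mc : c < psim x by rewrite -p2; exact: ib_decreasing hpsi _ _ xc (lexx _).
apply/seteqP; split => y /=; rewrite !in_itv /= => -[yab H]; split => //; move: H.
  move=> /andP[xfy fyc]; have /andP[ay yb] := yab; have [yle|cy] := leP y c.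
    rewrite (le_lt_trans yle mc) andbT -(ib_inv_p hpsi (_ : a <= y <= c)) ?ay //.
    exact: (ib_increasing hpsi).
  rewrite (lt_trans pc cy) -[ltLHS](ib_inv_m hpsi (_ : c <= y <= b)) ?yb ?andbT ?(ltW cy) //.
  exact: (ib_decreasing hpsi).
move=> /andP[py ym]; have fyc : f y <= f c by apply: f_max yab; exact: hf.
rewrite fyc andbT ltNge; apply/negP; rewrite le_eqVlt => /predU1P[e|lt].
  have /andP[ay yb] := yab; have [yle|cy] := leP y c.
    by move: py; rewrite -e (ib_inv_p hpsi) ?ay // ltxx.
  by move: ym; rewrite -e (ib_inv_m hpsi) ?yb ?(ltW cy) // ltxx.
have /andP[ay yb] := yab; have [yle|cy] := leP y c.
  have := ib_increasing hpsi lt (ltW xc); rewrite (ib_inv_p hpsi) ?ay // => h.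
  by have := lt_trans py h; rewrite ltxx.
have := ib_decreasing hpsi lt (ltW xc); rewrite (ib_inv_m hpsi) ?yb ?(ltW cy) // => h.
by have := lt_trans ym h; rewrite ltxx.
Qed.

(** Invariance is tested on the intervals []x, f c]]. Their preimage is the open interval between
    the two branch values, whose mass is a difference of tails. *)
Lemma tail_invariant x : tail x = primitive_transfer c f br tail x.
Proof.
rewrite /primitive_transfer; case: ltP => [xh|hx]; last by rewrite tail_hi.
have [-> ->] := brE (ltW xh); have [[_ _ _ roff inv] _ _ _] := hrho.
have := inv `]x, f c]%classic (measurable_itv _); rewrite preimage_branches // => /(congr1 fine).
rewrite -!/(Rintegral _ _ _) setIC Rintegral_mkcondr.
have -> : rho \_ `[a, b] = rho.
  apply/funext => y; rewrite patchE; case: ifPn => // /negP; rewrite inE /= in_itv /= => yab.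
  by rewrite roff //; exact/negP.
rewrite Rintegral_itv_bndo_bndc; last first.
  exact: integrableS density_integrable.
have p1 : psip x <= psim x.
  have [q1 q2] := branches_c.
  have := ib_increasing hpsi xh (lexx _); have := ib_decreasing hpsi xh (lexx _).
  by rewrite q1 q2 => h1 h2; rewrite ltW // (lt_trans h2 h1).
rewrite -!left_integral_diff ?density_integrable ?(ltW xh) // -!tail_diff (@tail_hi (f c)) ?lexx //.
lra.
Qed.

(** Difference quotients of the integral of [rho] are Lipschitz and close to [rho] in L1. Cutting
    them off outside the support is free, as [rho] vanishes there, and creates jumps only at the
    orbit points [lo] and [hi]. *)
Lemma smoothed_density e : 0 < e -> exists k B, [/\ 0 <= B, supported c f k,
  mu.-integrable setT (EFin \o k),
  [/\ forall x, `|k x| <= B, forall x y, cell c f x y -> `|k x - k y| <= B * `|x - y| &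
    forall x, regular_point c f x -> {for x, continuous k}] &
  \int[mu]_x `|rho x - k x| <= e].
Proof.
move=> e0; have [B HB] := density_bounded; have irho := density_integrable.
have B0 : 0 <= B := le_trans (normr_ge0 _) (HB 0).
have [d d0 Hd] := smoothing_L1 lo hi irho HB e0.
pose q x := (left_integral rho (x + d) - left_integral rho x) / d.
have qL x y : `|q x - q y| <= 2 * B / d * `|x - y|.
  rewrite /q -mulrBl normrM [`|d^-1|]gtr0_norm ?invr_gt0 //.
  rewrite mulrAC ler_wpM2r ?invr_ge0 ?(ltW d0) //.
  have h1 := left_integral_lipschitz (x + d) (y + d) irho HB.
  have h2 := left_integral_lipschitz x y irho HB.
  have e1 : x + d - (y + d) = x - y by ring.
  rewrite e1 in h1; rewrite [X in `|X|](_ : _ = (left_integral rho (x + d) - left_integral rho (y + d))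
    - (left_integral rho x - left_integral rho y)); last by ring.
  by apply: le_trans (ler_normB _ _) _; lra.
have qB x : `|q x| <= B.
  rewrite /q normrM [`|d^-1|]gtr0_norm ?invr_gt0 // ler_pdivrMr //.
  by have := left_integral_lipschitz (x + d) x irho HB; rewrite addrAC subrr add0r (gtr0_norm d0).
pose k := q \_ `[lo, hi].
have kE x : k x = if lo <= x <= hi then q x else 0.
  rewrite /k patchE; case: ifPn => [/set_mem|/negP]; rewrite ?inE /= in_itv /=; first by move=> ->.
  by move=> /negP/negbTE ->.
have cq : continuous q by exact: lipschitz_continuous qL.
have mq : measurable_fun setT q by exact: continuous_measurable_fun.
have iqI : mu.-integrable `[lo, hi] (EFin \o q).
  by apply: (bounded_itv_integrable (measurable_funTS mq)) => x _; exact: qB.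
have ik : mu.-integrable setT (EFin \o k).
  by have := iqI; rewrite integrable_mkcond //= restrict_EFin.
have kB x : `|k x| <= B by rewrite kE; case: ifP => _; rewrite ?normr0.
have d2 : 0 <= 2 * B / d by rewrite divr_ge0 ?mulr_ge0 // ltW.
exists k, (B + 2 * B / d); split.
- by lra.
- by move=> x /negbTE xI; rewrite kE xI.
- exact: ik.
- split=> [x|x y xy|x xr].
  + by apply: le_trans (kB x) _; lra.
  + rewrite !kE (cell_range xy); case: ifP => _.
      by apply: le_trans (qL x y) _; rewrite ler_wpM2r //; lra.
    by rewrite subrr normr0 mulr_ge0 //; lra.
  + have [xI|xI] := boolP (lo <= x <= hi).
      have /andP[lx xh] := regular_lo xr xI.
      apply: (continuous_near _ (cq x)); near=> y; rewrite kE; case: ifPn => //.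
      rewrite negb_and -!ltNge => /orP[] h; exfalso; move: h; apply/negP; rewrite -leNgt ltW //.
        by near: y; exact: lt_nbhsr.
      by near: y; exact: lt_nbhsl.
    apply: (@continuous_near _ _ (fun=> 0)); last exact: cst_continuous.
    by apply: filterS (near_outside xI) => y /negbTE yI; rewrite kE yI.
- apply: ltW; apply: le_lt_trans Hd; rewrite le_eqVlt; apply/orP; left; apply/eqP.
  rewrite [RHS]Rintegral_mkcond; apply: eq_Rintegral => x _; rewrite patchE; case: ifPn.
    by move=> /set_mem; rewrite /= in_itv /= => xI; rewrite kE xI distrC.
  move=> /negP; rewrite inE /= in_itv /= => /negP xI.
  by rewrite kE (negbTE xI) rho_off // subrr normr0.
Unshelve. all: by end_near. Qed.

(** The positive and negative parts of [rho - k] have mass at most [e], so their tails are the two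
    small distributions. *)
Lemma tail_approximation e : 0 < e -> exists P k m B, [/\ 0 <= B, supported c f k,
  primitive c f P k m,
  (forall x, regular_point c f x -> `|k x| <= B) /\
  (forall x y, cell c f x y -> `|k x - k y| <= B * `|x - y|) &
  exists K1 K2, [/\ small_distribution c f e K1, small_distribution c f e K2 &
    forall x, tail x = P x + (K1 x - K2 x)]].
Proof.
move=> e0; have [k [B [B0 sk ik [kB kL kc] ke]]] := smoothed_density e0.
have irho := density_integrable.
pose d x := rho x - k x.
have id : mu.-integrable setT (EFin \o d).
  exact: real_integrableB.
have iN : mu.-integrable setT (EFin \o (fun x => `|d x|)).
  by have := integrable_abse id.
pose dp x := (`|d x| + d x) / 2; pose dm x := (`|d x| - d x) / 2.
have half (g : R -> R) : mu.-integrable setT (EFin \o g) ->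
    mu.-integrable setT (EFin \o (fun x => g x / 2)).
  move=> ig; rewrite (_ : EFin \o _ = (fun x => (2^-1)%:E * (EFin \o g) x)%E).
    exact: integrableZl.
  by apply/funext => x; rewrite /= mulrC EFinM.
have idp : mu.-integrable setT (EFin \o dp).
  by apply/half/real_integrableD.
have idm : mu.-integrable setT (EFin \o dm).
  by apply/half/real_integrableB.
have d_hi x : f c < x -> d x = 0.
  by move=> hx; rewrite /d rho_off ?sk ?subrr // negb_and -!ltNge hx orbT.
have nd x : - d x <= `|d x| /\ d x <= `|d x| by rewrite ler_norm -normrN ler_norm.
have dist g : mu.-integrable setT (EFin \o g) -> (forall x, 0 <= g x <= `|d x|) ->
    small_distribution c f e (fun x => left_integral g x - \int[mu]_x g x).
  move=> ig gd; apply: small_distribution_left_integral => //.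
  - by move=> x; case/andP: (gd x).
  - by move=> x hx; have := gd x; rewrite d_hi // normr0 => H; apply/eqP; rewrite eq_le andbC.
  - by apply: le_trans ke; apply: le_Rintegral => // x _; case/andP: (gd x).
pose m := \int[mu]_x k x.
exists (fun x => left_integral k x - m), k, m, B; split => //.
  split.
  - by move=> x; apply: cvgB; [exact: left_integral_continuous ik kB x|exact: cvg_cst].
  - move=> x xr; rewrite -[k x]subr0; apply: is_deriveB; exact: left_integral_derive ik (kc x xr).
  - move=> x hx; rewrite (@left_integral_right _ _ hi) ?subrr // => t ht.
    by rewrite sk // negb_and -!ltNge ht orbT.
  - move=> x xl; rewrite (left_integral_left_closed ik kB _ xl) ?sub0r // => t tl.
    by rewrite sk // negb_and -!ltNge tl.
exists (fun x => left_integral dp x - \int[mu]_x dp x),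
       (fun x => left_integral dm x - \int[mu]_x dm x); split.
- by apply: dist => // x; rewrite /dp; have := nd x; lra.
- by apply: dist => // x; rewrite /dm; have := nd x; lra.
- move=> x; have l x0 : left_integral dp x0 - left_integral dm x0 = left_integral rho x0 - left_integral k x0.
    by rewrite -!left_integralB //; congr left_integral; apply/funext => t; rewrite /dp /dm /d; field.
  have t : \int[mu]_x dp x - \int[mu]_x dm x = \int[mu]_x rho x - \int[mu]_x k x.
    by rewrite -!RintegralB //; apply: eq_Rintegral => t _; rewrite /dp /dm /d; field.
  rewrite density_mass -/m in t; have := l x; rewrite /tail; lra.
Qed.

(** Differentiability of the tail forces both one-sided limits of [rho] to equal the derivative; the
    convention of regular discontinuities then fixes the value itself. *)
Lemma density_regular_value (h x : R) : is_derive x 1 tail h -> rho x = h.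
Proof.
move=> dT; have [_ _ bv reg] := hrho; have [cr cl] := bounded_variation_limits x bv.
have FB u v m B : u <= v -> (forall t, u < t < v -> m <= rho t <= B) ->
    m * (v - u) <= tail v - tail u <= B * (v - u).
  by move=> uv H; rewrite tail_diff; exact: left_integral_bounds density_integrable uv H.
have er : h = right_limit rho x := right_derivative dT cr FB.
have el : h = left_limit rho x := left_derivative dT cl FB.
by have := reg x; rewrite -er -el; lra.
Qed.

Lemma density_regularity : exists h g C, [/\ supported c f h /\ supported c f g,
    forall x, regular_point c f x ->
      [/\ is_derive x 1 tail (h x), is_derive x 1 h (g x) & rho x = h x],
    forall x, regular_point c f x -> `|h x| <= C /\ `|g x| <= C,
    forall x y, cell c f x y ->
      `|h x - h y| <= C * `|x - y| /\ `|g x - g y| <= C * `|x - y| &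
    forall x, regular_point c f x -> h x = transfer c f br dbr h x].
Proof.
have [h [g [C [sup der bnd lip inv]]]] := invariant_regularity M
  (invariant_unique M tail_invariant tail_lo tail_approximation).
exists h, g, C; split => // x /der[d1 d2]; split => //.
exact: density_regular_value d1.
Qed.

(** The decomposition sums over the whole orbit, [c] included; this removes the term that
    [total_jump] lacks. *)
Lemma density_jump_c : jump c f rho 0 = 0.
Proof.
have [h [g [C [[sh _] der _ _ inv]]]] := density_regularity.
have ch x : regular_point c f x -> {for x, continuous h}.
  by move=> /der[_ dh _]; exact: is_derive_continuous dh.
have [l hl] := no_jump M sh (orbit_neq_c hf) ch inv.
have rl : rho x @[x --> c^'] --> l.
  apply: cvg_trans hl; apply: near_eq_cvg.
  by apply: filterS (near_regular M c) => x /der[].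
rewrite /jump /right_limit /left_limit /=.
by rewrite (cvg_lim _ (cvg_dnbhs_at_right rl)) // (cvg_lim _ (cvg_dnbhs_at_left rl)) // subrr.
Qed.

Context (X : R -> R) (hX : perturbation_field a b f X).

(** [X] is smooth only near the image of [f]. The right branch takes [[c_2, c_1]] into [[c, b]], so
    the support lies in that image. *)
Lemma image_contains x : lo <= x <= hi -> (f @` `[a, b]) x.
Proof.
move=> /andP[lx xh]; have e : psim lo = hi.
  by apply: (ib_inv_m hpsi); rewrite (c1_le_b hf) (ltW (mk_hi M)).
have pb : psim x <= b.
  move: lx; rewrite le_eqVlt => /predU1P[<-|lx]; first by rewrite e (c1_le_b hf).
  apply: le_trans (c1_le_b hf); rewrite -[f c]/hi -e; apply: ltW.
  exact: ib_decreasing hpsi _ _ lx xh.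
have [cp fp] := f_psim hf hpsi xh pb; exists (psim x) => //=.
by rewrite in_itv /= pb andbT (le_trans _ cp) // ltW // (eu_ac hf).
Qed.

(** [rho X] is replaced by the product of the smooth representatives [h] and [Xt], equal to it off
    the orbit. Its jump at [c_k] is that of [rho] times [X] at [c_k]. *)
Lemma transfer_expansion : exists2 q, 0 < q < 1 & exists2 C, 0 <= C & forall n,
  exists K, [/\ continuous K, forall x, `|K x| <= C * q ^+ n &
    forall x, regular_point c f x ->
      iter n (L0 c f psip psim) (fun y => rho y * X y) x =
      K x - total_jump c f X rho n0 n1 * tail x +
      \sum_(1 <= k < n0 + n1) jump c f rho k * X (orb k) * step (orb (n + k)) x].
Proof.
have [q q01 Hq] := expansion M; exists q => //.
have [h [g [C [[sh sg] der bnd lip _]]]] := density_regularity.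
have [Xt [EX [U [oU AU CU]]]] := pf_C2 hX.
have inU x : lo <= x <= hi -> U x by move=> /image_contains/AU.
have dX x : lo <= x <= hi -> is_derive x 1 Xt (derive1 Xt x).
  by move=> /inU Ux; exact: Ck_on_derive CU (isT : (0 < 2)%N) Ux.
have dX2 x : lo <= x <= hi -> is_derive x 1 (derive1 Xt) (derive1n 2 Xt x).
  by move=> /inU Ux; exact: Ck_on_derive CU (isT : (1 < 2)%N) Ux.
have cX2 x : lo <= x <= hi -> {for x, continuous (derive1n 2 Xt)}.
  by move=> /inU Ux; exact: Ck_on_continuous CU (leqnn 2) Ux.
have [|B0 B00 HB0] := @continuous_bounded _ Xt lo hi (ltW lohi).
  by move=> x /dX; exact: is_derive_continuous.
have [|B1 B10 HB1] := @continuous_bounded _ (derive1 Xt) lo hi (ltW lohi).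
  by move=> x /dX2; exact: is_derive_continuous.
have [|La L00 HL0] := @C1_lipschitz _ Xt (derive1 Xt) lo hi (ltW lohi).
  by move=> x xI; split; [exact: dX|exact: is_derive_continuous (dX2 x xI)].
have [|Lb L10 HL1] := @C1_lipschitz _ (derive1 Xt) (derive1n 2 Xt) lo hi (ltW lohi).
  by move=> x xI; split; [exact: dX2|exact: cX2].
pose y x := h x * Xt x; pose y' x := g x * Xt x + h x * derive1 Xt x.
pose C' : R := `|C|; have C'0 : 0 <= C' by exact: normr_ge0.
have CC' : C <= C' by exact: ler_norm.
pose B := C' + C' * B0 + C' * B1 + C' * La + C' * Lb.
have [p1 p2 p3 p4] : [/\ 0 <= C' * B0, 0 <= C' * B1, 0 <= C' * La & 0 <= C' * Lb].
  by split; exact: mulr_ge0.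
have hE x : ~~ (lo <= x <= hi) -> h x = 0 /\ g x = 0 by move=> xI; rewrite sh ?sg.
have bh x : regular_point c f x -> `|h x| <= C' by move=> /bnd[+ _] => /le_trans; apply.
have bg x : regular_point c f x -> `|g x| <= C' by move=> /bnd[_] => /le_trans; apply.
have l_h x z : cell c f x z -> `|h x - h z| <= C' * `|x - z|.
  by move=> /lip[+ _] => /le_trans; apply; rewrite ler_wpM2r.
have l_g x z : cell c f x z -> `|g x - g z| <= C' * `|x - z|.
  by move=> /lip[_] => /le_trans; apply; rewrite ler_wpM2r.
have [] := Hq (n0 + n1)%N (fun x => rho x * X x) y y'
   (fun p => left_limit rho p * X p) (fun k => jump c f rho k * X (orb k)) tail h B.
- exact: orbit_injective.
- exact: orbit_finite.
- by rewrite /B; lra.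
- by move=> x /hE[h0 _]; rewrite /y h0 mul0r.
- by move=> x /hE[h0 g0]; rewrite /y' h0 g0 !mul0r addr0.
- move=> x xr; have [_ dh _] := der x xr; have [xI|xI] := boolP (lo <= x <= hi).
    have -> : y' x = h x *: derive1 Xt x + Xt x *: g x by rewrite /y' /GRing.scale /=; ring.
    exact: is_deriveM dh (dX x xI).
  have [h0 g0] := hE x xI; rewrite /y' h0 g0 !mul0r addr0.
  apply: (@near_eq_is_derive _ _ _ (cst 0)).
  by apply: filterS (near_outside xI) => z /hE[h0' _]; rewrite /y h0' mul0r.
- move=> x xr; have [xI|xI] := boolP (lo <= x <= hi).
    apply: le_trans (ler_normD _ _) _; rewrite !normrM.
    have := ler_pM (normr_ge0 _) (normr_ge0 _) (bg x xr) (HB0 x xI).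
    have := ler_pM (normr_ge0 _) (normr_ge0 _) (bh x xr) (HB1 x xI).
    by rewrite /B; lra.
  by have [h0 g0] := hE x xI; rewrite /y' h0 g0 !mul0r addr0 normr0 /B; lra.
- move=> x z xz; have [xI|xI] := boolP (lo <= x <= hi); last first.
    have zI : ~~ (lo <= z <= hi) by rewrite -(cell_range xz).
    have [h0 g0] := hE x xI; have [h1 g1] := hE z zI.
    by rewrite /y' h0 g0 h1 g1 !mul0r subrr normr0 mulr_ge0 // /B; lra.
  have zI : lo <= z <= hi by rewrite -(cell_range xz).
  have P (u v : R -> R) Lv Bv : (forall x, regular_point c f x -> `|u x| <= C') ->
      `|u x - u z| <= C' * `|x - z| -> `|v x - v z| <= Lv * `|x - z| -> `|v z| <= Bv ->
      `|u x * v x - u z * v z| <= (C' * Lv + C' * Bv) * `|x - z|.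
    move=> ub ul vl vb.
    have -> : u x * v x - u z * v z = u x * (v x - v z) + (u x - u z) * v z by ring.
    apply: le_trans (ler_normD _ _) _; rewrite !normrM mulrDl; apply: lerD.
      by rewrite -mulrA; apply: ler_pM => //; apply: ub; exact: cellL xz.
    by rewrite mulrAC; apply: ler_pM.
  have h1 := P g Xt La B0 bg (l_g x z xz) (HL0 x z xI zI) (HB0 z zI).
  have h2 := P h (derive1 Xt) Lb B1 bh (l_h x z xz) (HL1 x z xI zI) (HB1 z zI).
  have -> : y' x - y' z = (g x * Xt x - g z * Xt z) +
     (h x * derive1 Xt x - h z * derive1 Xt z) by rewrite /y'; ring.
  apply: le_trans (ler_normD _ _) _.
  apply: le_trans (lerD h1 h2) _; rewrite -mulrDl ler_wpM2r //.
  by rewrite /B; lra.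
(* The one-sided limits exist by bounded variation of [rho], and punctured neighbourhoods of an
   orbit point are eventually regular, so they pass to [y]. *)
- move=> k _; have oI := orbit_range hf hpsi hn0 hn1 hmin k.
  have EXk : X (orb k) = Xt (orb k) by rewrite EX //; exact: image_contains.
  have cXk : Xt x @[x --> orb k] --> Xt (orb k) by exact: is_derive_continuous (dX _ oI).
  have [_ _ bv _] := hrho; have [cr cl] := bounded_variation_limits (orb k) bv.
  have nr := near_regular M (orb k); rewrite EXk; split.
    apply: (@cvg_trans _ (rho x * Xt x @[x --> (orb k)^'-])).
      apply: near_eq_cvg; apply: filterS (near_left_dnbhs nr) => x /der[_ _ e].
      by rewrite /y e.
    by apply: cvgM; [exact: cl|exact: cvg_at_left_filter].
  have -> : left_limit rho (orb k) * Xt (orb k) + jump c f rho k * Xt (orb k) =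
     right_limit rho (orb k) * Xt (orb k) by rewrite /jump; ring.
  apply: (@cvg_trans _ (rho x * Xt x @[x --> (orb k)^'+])).
    apply: near_eq_cvg; apply: filterS (near_right_dnbhs nr) => x /der[_ _ e].
    by rewrite /y e.
  by apply: cvgM; [exact: cr|exact: cvg_at_right_filter].
- split; [exact: tail_continuous|by move=> x /der[]|exact: tail_hi|exact: tail_lo].
- exact: sh.
- by move=> x /bh /le_trans; apply; rewrite /B; lra.
- by move=> x z /l_h /le_trans; apply; rewrite ler_wpM2r // /B; lra.
- exact: tail_invariant.
- move=> x xr; have [_ _ e] := der x xr; rewrite /y e.
  have [xI|xI] := boolP (lo <= x <= hi); first by rewrite EX //; exact: image_contains.
  by have [-> _] := hE x xI; rewrite !mul0r.
move=> C1 C10 HC; exists C1 => // n; have [K [cK bK eK]] := HC n.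
exists K; split => // x xr; rewrite L0_primitive_transfer eK //.
have S (F : nat -> R) : \sum_(k < n0 + n1) jump c f rho k * X (orb k) * F k =
    \sum_(1 <= k < n0 + n1) jump c f rho k * X (orb k) * F k.
  rewrite -(big_mkord xpredT (fun k => jump c f rho k * X (orb k) * F k)) big_ltn ?density_jump_c ?mul0r ?add0r //.
  by rewrite addn_gt0 (leq_trans _ hn0).
congr (_ - _ * _ + _); last by rewrite -(S (fun k => step (orb (n + k)) x)).
rewrite /total_jump; have := S (fun=> 1).
by under eq_bigr do rewrite mulr1; move=> ->; apply: eq_bigr => k _; rewrite mulr1.
Qed.
End Density.

(** * Coefficients of the power series *)

Section TestFunctions.
Context {R : realType}.
Notation mu := (@lebesgue_measure R).
Implicit Types (phi F : R -> R).

Lemma clamp_continuous F (u v : R) : u <= v ->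
  (forall x, u <= x <= v -> {for x, continuous F}) ->
  continuous (fun x => F (Num.max u (Num.min x v))).
Proof.
move=> uv cF x; apply: (@continuous_comp _ _ _ (fun x => Num.max u (Num.min x v)) F).
  apply: (@continuous_max _ _ (cst u) (fun x => Num.min x v)); first exact: cst_continuous.
  by apply: (@continuous_min _ _ id (cst v)); [exact: cvg_id|exact: cst_continuous].
by apply: cF; rewrite le_max lexx ge_max uv ge_min lexx orbT.
Qed.

Lemma clamp_id (u v x : R) : u <= x <= v -> Num.max u (Num.min x v) = x.
Proof. by move=> /andP[ux xv]; rewrite (min_idPl xv); apply/max_idPr. Qed.

Lemma near_itv (u v x : R) : u < x < v -> \forall y \near x, u < y < v.
Proof.
move=> /andP[ux xv]; near=> y; apply/andP; split; near: y; [exact: lt_nbhsr|exact: lt_nbhsl].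
Unshelve. all: by end_near. Qed.

(** Clamping the argument makes the extension continuous on the whole line. [derive1 phi] is
    identified only in the open interval, because at the endpoints it depends on values of [phi]
    outside. *)
Lemma C1_on_interval phi (u v : R) : u < v -> extends_Ck 1 `[u, v] phi ->
  exists F h B, [/\ continuous F, forall x, u <= x <= v -> F x = phi x,
    forall x, u < x < v -> [/\ is_derive x 1 F (h x), derive1 phi x = h x & {for x, continuous h}],
    measurable_fun `[u, v] h & forall x, u <= x <= v -> `|h x| <= B].
Proof.
move=> uv [g [Eg [U [oU AU CU]]]].
have inU x : u <= x <= v -> U x by move=> xI; apply: AU; rewrite /= in_itv.
have dg x : u <= x <= v -> is_derive x 1 g (derive1 g x).
  by move=> /inU Ux; exact: Ck_on_derive CU (isT : (0 < 1)%N) Ux.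
have cg' x : u <= x <= v -> {for x, continuous (derive1 g)}.
  by move=> /inU Ux; exact: Ck_on_continuous CU (leqnn 1) Ux.
have [B B0 HB] := continuous_bounded (ltW uv) cg'.
pose F x := g (Num.max u (Num.min x v)).
have FE x : u <= x <= v -> F x = phi x.
  by move=> xI; rewrite /F clamp_id // Eg //= in_itv.
exists F, (derive1 g), B; split => //.
- by apply: clamp_continuous (ltW uv) _ => x /dg; exact: is_derive_continuous.
- move=> x xI; have xI' : u <= x <= v by case/andP: xI => ? ?; rewrite !ltW.
  have nE : \forall y \near x, g y = phi y.
    by apply: filterS (near_itv xI) => y /andP[? ?]; rewrite Eg //= in_itv /= !ltW.
  split; last exact: cg'.
  + apply: near_eq_is_derive (dg x xI'); apply: filterS (near_itv xI) => y /andP[? ?].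
    by rewrite /F clamp_id // !ltW.
  + by rewrite !derive1E; apply/esym/near_eq_derive.
- apply: subspace_continuous_measurable_fun => //.
  by apply: continuous_in_subspaceT => x; rewrite inE /= in_itv /= => /cg'.
Qed.

(** An antiderivative of [step p] times the derivative of [F], constant to the right of [p], and
    zero at [u] when [u <= p]. *)
Definition step_primitive F (u p x : R) : R := F u - F (Num.min x p).

Lemma step_primitiveP F h (u p x : R) : x != p -> is_derive x 1 F (h x) ->
  is_derive x 1 (step_primitive F u p) (step p x * h x).
Proof.
move=> xp dF; rewrite /step; case: leP => [xp'|px].
  have lt : x < p by rewrite lt_neqAle xp.
  rewrite mulN1r -[- h x]add0r; apply: (@near_eq_is_derive _ _ _ (cst (F u) \- F)).
    by near=> y; rewrite /step_primitive /= min_l //; apply: ltW; near: y; exact: lt_nbhsl.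
rewrite mul0r; apply: (@near_eq_is_derive _ _ _ (cst (F u - F p))).
by near=> y; rewrite /step_primitive /= min_r //; apply: ltW; near: y; exact: lt_nbhsr.
Unshelve. all: by end_near. Qed.

Lemma step_near (p x : R) : x != p -> {for x, continuous (step p)}.
Proof.
move=> xp; apply: (@continuous_near _ _ (fun=> step p x)); last exact: cst_continuous.
move: xp; rewrite neq_lt => /orP[] xp; near=> y; rewrite /step.
  by rewrite (ltW xp) ltW //; near: y; exact: lt_nbhsl.
have py : p < y by near: y; exact: lt_nbhsr.
by rewrite !leNgt py xp.
Unshelve. all: by end_near. Qed.

Lemma step_measurable (p : R) : measurable_fun setT (step p).
Proof.
apply: measurable_fun_ifT; [|exact: measurable_cst|exact: measurable_cst].
exact: measurable_fun_ler.
Qed.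

Lemma step_bounded (p x : R) : `|step p x| <= 1.
Proof. by rewrite /step; case: ifP; rewrite ?normrN ?normr1 ?normr0. Qed.
End TestFunctions.

Lemma is_derive_sum_nat {R : realType} (N : nat) (u v : nat -> R -> R) (x : R) :
  (forall k, is_derive x 1 (u k) (v k x)) ->
  is_derive x 1 (fun y => \sum_(1 <= k < N) u k y) (\sum_(1 <= k < N) v k x).
Proof.
move=> H; elim: N => [|N IH].
  by under eq_fun do rewrite big_geq //; rewrite big_geq //; exact: is_derive_cst.
have [N0|N0] := posnP N.
  by rewrite N0; under eq_fun do rewrite big_geq //; rewrite big_geq //; exact: is_derive_cst.
by under eq_fun do rewrite big_nat_recr //=; rewrite big_nat_recr //=; exact: is_deriveD.
Qed.

Lemma continuous_sum_nat {R : realType} (N : nat) (u : nat -> R -> R) (x : R) :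
  (forall k, {for x, continuous (u k)}) ->
  {for x, continuous (fun y => \sum_(1 <= k < N) u k y)}.
Proof.
move=> H; rewrite /prop_for /continuous_at; elim: N => [|N IH].
  by under eq_fun do rewrite big_geq //; rewrite big_geq //; exact: cvg_cst.
have [N0|N0] := posnP N.
  by rewrite N0; under eq_fun do rewrite big_geq //; rewrite big_geq //; exact: cvg_cst.
by under eq_fun do rewrite big_nat_recr //=; rewrite big_nat_recr //=; apply: cvgD; [exact: IH|exact: H].
Qed.

(** * Integration against the derivative of the test function *)

Section Coefficients.
Context {R : realType}.
Notation mu := (@lebesgue_measure R).

Lemma bounded_itv_Rintegral (g : R -> R) (u v B : R) : u <= v -> measurable_fun `[u, v] g ->
  (forall x, u <= x <= v -> `|g x| <= B) -> `|\int[mu]_(x in `[u, v]) g x| <= B * (v - u).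
Proof.
move=> uv mg gB; have ig := bounded_itv_integrable mg gB.
have ig' : mu.-integrable `]u, v] (EFin \o g).
  by apply: integrableS ig => // x /=; rewrite !in_itv /= => /andP[/ltW -> ->].
rewrite -Rintegral_itv_obnd_cbnd // -Rintegral_cst_itv //.
apply: le_trans (le_normr_Rintegral _ _) _ => //; apply: le_Rintegral => //.
- exact: (integrable_abse ig').
- exact: integrable_cst_itv.
- by move=> x /=; rewrite in_itv /= => /andP[/ltW ux xv]; apply: gB; rewrite ux.
Qed.

Context (a b c a0 : R) (f psip psim rho X phi : R -> R) (n0 n1 : nat).
Context (hf : expanding_unimodal a b c f) (hpsi : inverse_branches a b c f psip psim).
Context (hn0 : (2 <= n0)%N) (hn1 : minimal_period f (iter n0 f c) n1).
Context (hmin : forall k, (k < n0)%N -> ~ periodic_point f (iter k f c)).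
Context (hrho : regular_invariant_density a b c f rho) (hX : perturbation_field a b f X).
Context (a0a : a0 <= a) (hphi : extends_Ck 1 `[a0, b] phi).
Notation orb k := (iter k f c).

Lemma coefficient_expansion : exists2 q, 0 < q < 1 & exists2 C, 0 <= C & forall n,
  `|Psi_coef a0 b c f psip psim X rho phi n -
    (total_jump c f X rho n0 n1 * \int[mu]_(x in `[a0, b]) (phi x * rho x) -
     \sum_(1 <= k < n0 + n1) jump c f rho k * X (orb k) * phi (orb (n + k)))| <= C * q ^+ n.
Proof.
have [br [dbr [ddbr [lam [kap [D [M brE]]]]]]] := unimodal_markov hf hpsi hn0 hn1 hmin.
have [q q01 [C C0 HC]] := transfer_expansion hf hpsi hn0 hn1 hmin hrho M brE hX.
have [h [g [Ch [[sh sg] der _ _ _]]]] := density_regularity hf hpsi hrho M brE.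
have [s Hs] := regular_seq M.
have a0b : a0 < b by rewrite (le_lt_trans a0a) // (lt_trans (eu_ac hf)) // (eu_cb hf).
have [F [F' [B [cF FE dF mF' F'B]]]] := C1_on_interval a0b hphi.
have [Br HBr] := density_bounded hrho; have irho := density_integrable hrho.
have a0lo : a0 <= orb 2 by rewrite (le_trans a0a) // (a_le_c2 hf).
have hib : f c <= b by exact: (c1_le_b hf).
have rho_off x : ~~ (a0 <= x <= b) -> rho x = 0.
  move=> xI; case: hrho => _ + _ _; apply; apply: contra xI => /andP[h1 h2].
  by rewrite (le_trans a0lo h1) (le_trans h2).
have mrho : measurable_fun setT rho by case: hrho => -[].
have cT := tail_continuous hrho.
have mF : measurable_fun setT F by exact: continuous_measurable_fun.
have mT : measurable_fun setT (tail rho) by exact: continuous_measurable_fun.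
have [|BF _ HBF] := @continuous_bounded _ F a0 b (ltW a0b); first by move=> x _; exact: cF.
have [|BT BT0 HBT] := @continuous_bounded _ (tail rho) a0 b (ltW a0b); first by move=> x _; exact: cT.
pose w x := rho x * F x.
have wB x : `|w x| <= Br * BF.
  have [xI|xI] := boolP (a0 <= x <= b).
    by rewrite normrM; apply: ler_pM => //; exact: HBF.
  rewrite /w rho_off // mul0r normr0 mulr_ge0 //; first exact: le_trans (normr_ge0 _) (HBr 0).
  by apply: le_trans (normr_ge0 _) (HBF a0 _); rewrite lexx ltW.
have iw : mu.-integrable setT (EFin \o w).
  have : mu.-integrable `[a0, b] (EFin \o w).
    apply: (@bounded_itv_integrable _ _ _ _ (Br * BF)) => //.
    by apply: measurable_funM; exact: measurable_funTS.
  rewrite integrable_mkcond //= restrict_EFin; congr (mu.-integrable _ (EFin \o _)).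
  apply/funext => x; rewrite patchE; case: ifPn => // /negP; rewrite inE /= in_itv /= => /negP xI.
  by rewrite /w rho_off ?mul0r.
have wI : left_integral w b = \int[mu]_(x in `[a0, b]) (phi x * rho x).
  rewrite (@left_integral_right _ _ b) ?lexx //; last first.
    by move=> t bt; rewrite /w rho_off ?mul0r // negb_and -!ltNge bt orbT.
  rewrite [RHS]Rintegral_mkcond; apply: eq_Rintegral => x _; rewrite patchE.
  case: ifPn => [/set_mem|/negP]; first by rewrite /= in_itv /= /w => /FE ->; rewrite mulrC.
  by rewrite inE /= in_itv /= => /negP xI; rewrite /w rho_off ?mul0r.
have wL : left_integral w a0 = 0.
  apply: (left_integral_left_closed iw wB _ (lexx a0)) => t ta.
  by rewrite /w rho_off ?mul0r // negb_and -!ltNge ta.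
exists q => //; exists (C * B * (b - a0)).
  rewrite !mulr_ge0 ?subr_ge0 ?(ltW a0b) //; apply: le_trans (normr_ge0 _) (F'B a0 _).
  by rewrite lexx ltW.
move=> n; have [K [cK KB KE]] := HC n.
set J := total_jump _ _ _ _ _ _ in KE *; pose j k := jump c f rho k * X (orb k).
pose S x := - J * tail rho x + \sum_(1 <= k < n0 + n1) j k * step (orb (n + k)) x.
have mS : measurable_fun setT S.
  apply: measurable_funD; first by apply: measurable_funM => //; exact: measurable_cst.
  by apply: measurable_sum => k; apply: measurable_funM; [exact: measurable_cst|exact: step_measurable].
have mK : measurable_fun setT K by exact: continuous_measurable_fun.
pose BS := `|J| * BT + \sum_(1 <= k < n0 + n1) `|j k|.
have SB x : a0 <= x <= b -> `|S x| <= BS.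
  move=> xI; apply: le_trans (ler_normD _ _) _; apply: lerD.
    by rewrite normrM normrN ler_wpM2l // HBT.
  apply: le_trans (ler_norm_sum _ _ _) _; apply: ler_sum => k _.
  by rewrite normrM ler_piMr // step_bounded.
have B0 : 0 <= B by apply: le_trans (normr_ge0 _) (F'B a0 _); rewrite lexx ltW.
have KF'B x : a0 <= x <= b -> `|K x * F' x| <= C * q ^+ n * B.
  by move=> xI; rewrite normrM ler_pM // F'B.
have SF'B x : a0 <= x <= b -> `|S x * F' x| <= BS * B.
  by move=> xI; rewrite normrM ler_pM // ?SB ?F'B.
have mKF : measurable_fun `[a0, b] (fun x => K x * F' x).
  by apply: measurable_funM => //; exact: measurable_funTS.
have mSF : measurable_fun `[a0, b] (fun x => S x * F' x).
  by apply: measurable_funM => //; exact: measurable_funTS.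
have -> : Psi_coef a0 b c f psip psim X rho phi n =
    \int[mu]_(x in `[a0, b]) (K x * F' x) + \int[mu]_(x in `[a0, b]) (S x * F' x).
  rewrite -RintegralD //; [|exact: bounded_itv_integrable KF'B|exact: bounded_itv_integrable SF'B].
  (* The identity for the iterate fails possibly on the orbit, that for [derive1 phi] possibly at
     [a0] and [b]; finitely many points in all. *)
  apply: (@Rintegral_modify _ [:: a0, b & s]) => //.
    exact: measurable_funD.
  move=> x /=; rewrite in_itv /= => /andP[ax xb]; rewrite !inE !negb_or => /and3P[xa xb' xs].
  rewrite KE; last exact: Hs.
  have [|_ -> _] := dF x; first by rewrite !lt_neqAle ax xb eq_sym xa xb'.
  by rewrite /S -mulrDl; congr (_ * _); ring.
(* Integration by parts in antiderivative form: [tail rho] has derivative [rho] off the orbit, so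
   [tail rho * F] minus the integral of [rho * F] is an antiderivative of [tail rho * F']. *)
pose G x := - J * (tail rho x * F x - left_integral w x) +
  \sum_(1 <= k < n0 + n1) j k * step_primitive F a0 (orb (n + k)) x.
have -> : \int[mu]_(x in `[a0, b]) (S x * F' x) = G b - G a0.
  apply: (@FTC2_exceptions _ s G _ a0 b (BS * B)) => //.
    move=> x; apply: cvgD.
      apply: cvgM; first exact: cvg_cst.
      by apply: cvgB; [apply: cvgM; [exact: cT|exact: cF]|exact: left_integral_continuous iw wB x].
    apply: continuous_sum_nat => k; apply: cvgM; first exact: cvg_cst.
    apply: cvgB; first exact: cvg_cst.
    apply: (@continuous_comp _ _ _ (fun y => Num.min y (orb (n + k))) F); last exact: cF.
    by apply: (@continuous_min _ _ id (cst (orb (n + k)))); [exact: cvg_id|exact: cst_continuous].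
  move=> x xI /Hs xr; have [dFx _ cF'] := dF x xI; have [dT dh re] := der x xr; split.
    have xI' : a0 <= x <= b by case/andP: xI => ? ?; rewrite !ltW.
    have -> : S x * F' x = - J *: (tail rho x *: F' x + F x *: h x - w x) +
        \sum_(1 <= k < n0 + n1) j k *: (step (orb (n + k)) x * F' x).
      rewrite /S /w re mulrDl mulr_suml /GRing.scale /=; congr (_ + _); first by ring.
      by apply: eq_bigr => k _; ring.
    apply: is_deriveD.
      apply: is_deriveZ; apply: is_deriveB; apply: left_integral_derive iw _.
      apply: (@continuous_near _ _ (fun y => h y * F y)); last first.
        by apply: cvgM; [exact: is_derive_continuous dh|exact: cF].
      have nr := near_regular M x; rewrite /dnbhs near_withinE in nr.
      apply: filterS nr => y ny; rewrite /w.
      have [->|/ny /der[_ _ ->//]] := eqVneq y x; first by rewrite re.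
    apply: (@is_derive_sum_nat _ _ _ (fun k x => j k *: (step (orb (n + k)) x * F' x))) => k.
    by apply: is_deriveZ; apply: step_primitiveP => //; exact: xr.
  apply: cvgM; last exact: cF'; apply: cvgD.
    by apply: cvgM; [exact: cvg_cst|exact: cT].
  apply: continuous_sum_nat => k; apply: cvgM; first exact: cvg_cst.
  exact: step_near (xr _).
have oI k : a0 <= orb k <= b.
  have /andP[ha hb] := orbit_in hf k; by rewrite (le_trans a0a ha) hb.
have -> : G b - G a0 = J * \int[mu]_(x in `[a0, b]) (phi x * rho x) -
     \sum_(1 <= k < n0 + n1) jump c f rho k * X (orb k) * phi (orb (n + k)).
  rewrite /G wI wL (tail_hi hrho) // (tail_lo hrho) //.
  (* Each step contributes [phi a0] weighted by [j k], in total [J * phi a0]. This cancels the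
     boundary term of [tail rho] at [a0], where the tail is [- 1]. *)
  have e k : step_primitive F a0 (orb (n + k)) b - step_primitive F a0 (orb (n + k)) a0 =
      phi a0 - phi (orb (n + k)).
    have /andP[ha hb] := oI (n + k)%N; rewrite /step_primitive (min_r hb) (min_l ha) subrr subr0.
    by rewrite !FE ?oI // lexx ltW.
  pose p k : R := phi (orb (n + k)).
  have -> : \sum_(1 <= k < n0 + n1) j k * step_primitive F a0 (orb (n + k)) b =
    \sum_(1 <= k < n0 + n1) j k * step_primitive F a0 (orb (n + k)) a0 +
    (J * phi a0 - \sum_(1 <= k < n0 + n1) j k * p k).
    rewrite /J /total_jump mulr_suml -sumrB -big_split /=; apply: eq_bigr => k _.
    by have := e k; rewrite -/(p k) -/(j k) => ek; rewrite -mulrBr -ek; ring.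
  rewrite (FE a0) ?lexx ?(ltW a0b) // /j /p; ring.
rewrite addrK mulrAC; apply: le_trans (bounded_itv_Rintegral (ltW a0b) mKF KF'B) _.
by rewrite le_eqVlt; apply/orP; left; apply/eqP; ring.
Qed.
End Coefficients.

(** * Complex power series *)

Local Open Scope complex_scope.

Section ComplexModulus.
Context {R : realType}.
Implicit Types (F G : R[i] -> R[i]) (z w : R[i]) (x e B : R).
Notation cm := (@Normc.normc R).

(** The norm of [R[i]] has values in [R[i]]; [cm] is its real form, so that estimates live in an
    ordered field. *)
Lemma norm_modulus z : `|z| = (cm z)%:C. Proof. by []. Qed.

Lemma modulus_real x : cm x%:C = `|x|.
Proof. by rewrite /Normc.normc /= expr0n addr0 sqrtr_sqr. Qed.

Lemma modulus_ge0 z : 0 <= cm z.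
Proof. by rewrite -ler0c -norm_modulus. Qed.

Lemma modulusB z w : cm (z - w) = cm (w - z).
Proof. by rewrite -normcN opprB. Qed.

Lemma modulusX z n : cm (z ^+ n) = cm z ^+ n.
Proof. by elim: n => [|n IH]; rewrite ?expr0 ?Normc.normc1 // !exprS Normc.normcM IH. Qed.

Lemma modulus_parts z : [/\ `|complex.Re z| <= cm z, `|complex.Im z| <= cm z &
  cm z <= `|complex.Re z| + `|complex.Im z|].
Proof.
case: z => p q /=; split.
- by rewrite -sqrtr_sqr ler_wsqrtr // lerDl sqr_ge0.
- by rewrite -sqrtr_sqr ler_wsqrtr // lerDr sqr_ge0.
- rewrite -[leRHS]ger0_norm ?addr_ge0 // -sqrtr_sqr ler_wsqrtr //.
  rewrite sqrrD !real_normK ?num_real // -addrA lerD2l lerDr.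
  by rewrite mulrn_wge0 // mulr_ge0.
Qed.

Lemma complex_pos (e : R[i]) : 0 < e -> exists2 d : R, 0 < d & e = d%:C.
Proof.
move=> e0; exists (complex.Re e); first by move: e0; rewrite ltcE => /andP[].
by rewrite RRe_real // gtr0_real.
Qed.

Lemma cvg_modulusP (T : Type) (S : set_system T) {FS : Filter S} (F : T -> R[i]) (l : R[i]) :
  F x @[x --> S] --> l <-> forall e : R, 0 < e -> \forall x \near S, cm (F x - l) < e.
Proof.
split=> [/cvgrPdist_lt H e e0|H].
  have e1 : 0 < e%:C by rewrite ltcR.
  by apply: filterS (H _ e1) => x; rewrite norm_modulus ltcR modulusB.
apply/cvgrPdist_lt => e /complex_pos[d d0 ->].
by apply: filterS (H d d0) => x; rewrite norm_modulus ltcR modulusB.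
Qed.

Lemma cvg_real_complex (T : Type) (S : set_system T) {FS : Filter S} (F : T -> R) (l : R) :
  F x @[x --> S] --> l -> (F x)%:C @[x --> S] --> l%:C.
Proof.
move=> H; apply/cvg_modulusP => e e0; move/cvgrPdist_lt: H => /(_ e e0).
by apply: filterS => x; rewrite -rmorphB modulus_real distrC.
Qed.

Lemma cvg_modulus_le (s : nat -> R[i]) (l : R[i]) B :
  s n @[n --> \oo] --> l -> (forall n, cm (s n) <= B) -> cm l <= B.
Proof.
move=> /cvg_modulusP H sB; apply/ler_addgt0Pr => e /H [n _ /(_ n (leqnn n)) Hn].
rewrite -[l](subrK (s n)) addrC; apply: le_trans (le_normcD _ _) _.
by rewrite lerD // modulusB ltW.
Qed.

Lemma cvg_complex (s : nat -> R[i]) : cvgn (fun n => complex.Re (s n)) ->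
  cvgn (fun n => complex.Im (s n)) -> cvgn s.
Proof.
move=> /cvg_ex[p /= Hp] /cvg_ex[q /= Hq]; apply/cvg_ex; exists (p +i* q).
apply/cvg_modulusP => e e0; have e2 : 0 < e / 2 by rewrite divr_gt0.
move/cvgrPdist_lt: Hp => /(_ _ e2) Hp; move/cvgrPdist_lt: Hq => /(_ _ e2) Hq.
near=> n; have [_ _ /le_lt_trans] := modulus_parts (s n - (p +i* q)); apply.
have h1 : `|p - complex.Re (s n)| < e / 2 by near: n.
have h2 : `|q - complex.Im (s n)| < e / 2 by near: n.
have -> : complex.Re (s n - (p +i* q)) = complex.Re (s n) - p by case: (s n).
have -> : complex.Im (s n - (p +i* q)) = complex.Im (s n) - q by case: (s n).
by rewrite distrC [X in _ + X]distrC; lra.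
Unshelve. all: by end_near. Qed.

Lemma geometric_series_cvg (a : nat -> R[i]) (C k : R) : 0 <= k < 1 ->
  (forall n, cm (a n) <= C * k ^+ n) -> cvgn (series a).
Proof.
move=> /andP[k0 k1] H.
have real (b : nat -> R) : (forall n, `|b n| <= C * k ^+ n) -> cvgn (series b).
  move=> Hb; apply: normed_cvg; apply: (@series_le_cvg _ _ (geometric C k)) => //.
  - by move=> n; exact: normr_ge0.
  - by move=> n; apply: le_trans (normr_ge0 _) (Hb n).
  - by apply: is_cvg_geometric_series; rewrite ger0_norm.
have sRe n : complex.Re (series a n) = series (fun m => complex.Re (a m)) n.
  by rewrite /series /=; elim: n => [|n IH]; first (by rewrite !big_geq);
    rewrite !big_nat_recr //= -IH; case: (\sum_(_ <= _ < _) _) => ? ?; case: (a n).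
have sIm n : complex.Im (series a n) = series (fun m => complex.Im (a m)) n.
  by rewrite /series /=; elim: n => [|n IH]; first (by rewrite !big_geq);
    rewrite !big_nat_recr //= -IH; case: (\sum_(_ <= _ < _) _) => ? ?; case: (a n).
apply: cvg_complex.
  under eq_fun do rewrite sRe; apply: real => n; apply: le_trans (H n).
  by case: (modulus_parts (a n)).
under eq_fun do rewrite sIm; apply: real => n; apply: le_trans (H n).
by case: (modulus_parts (a n)).
Qed.

Lemma derivable_quadratic F z l (d M : R) : 0 < d ->
  (forall h, cm h <= d -> cm (F (h + z) - F z - l * h) <= M * cm h ^+ 2) ->
  derivable F z 1.
Proof.
move=> d0 H; apply/cvg_ex; exists l; apply/cvg_modulusP => e e0.
have M0 : 0 <= M.
  have := H d%:C; rewrite modulus_real gtr0_norm // => /(_ (lexx _)).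
  by move=> /(le_trans (modulus_ge0 _)); rewrite pmulr_lge0 // exprn_gt0.
rewrite near_withinE; pose t := Num.min d (e / (M + 1)).
have t0 : 0 < t by rewrite lt_min d0 divr_gt0 //; lra.
have tc : 0 < t%:C by rewrite ltcR.
apply: filterS (nbhsx_ballx (0 : R[i]) _ tc) => h hb h0.
have ht : cm h < t by move: hb; rewrite -ball_normE /= sub0r normrN norm_modulus ltcR.
have hn0 : h != 0 by exact: h0.
have cm0 : 0 < cm h by rewrite lt_neqAle modulus_ge0 andbT eq_sym; apply/eqP => /Normc.eq0_normc/eqP; exact/negP.
have -> : h^-1 *: (F (h *: 1 + z) - F z) - l = h^-1 * (F (h + z) - F z - l * h).
  by rewrite /GRing.scale /= mulr1 [RHS]mulrBr [l * h]mulrC (mulKf hn0).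
rewrite Normc.normcM Normc.normcV mulrC ltr_pdivrMr //.
move: ht; rewrite lt_min => /andP[hd he].
apply: le_lt_trans (H h (ltW hd)) _; rewrite expr2 mulrA ltr_pM2r //.
by move: he; rewrite ltr_pdivlMr; nra.
Qed.
End ComplexModulus.

(** * Holomorphy of power series with geometric coefficient bounds *)

Section PowerSeries.
Context {R : realType}.
Notation cm := (@Normc.normc R).
Implicit Types (z w h : R[i]).

(** In the binomial expansion every remaining term has a factor [|h| ^ j] with [j >= 1],
    respectively [j >= 2], at most [|h| / d] or its square times [d ^ j]. The two bounds are proved
    by one induction, as the second uses the first. *)
Lemma pow_increment z h (d : R) n : 0 < d -> cm h <= d ->
  cm ((h + z) ^+ n - z ^+ n) <= cm h / d * (cm z + d) ^+ n /\
  cm ((h + z) ^+ n - z ^+ n - n%:R * z ^+ n.-1 * h) <= (cm h / d) ^+ 2 * (cm z + d) ^+ n.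
Proof.
move=> d0 hd; set A := cm z + d; set t := cm h / d.
have t0 : 0 <= t by rewrite divr_ge0 ?modulus_ge0 // ltW.
have z0 := modulus_ge0 z; have h0 := modulus_ge0 h.
have A0 : 0 <= A by rewrite addr_ge0 // ltW.
have td : cm h = t * d by rewrite /t divfK // gt_eqF.
have zhA m : cm ((h + z) ^+ m) <= A ^+ m.
  rewrite modulusX; apply: lerXn2r; rewrite ?nnegrE ?modulus_ge0 //.
  by apply: le_trans (le_normcD _ _) _; rewrite addrC lerD2l.
elim: n => [|n [IH1 IH2]].
  by rewrite !expr0 subrr mul0r mul0r subr0 Normc.normc0 !mulr1 sqr_ge0.
split.
  have -> : (h + z) ^+ n.+1 - z ^+ n.+1 = h * (h + z) ^+ n + z * ((h + z) ^+ n - z ^+ n).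
    by rewrite !exprS; ring.
  apply: le_trans (le_normcD _ _) _; rewrite !Normc.normcM exprS.
  have := zhA n; have := A0; rewrite -/A.
  have p : 0 <= A ^+ n by exact: exprn_ge0.
  move=> _ ha; have h1 := ler_wpM2l h0 ha; have h2 := ler_wpM2l z0 IH1.
  apply: le_trans (lerD h1 h2) _; rewrite td [leRHS](_ : _ = t * d * A ^+ n + cm z * (t * A ^+ n)) //.
  by rewrite /A; ring.
have -> : (h + z) ^+ n.+1 - z ^+ n.+1 - n.+1%:R * z ^+ n.+1.-1 * h =
    z * ((h + z) ^+ n - z ^+ n - n%:R * z ^+ n.-1 * h) + h * ((h + z) ^+ n - z ^+ n).
  case: n {IH1 IH2} => [|n]; first by rewrite !expr0 !expr1; ring.
  by rewrite /= !exprS -[n.+2%:R]natr1; ring.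
apply: le_trans (le_normcD _ _) _; rewrite !Normc.normcM [A ^+ _]exprS.
have h1 := ler_wpM2l z0 IH2; have h2 := ler_wpM2l h0 IH1.
apply: le_trans (lerD h1 h2) _; rewrite td [leRHS](_ : _ = cm z * (t ^+ 2 * A ^+ n) + t * d * (t * A ^+ n)) //.
by rewrite /A; ring.
Qed.

Context (e : nat -> R) (C q : R) (q0 : 0 < q) (eC : forall n, `|e n| <= C * q ^+ n).

Let C0 : 0 <= C.
Proof. by apply: le_trans (normr_ge0 (e 0)) _; have := eC 0; rewrite expr0 mulr1. Qed.

Lemma power_series_cvg z : q * cm z < 1 ->
  power_series_partial e z n @[n --> \oo] --> power_series e z.
Proof.
move=> qz; suff : cvgn (power_series_partial e z) by [].
apply: (@geometric_series_cvg _ _ C (q * cm z)).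
  by rewrite qz andbT mulr_ge0 ?modulus_ge0 // ltW.
move=> n; rewrite Normc.normcM modulus_real modulusX exprMn mulrA.
by rewrite ler_wpM2r // exprn_ge0 // modulus_ge0.
Qed.

Lemma geometric_sum_le (k : R) N : 0 <= k < 1 -> \sum_(0 <= n < N) k ^+ n <= (1 - k)^-1.
Proof.
move=> /andP[k0 k1]; rewrite -[leRHS]div1r ler_pdivlMr ?subr_gt0 //.
rewrite big_mkord mulrC -opprB mulNr -subrX1 opprB lerBlDr lerDl.
exact: exprn_ge0.
Qed.

Lemma power_series_derivable z : q * cm z < 1 -> derivable (power_series e) z 1.
Proof.
move=> qz; have z0 := modulus_ge0 z; pose d := (q^-1 - cm z) / 2.
have zq : cm z < q^-1 by rewrite -[ltRHS]mul1r ltr_pdivlMr // mulrC.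
have d0 : 0 < d by rewrite divr_gt0 // subr_gt0.
pose k := q * (cm z + d).
have k01 : 0 <= k < 1.
  apply/andP; split; first by rewrite mulr_ge0 ?addr_ge0 // ltW.
  by rewrite /k mulrC -ltr_pdivlMr // div1r /d; lra.
pose b n : R[i] := (e n)%:C * (n%:R * z ^+ n.-1).
(* Coefficients of the formal derivative are bounded by [pow_increment] at [h = d]: both quantities
   there are at most [(|z| + d) ^ n], and their difference is [n * z ^ (n - 1) * d]. *)
have bC n : cm (b n) <= (2 * C / d) * k ^+ n.
  have dd : cm d%:C <= d by rewrite modulus_real gtr0_norm.
  have [h1 h2] := pow_increment z n d0 dd; rewrite modulus_real gtr0_norm // divff ?gt_eqF // in h1 h2.
  rewrite expr1n !mul1r in h1 h2.
  have : cm (n%:R * z ^+ n.-1 * d%:C) <= 2 * (cm z + d) ^+ n.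
    have -> : n%:R * z ^+ n.-1 * d%:C = ((d%:C + z) ^+ n - z ^+ n) +
      - ((d%:C + z) ^+ n - z ^+ n - n%:R * z ^+ n.-1 * d%:C) by ring.
    by apply: le_trans (le_normcD _ _) _; rewrite normcN; lra.
  rewrite Normc.normcM modulus_real gtr0_norm // -ler_pdivlMr // => h3.
  rewrite Normc.normcM modulus_real.
  apply: le_trans (ler_pM (normr_ge0 _) (modulus_ge0 _) (eC n) h3) _.
  by rewrite /k exprMn le_eqVlt; apply/orP; left; apply/eqP; ring.
have cb := geometric_series_cvg k01 bC.
pose l := limn (series b).
apply: (@derivable_quadratic _ _ _ l d (C / (1 - k) / d ^+ 2)) => // h hd.
have qhz : q * cm (h + z) < 1.
  case/andP: k01 => _; apply: le_lt_trans; rewrite /k ler_pM2l //.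
  by apply: le_trans (le_normcD _ _) _; lra.
pose T n : R[i] := (e n)%:C * ((h + z) ^+ n - z ^+ n - n%:R * z ^+ n.-1 * h).
have lim : series T n @[n --> \oo] --> power_series e (h + z) - power_series e z - l * h.
  have -> : series T = (fun n => power_series_partial e (h + z) n - power_series_partial e z n - series b n * h).
    apply/funext => N; rewrite /power_series_partial /series /= mulr_suml -!sumrB.
    by apply: eq_bigr => n _; rewrite /T /b; ring.
  apply: (@cvgB _ R[i]^o); first by apply: (@cvgB _ R[i]^o); exact: power_series_cvg.
  by apply: (@cvgM R[i]); [exact: cb|exact: cvg_cst].
apply: (cvg_modulus_le lim) => N.
have bnd M : cm (series T M) <= \sum_(0 <= n < M) C * (cm h / d) ^+ 2 * k ^+ n.
  rewrite /series /=; elim: M => [|M IH]; first by rewrite !big_geq // Normc.normc0.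
  rewrite !big_nat_recr //=; apply: le_trans (le_normcD _ _) _; apply: lerD IH _.
  have [_ h2] := pow_increment z M d0 hd; rewrite Normc.normcM modulus_real.
  apply: le_trans (ler_pM (normr_ge0 _) (modulus_ge0 _) (eC M) h2) _.
  by rewrite /k [(q * _) ^+ M]exprMn le_eqVlt; apply/orP; left; apply/eqP; ring.
apply: le_trans (bnd N) _; rewrite -mulr_sumr.
have h0 : 0 <= C * (cm h / d) ^+ 2 by rewrite mulr_ge0 // sqr_ge0.
apply: le_trans (ler_wpM2l h0 (geometric_sum_le N k01)) _.
by rewrite expr_div_n le_eqVlt; apply/orP; left; apply/eqP; ring.
Qed.
End PowerSeries.

(** * Continuation of an almost periodic coefficient sequence *)

Section MeromorphicContinuation.
Context {R : realType}.
Notation cm := (@Normc.normc R).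
Implicit Types (F G : R[i] -> R[i]) (z w : R[i]).

Lemma complex_derivableM F G z : derivable F z 1 -> derivable G z 1 ->
  derivable ((fun w => F w * G w) : R[i] -> R[i]) z 1.
Proof. by move=> dF dG; exact: (@derivableM _ _ (F : R[i] -> R[i]^o) (G : R[i] -> R[i]^o) z 1 dF dG). Qed.

Lemma complex_derivable_continuous F z : derivable F z 1 -> {for z, continuous F}.
Proof. by move=> dF; exact/differentiable_continuous/derivable1_diffP. Qed.

Lemma complex_derivable_div F G z : derivable F z 1 -> derivable G z 1 -> G z != 0 ->
  derivable ((fun w => F w / G w) : R[i] -> R[i]) z 1.
Proof. by move=> dF dG G0; exact: complex_derivableM dF (derivableV G0 dG). Qed.

Lemma polynomial_derivable (n : nat) (a : nat -> R[i]) z :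
  derivable ((fun w => \sum_(i < n) a i * w ^+ i) : R[i] -> R[i]) z 1.
Proof.
have dX k : derivable ((fun w => w ^+ k) : R[i] -> R[i]) z 1.
  elim: k => [|k IH]; first exact: derivable_cst.
  have -> : (fun w : R[i] => w ^+ k.+1) = (fun w => w * w ^+ k).
    by apply/funext => w; rewrite exprS.
  exact: (@complex_derivableM id (fun w => w ^+ k) z (@derivable_id _ R[i] z 1) IH).
elim: n => [|n IH].
  have -> : (fun w : R[i] => \sum_(i < 0) a i * w ^+ i) = cst 0.
    by apply/funext => w; rewrite big_ord0.
  exact: derivable_cst.
have -> : (fun w : R[i] => \sum_(i < n.+1) a i * w ^+ i) =
    (fun w => \sum_(i < n) a i * w ^+ i) + (fun w => a n * w ^+ n).
  by apply/funext => w; rewrite big_ord_recr.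
exact: (@derivableD _ _ R[i] _ _ z 1 IH (@complex_derivableM (cst (a n)) (fun w => w ^+ n) z (@derivable_cst _ _ R[i] (a n) z 1) (dX n))).
Qed.

Lemma near_nonzero F z : {for z, continuous F} -> F z != 0 -> \forall w \near z, F w != 0.
Proof. by move=> cF F0; exact: (cvgr_neq0 _ cF). Qed.

Lemma near_modulus z (q : R) : 0 < q -> q * cm z < 1 -> \forall w \near z, q * cm w < 1.
Proof.
move=> q0; rewrite mulrC -ltr_pdivlMr // div1r => zq.
have d0 : 0 < (q^-1 - cm z)%:C by rewrite ltcR subr_gt0.
apply: filterS (nbhsx_ballx z _ d0) => w; rewrite -ball_normE /= norm_modulus ltcR => zw.
rewrite mulrC -ltr_pdivlMr // div1r -[w](subrK z); apply: le_lt_trans (le_normcD _ _) _.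
by rewrite modulusB -ltrBrDr.
Qed.

(* Abel summation turns the polynomial of one period into its mean plus a
   multiple of [1 - z]. *)
Lemma abel_summation (t : nat -> R[i]) z n :
  \sum_(i < n) t i * z ^+ i =
  (1 - z) * \sum_(i < n) (\sum_(j < i.+1) t j) * z ^+ i + (\sum_(j < n) t j) * z ^+ n.
Proof.
elim: n => [|n IH]; first by rewrite !big_ord0 mulr0 mul0r addr0.
rewrite [LHS]big_ord_recr /= IH [in RHS]big_ord_recr /= exprS.
by rewrite [\sum_(j < n.+1) t j]big_ord_recr /=; ring.
Qed.

(** The series is its first period plus [z ^+ n1] times itself. *)
Lemma periodic_power_series (p : nat -> R) n1 B z : (forall n, p (n + n1)%N = p n) ->
  (forall n, `|p n| <= B) -> cm z < 1 ->
  power_series p z * (1 - z ^+ n1) = \sum_(i < n1) (p i)%:C * z ^+ i.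
Proof.
move=> per pB z1.
have cp : power_series_partial p z n @[n --> \oo] --> power_series p z.
  apply: (@power_series_cvg _ p B 1) => //; last by rewrite mul1r.
  by move=> n; rewrite expr1n mulr1.
have sE M : power_series_partial p z (M + n1)%N =
    \sum_(i < n1) (p i)%:C * z ^+ i + z ^+ n1 * power_series_partial p z M.
  rewrite /power_series_partial /series /= (@big_cat_nat _ _ _ n1) //=; last exact: leq_addl.
  rewrite big_mkord; congr (_ + _).
  rewrite -{1}[n1]add0n big_addn addnK mulr_sumr; apply: eq_bigr => i _.
  by rewrite per exprD; ring.
have l1 : power_series_partial p z (M + n1)%N @[M --> \oo] --> power_series p z.
  by rewrite (cvg_shiftn n1 (power_series_partial p z)).
have l2 : power_series_partial p z (M + n1)%N @[M --> \oo] -->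
    \sum_(i < n1) (p i)%:C * z ^+ i + z ^+ n1 * power_series p z.
  under eq_fun do rewrite sE; apply: (@cvgD _ R[i]^o); first exact: cvg_cst.
  by apply: (@cvgM R[i]); [exact: cvg_cst|exact: cp].
have e := @cvg_unique _ (@norm_hausdorff _ R[i]^o) _ _ _ _ l1 l2.
by rewrite mulrBr mulr1 {1}e [z ^+ n1 * _]mulrC addrK.
Qed.

(** The error [u - p] gives a series holomorphic in the disc of radius [q^-1]; the periodic part is
    a polynomial over [1 - z ^+ n1], whose pole at 1 is isolated by Abel summation. *)
Lemma meromorphic_continuation (u p : nat -> R) (n1 : nat) (C q : R) :
  (0 < n1)%N -> 0 < q < 1 -> (forall n, p (n + n1)%N = p n) ->
  (forall n, `|u n - p n| <= C * q ^+ n) ->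
  (forall z, disc 1 z -> cvgn (power_series_partial u z)) /\
  exists2 r : R, 1 < r & exists F : R[i] -> R[i],
    [/\ meromorphic_on (disc r) F,
        forall z, disc 1 z -> F z = power_series u z,
        (forall n, p n = 0) ->
          [/\ holomorphic_on (disc r) F, F z @[z --> (1 : R[i])^'] --> F 1 &
              ((\sum_(0 <= n < k.+1) u n)%:C : R[i]) @[k --> \oo] --> F 1] &
        at_most_simple_pole F 1 (n1%:R^-1 * \sum_(i < n1) p i)%:C /\
        (n1%:R^-1 * \sum_(i < n1) p i = 0 ->
          holomorphic_at F 1 /\ power_series u t%:C @[t --> (1 : R)^'-] --> F 1)].
Proof.
move=> n1_gt0 /andP[q0 q1] per eC; pose e n := u n - p n.
pose m := n1%:R^-1 * \sum_(i < n1) p i; pose E := power_series e.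
have n1C : n1%:R != 0 :> R by rewrite pnatr_eq0 -lt0n.
have [B pB] : exists B, forall n, `|p n| <= B.
  have pmod n : p n = p (n %% n1)%N.
    rewrite [in LHS](divn_eq n n1); elim: (n %/ n1)%N => [|k IH]; first by rewrite add0n.
    by rewrite mulSn -addnA addnC per.
  exists (\sum_(i < n1) `|p i|) => n; rewrite pmod.
  rewrite (bigD1 (Ordinal (ltn_pmod n n1_gt0))) //= lerDl; exact: sumr_ge0.
pose t i : R[i] := (p i - m)%:C; pose s i : R[i] := \sum_(j < i.+1) t j.
pose N z : R[i] := \sum_(i < n1) (1 : R[i]) * z ^+ i; pose S z : R[i] := \sum_(i < n1) s i * z ^+ i.
pose P z : R[i] := \sum_(i < n1) (p i)%:C * z ^+ i.
(* With [S / N] in place of [P / (1 - z ^+ n1)] the value [F 1] is the right one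
   when the mean [m] vanishes. *)
pose F z : R[i] := m%:C / (1 - z) + (S z / N z + E z).
have EN z : (1 - z) * N z = 1 - z ^+ n1.
  rewrite -opprB mulNr -[in RHS]opprB subrX1; congr (- (_ * _)).
  by apply: eq_bigr => i _; rewrite mul1r.
have EP z : P z = m%:C * N z + (1 - z) * S z.
  have t0 : \sum_(j < n1) t j = 0.
    rewrite -rmorph_sum sumrB sumr_const card_ord -[m *+ _]mulr_natl /m mulrA divff // mul1r subrr.
    by rewrite rmorph0.
  have := abel_summation t z n1; rewrite t0 mul0r addr0 => <-.
  rewrite /P /N mulr_sumr -big_split /=; apply: eq_bigr => i _.
  by rewrite /t rmorphB /=; ring.
have FP z : 1 - z ^+ n1 != 0 -> F z = P z / (1 - z ^+ n1) + E z.
  rewrite -EN mulf_eq0 negb_or => /andP[z0 N0]; rewrite /F addrA; congr (_ + _).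
  by rewrite addf_div // EP [S z * _]mulrC.
have disc1 z : disc 1 z -> cm z < 1 by rewrite /disc /= norm_modulus ltcR.
have discq z : disc q^-1 z -> q * cm z < 1.
  by rewrite /disc /= norm_modulus ltcR mulrC -ltr_pdivlMr // div1r.
have cm1 : cm 1 = 1 by exact: Normc.normc1.
have qle z : cm z <= 1 -> q * cm z < 1 by have := modulus_ge0 z; nra.
have useries z : cm z < 1 ->
    power_series_partial u z n @[n --> \oo] --> power_series p z + power_series e z.
  move=> z1; have -> : power_series_partial u z = (fun n => power_series_partial p z n + power_series_partial e z n).
    apply/funext => n; rewrite /power_series_partial /series /= -big_split /=.
    by apply: eq_bigr => i _; rewrite /e rmorphB /=; ring.
  apply: (@cvgD _ R[i]^o); last exact: (power_series_cvg q0 eC (qle _ (ltW z1))).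
  apply: (@power_series_cvg _ p B 1) => //; last by rewrite mul1r.
  by move=> n; rewrite expr1n mulr1.
have usum z : cm z < 1 -> power_series u z = power_series p z + power_series e z.
  by move=> /useries; apply: cvg_lim; exact: (@norm_hausdorff _ R[i]^o).
have dE z : q * cm z < 1 -> derivable E z 1 by exact: (power_series_derivable q0 eC).
have dN z : derivable N z 1 by exact: (@polynomial_derivable n1 (fun=> 1) z).
have dS z : derivable S z 1 by exact: (@polynomial_derivable n1 s z).
have dP z : derivable P z 1 by exact: (@polynomial_derivable n1 (fun i => (p i)%:C) z).
have dD z : derivable ((fun w => 1 - w ^+ n1) : R[i] -> R[i]) z 1.
  have -> : (fun w : R[i] => 1 - w ^+ n1) = (fun w => (1 - w) * N w).
    by apply/funext => w; rewrite EN.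
  exact: (complex_derivableM (@derivableB _ _ R[i] _ _ z 1 (@derivable_cst _ _ R[i] (1 : R[i]) z 1)
    (@derivable_id _ R[i] z 1)) (dN z)).
have N1 : N 1 != 0.
  rewrite /N; under eq_bigr do rewrite expr1n mulr1.
  by rewrite sumr_const card_ord pnatr_eq0 -lt0n.
pose G z : R[i] := S z / N z + E z.
have dG z : N z != 0 -> q * cm z < 1 -> derivable G z 1.
  move=> Nz qz; exact: (@derivableD _ _ R[i] _ _ z 1 (complex_derivable_div (dS z) (dN z) Nz) (dE z qz)).
have q11 : q * cm 1 < 1 by rewrite cm1 mulr1.
have hG : holomorphic_at G 1.
  have n2 := near_modulus q0 q11.
  have n3 := near_nonzero (complex_derivable_continuous (dN 1)) N1.
  by apply: filterS2 n2 n3 => w; move=> *; exact: dG.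
have FPsi z : disc 1 z -> F z = power_series u z.
  move=> /disc1 z1; have z0 : 1 - z ^+ n1 != 0.
    rewrite subr_eq0; apply/eqP => /(congr1 cm); rewrite cm1 modulusX => /esym.
    have := exprn_ilt1 n1 (modulus_ge0 z) z1; rewrite -lt0n n1_gt0 => + h.
    by rewrite h ltxx.
  rewrite FP // usum //; congr (_ + _).
  by rewrite /P -(periodic_power_series per pB z1) mulfK.
split=> [z /disc1/useries|]; first by move=> h; apply/cvg_ex; eexists; exact: h.
exists q^-1; first by rewrite invf_gt1.
exists F; split; [|exact: FPsi| |].
- move=> z /discq qz; have [z0|z0] := eqVneq (1 - z ^+ n1) 0; last first.
    exists 0%N, (fun w => P w / (1 - w ^+ n1) + E w).
    have n3 := near_nonzero (complex_derivable_continuous (dD z)) z0; split.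
      apply: filterS2 (near_modulus q0 qz) n3 => w qw w0.
      exact: (@derivableD _ _ R[i] _ _ w 1 (complex_derivable_div (dP w) (dD w) w0) (dE w qw)).
    by apply: filterS (nbhs_dnbhs n3) => w w0; rewrite expr0 mul1r FP.
  have zn : z ^+ n1 = 1 by apply/eqP; rewrite eq_sym -subr_eq0 z0.
  have z_neq0 : z != 0.
    by apply/eqP => z00; move: zn; rewrite z00 expr0n gtn_eqF // => /eqP; rewrite eq_sym oner_eq0.
  (* At an [n1]-th root of unity, [1 - w ^+ n1] factors as [(z - w) * Q w] with
     [Q z = n1 * z ^+ (n1 - 1)] nonzero, so one factor [w - z] removes the pole. *)
  pose Q w : R[i] := \sum_(i < n1) (z ^+ (n1.-1 - i)) * w ^+ i.
  have EQ w : 1 - w ^+ n1 = (z - w) * Q w by rewrite -zn subrXX.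
  have Qz : Q z != 0.
    rewrite /Q (eq_bigr (fun=> z ^+ n1.-1)) => [|i _].
      by rewrite sumr_const card_ord -[_ *+ _]mulr_natl mulf_neq0 ?pnatr_eq0 -?lt0n ?expf_neq0.
    by rewrite -exprD subnK // -ltnS prednK.
  have dQ w : derivable Q w 1 by exact: (@polynomial_derivable n1 (fun i => z ^+ (n1.-1 - i)) w).
  have n3 := near_nonzero (complex_derivable_continuous (dQ z)) Qz.
  exists 1%N, (fun w => (- 1) * (P w / Q w) + (w - z) * E w); split.
    apply: filterS2 (near_modulus q0 qz) n3 => w qw w0.
    have d1 := complex_derivableM (@derivable_cst _ _ R[i] (- 1 : R[i]) w 1)
      (complex_derivable_div (dP w) (dQ w) w0).
    have d2 := complex_derivableM (@derivableB _ _ R[i] _ _ w 1 (@derivable_id _ R[i] w 1)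
      (@derivable_cst _ _ R[i] z w 1)) (dE w qw).
    exact: (@derivableD _ _ R[i] _ _ w 1 d1 d2).
  apply: filterS2 (nbhs_dnbhs n3) (nbhs_dnbhs_neq z) => w Qw wz.
  have zw : z - w != 0 by rewrite subr_eq0 eq_sym.
  rewrite expr1 FP EQ ?mulf_neq0 // mulrDr; congr (_ + _).
  rewrite invfM mulN1r -[w - z]opprB mulNr; congr (- _).
  by rewrite [P w * _]mulrCA mulVKf.
- move=> p0; have FE : F = E.
    have m0 : m = 0 by rewrite /m big1 ?mulr0.
    apply/funext => w; rewrite /F m0 rmorph0 mul0r add0r [S w]big1 ?mul0r ?add0r // => i _.
    by rewrite /s big1 ?mul0r // => j _; rewrite /t m0 p0 subrr rmorph0.
  rewrite FE; split.
  + by move=> z /discq; exact: dE.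
  + exact: cvg_within_filter (complex_derivable_continuous (dE 1 q11)).
  + have := power_series_cvg q0 eC q11; rewrite -(cvg_shiftS (power_series_partial e 1)).
    suff -> : [sequence power_series_partial e 1 n.+1]_n = (fun k => (\sum_(0 <= n < k.+1) u n)%:C) by [].
    apply/funext => k; rewrite /power_series_partial /series /= rmorph_sum.
    by apply: eq_bigr => i _; rewrite expr1n mulr1 /e p0 subr0.
- split; first by exists G; split; [exact: hG|apply: nearW => w].
  rewrite -/m => m0; have FG : F = G by apply/funext => w; rewrite /F m0 rmorph0 mul0r add0r.
  rewrite FG; split; first exact: hG.
  have cG : {for 1, continuous G} := complex_derivable_continuous (nbhs_singleton hG).
  have r1 : t%:C @[t --> (1 : R)^'-] --> (1 : R[i]).
    by apply: (@cvg_real_complex _ _ _ _ id 1); apply: cvg_at_left_filter; exact: cvg_id.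
  apply: (@cvg_trans _ (G t%:C @[t --> (1 : R)^'-])); last exact: cvg_comp r1 cG.
  apply: near_eq_cvg; near=> x; rewrite -FG FPsi // /disc /= norm_modulus modulus_real ltcR.
  have x1 : x < 1 by near: x; exact: nbhs_left_lt.
  have x0 : -1 < x by near: x; apply: nbhs_left_gt; lra.
  by rewrite ltr_norml x0.
Unshelve. all: by end_near. Qed.
End MeromorphicContinuation.

(** * The residue *)

Section PeriodicSequences.
Context {R : realType}.

Lemma periodic_sum (g : nat -> R) (n1 M : nat) : (forall n, g (n + n1)%N = g n) ->
  \sum_(i < n1) g (i + M)%N = \sum_(i < n1) g i.
Proof.
move=> per; elim: M => [|M IH]; first by apply: eq_bigr => i _; rewrite addn0.
rewrite -IH; case: n1 per {IH} => [|n] per; first by rewrite !big_ord0.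
rewrite big_ord_recr [RHS]big_ord_recl /= addrC; congr (_ + _).
  by rewrite add0n -[RHS]per; congr g; lia.
by apply: eq_bigr => i _; congr g; rewrite /bump /=; lia.
Qed.

(** For [m = n0 + r] the index condition says that [k - 1] is [r] modulo [n1]; for [n1 = 1] this
    holds for every [k], in line with the separate definition there. *)
Lemma partial_jumpE (c : R) (f X rho : R -> R) (n0 n1 r : nat) : (r < n1)%N ->
  partial_jump c f X rho n0 n1 (n0 + r) =
  \sum_(1 <= k < n0 + n1 | (k.-1 %% n1 == r)%N) jump c f rho k * X (iter k f c).
Proof.
move=> rn; rewrite /partial_jump /total_jump; case: eqP => [n11|_].
  move: rn; rewrite n11 ltnS leqn0 => /eqP ->.
  by apply: eq_bigl => k; rewrite modn1.
rewrite [LHS]big_nat_cond [RHS]big_nat_cond; apply: eq_big => [k|k _]; last exact: mulrC.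
case: k => //= k; congr (_ && _); apply/asboolP/eqP => [[l]|e].
  rewrite addnC -addnA => /addnI ->.
  by rewrite addnC modnMDl modn_small.
exists (k %/ n1)%N; rewrite [in LHS](divn_eq k n1) e; lia.
Qed.

Lemma sum_by_residue (a G : nat -> R) (n1 N : nat) : (0 < n1)%N ->
  (forall k, G (k + n1)%N = G k) ->
  \sum_(1 <= k < N) a k * G k.-1 =
  \sum_(r < n1) G r * \sum_(1 <= k < N | (k.-1 %% n1 == r)%N) a k.
Proof.
move=> n1_gt0 per.
have Gmod k : G k = G (k %% n1)%N.
  rewrite [in LHS](divn_eq k n1); elim: (k %/ n1)%N => [|l IH]; first by rewrite add0n.
  by rewrite mulSn -addnA addnC per.
rewrite (partition_big (fun k => Ordinal (ltn_pmod k.-1 n1_gt0)) xpredT) //=.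
apply: eq_bigr => r _; rewrite mulr_sumr; apply: eq_bigr => k /eqP <-.
by rewrite mulrC -Gmod.
Qed.
(** Finitely many nonzero terms cost only a larger constant, the sum of [|d i| / q ^+ i]. *)
Lemma geometric_error (d : nat -> R) (q : R) (K : nat) : 0 < q ->
  (forall n, (K <= n)%N -> d n = 0) -> exists2 W, 0 <= W & forall n, `|d n| <= W * q ^+ n.
Proof.
move=> q0 dK; exists (\sum_(i < K) `|d i| / q ^+ i).
  by apply: sumr_ge0 => i _; rewrite divr_ge0 // exprn_ge0 // ltW.
move=> n; have [Kn|nK] := leqP K n.
  rewrite dK // normr0 mulr_ge0 ?exprn_ge0 ?(ltW q0) //.
  by apply: sumr_ge0 => i _; rewrite divr_ge0 // exprn_ge0 // ltW.
rewrite -ler_pdivrMr ?exprn_gt0 // (bigD1 (Ordinal nK)) //= lerDl.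
by apply: sumr_ge0 => i _; rewrite divr_ge0 // exprn_ge0 // ltW.
Qed.
End PeriodicSequences.

Theorem theorem5p2 (R : realType) (a b c a0 : R)
    (f psip psim rho0 X phi : R -> R) (n0 n1 : nat)
    (hf : expanding_unimodal a b c f)
    (hrho0 : regular_invariant_density a b c f rho0)
    (hpsi : inverse_branches a b c f psip psim)
    (ha0 : a0 <= a /\ unique_fixed_point `]-oo, f c] psip a0)
    (hX : perturbation_field a b f X)
    (hn0 : (2 <= n0)%N)
    (hn1 : minimal_period f (iter n0 f c) n1)
    (hmin : forall k, (k < n0)%N -> ~ periodic_point f (iter k f c))
    (hphi : extends_Ck 1 `[a0, b] phi) :
  let u := Psi_coef a0 b c f psip psim X rho0 phi in
  let Psi := power_series u in
  let J := total_jump c f X rho0 n0 n1 in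
  (forall z : R[i], disc 1 z -> cvgn (power_series_partial u z)) /\
  exists r : R, 1 < r /\ exists F : R[i] -> R[i],
    [/\ meromorphic_on (disc r) F,
        forall z, disc 1 z -> F z = Psi z,
        (forall m, (n0 <= m < n0 + n1)%N ->
            partial_jump c f X rho0 n0 n1 m = 0) ->
          [/\ exists2 r' : R, 1 < r' & holomorphic_on (disc r') F,
              F z @[z --> (1 : R[i])^'] --> F 1
            & ((\sum_(0 <= n < k.+1) u n)%:C : R[i]) @[k --> \oo] --> F 1]
      & at_most_simple_pole F 1
          (J * (\int[lebesgue_measure]_(x in `[a0, b]) (phi x * rho0 x)
                - n1%:R^-1 * \sum_(n0 <= j < n0 + n1) phi (iter j f c)))%:C /\
        (J = 0 ->
          holomorphic_at F 1 /\ Psi t%:C @[t --> (1 : R)^'-] --> F 1)].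
Proof.
move=> u Psi J; have [a0a _] := ha0.
have [q q01 [C C0 uE]] := coefficient_expansion hf hpsi hn0 hn1 hmin hrho0 hX a0a hphi.
have n1_gt0 : (0 < n1)%N by case: hn1.
pose A := \int[lebesgue_measure]_(x in `[a0, b]) (phi x * rho0 x).
pose j k := jump c f rho0 k * X (iter k f c).
pose g n := phi (iter (n + n0) f c).
have gper n : g (n + n1)%N = g n by rewrite /g addnAC (orbit_shift hn1).
pose v n := J * A - \sum_(1 <= k < n0 + n1) j k * phi (iter (n + k) f c).
(* The main term [v] is periodic only from [n0] on; shifting by [n0 * n1], a multiple of the period
   past the preperiod, makes it periodic from the start. The index through [k.-1] is the one
   [sum_by_residue] expects, and [n0 <= n0 * n1] keeps the subtraction exact. *)
pose p n := J * A - \sum_(1 <= k < n0 + n1) j k * g (k.-1 + (n + n0 * n1 - n0).+1)%N.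
have le_n : (n0 <= n0 * n1)%N by rewrite leq_pmulr.
have pE n : p n = v (n + n0 * n1)%N.
  congr (_ - _); rewrite big_nat_cond [RHS]big_nat_cond.
  apply: eq_bigr => k; rewrite andbT => /andP[k0 _]; rewrite /g; congr (_ * phi (iter _ _ _)).
  by move: le_n k0; move: (n0 * n1)%N => M; lia.
have vper n : (n0 <= n)%N -> v (n + n1)%N = v n.
  move=> n0n; congr (_ - _); apply: eq_bigr => k _; congr (_ * _).
  have := gper (n + k - n0)%N; rewrite /g subnK ?(leq_trans n0n) ?leq_addr // => <-.
  by congr (phi (iter _ _ _)); move: n0n; lia.
have vperM n m : (n0 <= n)%N -> v (n + m * n1)%N = v n.
  move=> n0n; elim: m => [|m IH]; first by rewrite addn0.
  by rewrite mulSn [(n1 + _)%N]addnC addnA vper // (leq_trans n0n) // leq_addr.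
have pper n : p (n + n1)%N = p n.
  by rewrite !pE addnAC vper // (leq_trans le_n) // leq_addl.
have /andP[q0 q1] := q01.
have vp n : (n0 <= n)%N -> v n - p n = 0 by move=> n0n; rewrite pE vperM // subrr.
have [W W0 HW] := geometric_error q0 vp.
have eC n : `|u n - p n| <= (C + W) * q ^+ n.
  have -> : u n - p n = (u n - v n) + (v n - p n) by ring.
  rewrite mulrDl; apply: le_trans (ler_normD _ _) _; apply: lerD; [exact: uE|exact: HW].
(* For each [k] the sum of [g] over a period is independent of its starting index, so every jump
   sees the same mean of [phi] over the cycle. *)
have mean : n1%:R^-1 * \sum_(i < n1) p i =
    J * (A - n1%:R^-1 * \sum_(n0 <= j < n0 + n1) phi (iter j f c)).
  have n1C : n1%:R != 0 :> R by rewrite pnatr_eq0 -lt0n.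
  have gsum : \sum_(n0 <= i < n0 + n1) phi (iter i f c) = \sum_(i < n1) g i.
    by rewrite -{1}[n0]add0n big_addn addKn big_mkord.
  have -> : \sum_(i < n1) p i = n1%:R * (J * A) - J * \sum_(i < n1) g i.
    rewrite sumrB sumr_const card_ord mulr_natl exchange_big /=; congr (_ - _).
    rewrite /J /total_jump mulr_suml; apply: eq_bigr => k _; rewrite -mulr_sumr; congr (_ * _).
    rewrite -(periodic_sum (k.-1 + (n0 * n1 - n0).+1) gper); apply: eq_bigr => i _.
    by congr g; move: le_n; move: (n0 * n1)%N => M; lia.
  by rewrite gsum; field.
have p_zero : (forall m, (n0 <= m < n0 + n1)%N -> partial_jump c f X rho0 n0 n1 m = 0) ->
    forall n, p n = 0.
  move=> pj n.
  have res (G : nat -> R) : (forall k, G (k + n1)%N = G k) ->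
      \sum_(1 <= k < n0 + n1) j k * G k.-1 = 0.
    move=> Gper; rewrite (sum_by_residue _ _ n1_gt0 Gper) big1 // => r _.
    by rewrite -(partial_jumpE c f X rho0 n0 (ltn_ord r)) pj ?mulr0 // leq_addr ltn_add2l ltn_ord.
  (* The constant weight adds up all residue classes, so vanishing partial jumps also kill the total
     jump. *)
  have J0 : J = 0.
    have := res (fun=> 1) (fun=> erefl); under eq_bigr do rewrite mulr1.
    by move=> <-.
  by rewrite /p J0 mul0r sub0r (res (fun k => g (k + (n + n0 * n1 - n0).+1)%N)) ?oppr0 // => k; rewrite addnAC gper.
have [cv [r r1 [F [mer FPsi case1 [pole case2]]]]] :=
  meromorphic_continuation n1_gt0 q01 pper eC.
split=> //; exists r; split=> //; exists F; split=> //.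
- by move=> /p_zero/case1[h1 h2 h3]; split => //; exists r.
- by rewrite -mean; split => // J0; apply: case2; rewrite mean J0 mul0r.
Qed.
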